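(* Let $M$ be an $n$-dimensional Cartan-Hadamard manifold, and let $o\in M$ be a fixed (arbitrary) pole. Also assume that the sectional curvatures of $M$ satisfy, for all $x\in M$ and all two-dimensional subspaces $\sigma\subset T_xM$, $-c_m\le\mathcal{K}(x;\sigma)\le0$, where $c_m$ is a positive constant. Then, if $\rho\in\mathcal{P}_{ac}(M)$ and $\int_M\log(1+|\theta_x|^2)\rho(x)\,\mathrm{d}x<\infty$, we have $$-\int_M\int_M\log(d(x,y))\rho(x)\rho(y)\,\mathrm{d}x\,\mathrm{d}y\le\frac1n\int_M\rho(x)\log\rho(x)\,\mathrm{d}x+\frac{n-1}{n}\int_M\log\left(\frac{\sinh(\sqrt{c_m}\,\theta_x)}{\sqrt{c_m}\,\theta_x}\right)\rho(x)\,\mathrm{d}x+C_0,$$ where $C_0\in\mathbb{R}$ is the constant, depending only on $n$, of the logarithmic Hardy-Littlewood-Sobolev inequality on $\mathbb{R}^n$.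
   Context: A Cartan-Hadamard manifold is a complete, simply connected Riemannian manifold with everywhere non-positive sectional curvature. A pole is a point at which the exponential map is a global diffeomorphism; on a Cartan-Hadamard manifold every point is a pole. $d$ is the geodesic distance, $\theta_x:=d(o,x)$, $\mathcal{K}(x;\sigma)$ the sectional curvature of $\sigma$ at $x$, $\mathrm{d}x$ the Riemannian volume measure, and $\mathcal{P}_{ac}(M)$ the set of probability measures on $M$ absolutely continuous with respect to $\mathrm{d}x$, identified with their densities. The logarithmic Hardy-Littlewood-Sobolev inequality on $\mathbb{R}^n$ (known) states: if $\rho\in\mathcal{P}_{ac}(\mathbb{R}^n)$ satisfies $\log(1+|\cdot|^2)\rho\in L^1(\mathbb{R}^n)$, then there exists $C_0\in\mathbb{R}$ depending only on $n$ such that $$-\int_{\mathbb{R}^n}\int_{\mathbb{R}^n}\log(|x-y|)\rho(x)\rho(y)\,\mathrm{d}x\,\mathrm{d}y\le\frac1n\int_{\mathbb{R}^n}\rho(x)\log\rho(x)\,\mathrm{d}x+C_0.$$ *)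

(* Defs.v *)
From HB Require Import structures.
From mathcomp Require Export all_boot all_order all_algebra.
From mathcomp Require Export all_classical all_reals all_analysis.

Set Implicit Arguments.
Unset Strict Implicit.
Unset Printing Implicit Defensive.

Export Order.TTheory GRing.Theory Num.Theory.
Export numFieldNormedType.Exports.

Local Open Scope classical_set_scope.
Local Open Scope ring_scope.

Definition sinh {R : realType} (x : R) : R := (expR x - expR (- x)) / 2.

(** * Smooth functions on open subsets of R^n *)

(* The library norm `|x| on 'rV[R]_n is the sup norm; it is used only through
   the topology and the derivatives that it induces. *)
Definition l2norm {R : realType} {n : nat} (x : 'rV[R]_n) : R :=
  Num.sqrt (\sum_(i < n) x 0 i ^+ 2).

Definition basis_vec {R : realType} {n : nat} (i : 'I_n) : 'rV[R]_n :=
  delta_mx 0 i.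

Definition partial {R : realType} {n : nat} (i : 'I_n) (f : 'rV[R]_n -> R) :
  'rV[R]_n -> R := fun p => 'D_(basis_vec i) f p.

Fixpoint Ck_on {R : realType} {n : nat} (k : nat) (U : set 'rV[R]_n)
    (f : 'rV[R]_n -> R) : Prop :=
  (forall p, U p -> {for p, continuous f}) /\
  match k with
  | 0 => True
  | k'.+1 => forall i : 'I_n,
      (forall p, U p -> derivable f p (basis_vec i)) /\
      Ck_on k' U (partial i f)
  end.

Definition smooth_on {R : realType} {n : nat} (U : set 'rV[R]_n)
  (f : 'rV[R]_n -> R) : Prop := forall k, Ck_on k U f.

Definition smooth_map_on {R : realType} {n m : nat} (U : set 'rV[R]_n)
    (f : 'rV[R]_n -> 'rV[R]_m) : Prop :=
  forall j : 'I_m, smooth_on U (fun p => f p 0 j).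

(** * Riemannian manifolds *)

(* A smooth manifold is given by a (not necessarily maximal) smooth atlas, and
   the metric tensor by its matrix in each chart, as a function of the
   coordinates.  The values of [coord i], [coordV i] and [metric i] outside
   [dom i], resp. its image [cod i], are irrelevant.  Since the jacobian ['J]
   acts on row vectors on the right, [metric_change] is the usual tensor rule
   g_i(u, v) = g_j(dt u, dt v), t being the transition map. *)
Record riemannianManifold (R : realType) (n : nat) := RiemannianManifold {
  carrier :> ptopologicalType ;
  carrier_hausdorff : hausdorff_space carrier ;
  carrier_second_countable : @second_countable carrier ;
  chart : Type ;
  dom : chart -> set carrier ;
  coord : chart -> carrier -> 'rV[R]_n ;
  coordV : chart -> 'rV[R]_n -> carrier ;
  cod := fun i : chart => coord i @` dom i ;
  dom_open : forall i, open (dom i) ;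
  cod_open : forall i, open (cod i) ;
  coordK : forall i x, dom i x -> coordV i (coord i x) = x ;
  coord_continuous : forall i x, dom i x -> {for x, continuous (coord i)} ;
  coordV_continuous : forall i p, cod i p -> {for p, continuous (coordV i)} ;
  chart_at : carrier -> chart ;
  chart_atP : forall x, dom (chart_at x) x ;
  transition_smooth : forall i j,
    smooth_map_on (coord i @` (dom i `&` dom j)) (coord j \o coordV i) ;
  metric : chart -> 'rV[R]_n -> 'M[R]_n ;
  metric_smooth : forall i (a b : 'I_n),
    smooth_on (cod i) (fun p => metric i p a b) ;
  metric_sym : forall i p, cod i p -> (metric i p)^T = metric i p ;
  metric_pos : forall i p, cod i p -> forall v : 'rV[R]_n, v != 0 ->
    0 < (v *m metric i p *m v^T) 0 0 ;
  metric_change : forall i j p, (coord i @` (dom i `&` dom j)) p ->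
    metric i p = 'J (coord j \o coordV i) p *m
      metric j ((coord j \o coordV i) p) *m ('J (coord j \o coordV i) p)^T
}.

(** * Curvature *)

Section curvature.
Context {R : realType} {n : nat}.
Variable g : 'rV[R]_n -> 'M[R]_n.

(* Gamma^k_{ij} *)
Definition christoffel (k i j : 'I_n) (p : 'rV[R]_n) : R :=
  2^-1 * \sum_(l < n) invmx (g p) k l *
    (partial i (fun q => g q j l) p + partial j (fun q => g q i l) p
     - partial l (fun q => g q i j) p).

(* The component on d_l of R(d_i, d_j) d_k, where
   R(X, Y) = nabla_X nabla_Y - nabla_Y nabla_X - nabla_[X, Y]. *)
Definition riemann (l i j k : 'I_n) (p : 'rV[R]_n) : R :=
  partial i (christoffel l j k) p - partial j (christoffel l i k) p
  + \sum_(m < n) (christoffel m j k p * christoffel l i m p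
                  - christoffel m i k p * christoffel l j m p).

Definition metric_form (p u v : 'rV[R]_n) : R := (u *m g p *m v^T) 0 0.

(* R(u, v) v *)
Definition riemann_uvv (p u v : 'rV[R]_n) : 'rV[R]_n :=
  \row_(l < n) \sum_(i < n) \sum_(j < n) \sum_(k < n)
    riemann l i j k p * u 0 i * v 0 j * v 0 k.

Definition sectional_form (p u v : 'rV[R]_n) : R :=
  metric_form p (riemann_uvv p u v) u /
  (metric_form p u u * metric_form p v v - metric_form p u v ^+ 2).

End curvature.

Section geometry.
Context {R : realType} {n : nat}.
Variable M : riemannianManifold R n.

(* Tangent vectors at x are written in the coordinates of [chart_at M x]; the
   plane is given by two rows that span it ([row_free s] in the uses below). *)
Definition sectional_curvature (x : M) (s : 'M[R]_(2, n)) : R :=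
  let i := chart_at x in
  sectional_form (metric i) (coord i x) (row 0 s) (row 1 s).

(** * Length and geodesic distance *)

Definition C1_curve (c : R -> M) : Prop :=
  continuous c /\
  forall (i : chart M) (t : R), dom i (c t) ->
    derivable (coord i \o c) t 1 /\ {for t, continuous (derive1 (coord i \o c))}.

Definition speed (c : R -> M) (t : R) : R :=
  let i := chart_at (c t) in
  let v := derive1 (coord i \o c) t in
  Num.sqrt (metric_form (metric i) (coord i (c t)) v v).

Definition arc_length (c : R -> M) : R :=
  Rintegral (@lebesgue_measure R) `[0, 1] (speed c).

(* Piecewise C^1 paths from x to y, as chains of C^1 arcs parametrized by
   [0, 1] (each being the restriction of a C^1 curve defined on R). *)
Fixpoint piecewise_C1_path (x : M) (s : seq (R -> M)) (y : M) : Prop :=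
  match s with
  | [::] => x = y
  | c :: s' => [/\ C1_curve c, c 0 = x & piecewise_C1_path (c 1) s' y]
  end.

Definition dist (x y : M) : R :=
  inf [set L | exists2 s, piecewise_C1_path x s y &
                          L = \sum_(c <- s) arc_length c].

(** * Cartan-Hadamard manifolds *)

Definition complete_manifold : Prop :=
  forall u : nat -> M,
    (forall e : R, 0 < e -> exists N : nat, forall k l : nat,
       (N <= k)%N -> (N <= l)%N -> dist (u k) (u l) < e) ->
    exists x : M, forall e : R, 0 < e -> exists N : nat, forall k : nat,
       (N <= k)%N -> dist (u k) x < e.

Definition path_connected : Prop :=
  forall x y : M, exists c : R -> M,
    [/\ {within `[0, 1], continuous c}, c 0 = x & c 1 = y].

Definition null_homotopic_loop (c : R -> M) : Prop :=
  exists H : R * R -> M,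
    [/\ {within `[0, 1] `*` `[0, 1], continuous H},
        forall t, 0 <= t <= 1 -> H (0, t) = c t,
        forall t, 0 <= t <= 1 -> H (1, t) = c 0 &
        forall s, 0 <= s <= 1 -> H (s, 0) = c 0 /\ H (s, 1) = c 0].

Definition simply_connected : Prop :=
  path_connected /\
  forall c : R -> M, {within `[0, 1], continuous c} -> c 0 = c 1 ->
    null_homotopic_loop c.

Definition cartan_hadamard : Prop :=
  [/\ complete_manifold, simply_connected &
      forall (x : M) (s : 'M[R]_(2, n)), row_free s ->
        sectional_curvature x s <= 0].

(** * Poles *)

Definition geodesic (c : R -> M) : Prop :=
  C1_curve c /\
  forall (i : chart M) (t : R), dom i (c t) ->
    let v := derive1 (coord i \o c) in
    derivable v t 1 /\
    forall k : 'I_n,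
      derive1 v t 0 k + \sum_(a < n) \sum_(b < n)
        christoffel (metric i) k a b (coord i (c t)) * v t 0 a * v t 0 b = 0.

(* T_oM is identified with R^n through the coordinates of [chart_at o]. *)
Definition is_exponential_map (o : M) (E : 'rV[R]_n -> M) : Prop :=
  forall v : 'rV[R]_n, exists c : R -> M,
    [/\ geodesic c, c 0 = o, derive1 (coord (chart_at o) \o c) 0 = v & c 1 = E v].

Definition diffeomorphism (E : 'rV[R]_n -> M) : Prop :=
  exists F : M -> 'rV[R]_n,
    [/\ cancel E F, cancel F E, continuous E,
        forall i, smooth_map_on (E @^-1` dom i) (coord i \o E) &
        forall i, smooth_map_on (cod i) (F \o coordV i)].

Definition pole (o : M) : Prop :=
  exists2 E : 'rV[R]_n -> M, is_exponential_map o E & diffeomorphism E.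

End geometry.

(** * Measures and densities *)

Definition borel (T : ptopologicalType) := g_sigma_algebraType (@open T).

Definition is_lebesgue {R : realType} {n : nat}
    (lambda : {measure set (borel 'rV[R]_n) -> \bar R}) : Prop :=
  forall a b : 'rV[R]_n, (forall i, a 0 i <= b 0 i) ->
    lambda [set x : 'rV[R]_n | forall i, a 0 i < x 0 i <= b 0 i] =
    (\prod_(i < n) (b 0 i - a 0 i))%:E.

Definition is_riemannian_volume {R : realType} {n : nat}
    (lambda : {measure set (borel 'rV[R]_n) -> \bar R})
    (M : riemannianManifold R n)
    (vol : {measure set (borel M) -> \bar R}) : Prop :=
  forall (i : chart M) (A : set (borel M)), measurable A -> A `<=` dom i ->
    vol A = (\int[lambda]_(p in coord i @` A)
              (Num.sqrt (\det (metric i p)))%:E)%E.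

(* rho is the density with respect to mu of an absolutely continuous
   probability measure. *)
Definition prob_density {R : realType} {d : measure_display}
    {T : measurableType d} (mu : {measure set T -> \bar R}) (rho : T -> R) :
    Prop :=
  [/\ measurable_fun setT rho, forall x, 0 <= rho x &
      (\int[mu]_x (rho x)%:E = 1)%E].

(* C0 is a constant in the logarithmic Hardy-Littlewood-Sobolev inequality on
   R^n.  Here and below [ln 0 = 0], so that rho log rho = 0 where rho = 0; the
   diagonal x = y is negligible. *)
Definition log_HLS_constant {R : realType} {n : nat}
    (lambda : {measure set (borel 'rV[R]_n) -> \bar R}) (C0 : R) : Prop :=
  forall rho : 'rV[R]_n -> R,
    prob_density lambda rho ->
    (\int[lambda]_x (ln (1 + l2norm x ^+ 2) * rho x)%:E < +oo)%E ->
    (- (\int[lambda]_x \int[lambda]_y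
          (ln (l2norm (x - y)) * rho x * rho y)%:E) <=
     (n%:R^-1)%:E * (\int[lambda]_x (rho x * ln (rho x))%:E) + C0%:E)%E.

(* Main.v *)
(* Let E be the exponential map at o and let C C^T be the metric at o. The map Phi = E^-1 * C
   identifies M with R^n. The Jacobi fields along the rays from o satisfy a matrix Riccati
   equation; with it, K <= 0 makes the metric in normal coordinates at least the one at o, so that
   |Phi x - Phi y| <= d(x, y); and K >= -c_m makes the volume of Phi^-1(B) at most the integral
   over B of J(y) = (sinh(k |y|) / (k |y|))^(n-1), where k = sqrt c_m. Push the probability rho dx
   forward by Phi: its Lebesgue density p satisfies p <= (rho o Phi^-1) J. Apply the Euclidean
   inequality to p. The left-hand side only grows when d(x, y) is replaced by |Phi x - Phi y|, and
   the entropy of p is at most the integral of p times the logarithm of (rho o Phi^-1) J, that is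
   of rho log rho + rho log (J o Phi) on M; finally J is radially nondecreasing and |Phi x| <= d(o,
   x). *)

(* The matrix of the metric in normal coordinates is the only global object: its Riccati equation is
   proved chart by chart, where Christoffel symbols live, then restated through that matrix alone.
   Nothing is differentiated at the pole, since along rays the geodesic equation carries a factor
   t^2; initial values come from continuity at 0. For K <= 0, the equation and Cauchy-Schwarz make
   the length of each Jacobi field convex in t, with initial slope its length for the metric at the
   pole. For K >= -c_m, the trace of the equation bounds the logarithmic derivative of the volume
   density. The radial direction is an eigenvector with the flat eigenvalue, so only n - 1
   directions count; the substitution e = density^(1/(n-1)) turns the Riccati inequality into the
   linear one solved by sinh. Upper bounds on volumes suffice, so no change of variables formula is
   proved: first-order expansions and a bisection argument compare the measures on cubes, and
   regularity extends this to Borel sets. Integrals may be infinite, so they are compared through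
   their positive and negative parts. *)
From HB Require Import structures.
Require Import Defs.
From mathcomp Require Import fingroup perm ring lra measurable_realfun.

Set Implicit Arguments.
Unset Strict Implicit.
Unset Printing Implicit Defensive.

Local Open Scope classical_set_scope.
Local Open Scope ring_scope.

(** * Differential calculus on R^n *)

Section directional.
Context {R : realType} {V W : normedModType R}.

(** A directional derivative only sees the restriction to the line, so one-variable theorems
    transfer through this equivalence. *)
Lemma is_derive_lineP (f : V -> W) (p v : V) (t : R) (d : W) :
  is_derive (p + t *: v) v f d <-> is_derive t 1 (fun s : R => f (p + s *: v)) d.
Proof.
have e : (fun h : R => h^-1 *: (((fun s : R => f (p + s *: v)) \o shift t) (h *: 1) - f (p + t *: v)))
  = (fun h => h^-1 *: ((f \o shift (p + t *: v)) (h *: v) - f (p + t *: v))).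
  apply/funext => h /=; rewrite [h *: 1]mulr1 scalerDl.
  by congr (_ *: (f _ - _)); rewrite addrCA.
split=> -[dfx <-]; split.
- by rewrite /derivable e.
- by rewrite /derive e.
- by rewrite /derivable -e.
- by rewrite /derive -e.
Qed.

Lemma is_derive_shiftP (f : V -> W) (p v : V) (d : W) :
  is_derive p v f d <-> is_derive (0 : R) 1 (fun s : R => f (p + s *: v)) d.
Proof. by rewrite -is_derive_lineP scale0r addr0. Qed.

Lemma differentiable_criterion (L : {linear V -> W}) (f : V -> W) (x : V) :
  continuous L ->
  (forall e : R, 0 < e -> \forall h \near (0 : V), `|f (h + x) - f x - L h| <= e * `|h|) ->
  is_diff x f L.
Proof.
move=> Lc H.
have e : f \o shift x = cst (f x) + L +o_ (0:V) id.
  apply/eqaddoP => e e0; apply: filterS (H e e0) => h /=.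
  by rewrite -!fctE /cst opprD addrA.
have dL := diff_unique Lc e.
by apply: DiffDef => //; apply/diff_locallyP; rewrite dL.
Qed.

End directional.

Section directional_scale.
Context {R : realType} {V W : normedModType R}.

Lemma is_derive_scale (f : V -> W) (p v : V) (c : R) (d : W) :
  is_derive p v f d -> is_derive p (c *: v) f (c *: d).
Proof.
move=> /is_derive_shiftP df; apply/is_derive_shiftP.
have -> : (fun s : R => f (p + s *: (c *: v))) = (fun s => f (p + s *: v)) \o ( *:%R^~ c).
  by apply/funext => s /=; rewrite scalerA.
have d1 : differentiable (fun s : R => f (p + s *: v)) (0 *: c : R).
  by rewrite scale0r; apply/derivable1_diffP.
have d2 : differentiable (( *:%R^~ c) : R -> R) (0:R) by exact: ex_diff.
have d3 : differentiable ((fun s : R => f (p + s *: v)) \o ( *:%R^~ c)) (0:R).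
  exact: differentiable_comp.
have -> : c *: d = 'D_1 ((fun s : R => f (p + s *: v)) \o ( *:%R^~ c)) (0:R).
  have e2 : 'd ( *:%R^~ c : R -> R) (0:R) 1 = c.
    by rewrite diff_val scale1r.
  have e1 : 'd (fun s : R => f (p + s *: v)) (0 *: c : R) = *:%R^~ d :> (R -> W).
    by rewrite deriv1E ?derive1E; [rewrite scale0r derive_val|apply/derivable1_diffP].
  by rewrite deriveE// diff_comp//= e1 e2.
by apply: derivableP; apply/derivable1_diffP.
Qed.

End directional_scale.

Section mean_value.
Context {R : realType} {V : normedModType R}.

Lemma MVT_line (f df : V -> R) (p v : V) :
  (forall t : R, 0 <= t <= 1 -> is_derive (p + t *: v) v f (df (p + t *: v))) ->
  exists2 t : R, 0 <= t <= 1 & f (p + v) - f p = df (p + t *: v).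
Proof.
move=> H.
pose g (t : R) := f (p + t *: v); pose dg (t : R) := df (p + t *: v).
have dgP (t : R) : 0 <= t <= 1 -> is_derive t 1 g (dg t).
  by move=> t01; exact: (is_derive_lineP f p v t (df (p + t *: v))).1 (H t t01).
have [t|//|c c01 e] := @MVT_segment R g dg 0 1 ler01.
- by rewrite in_itv/= => /andP[t0 t1]; apply: dgP; rewrite !ltW.
- apply: derivable_within_continuous => t; rewrite in_itv/= => t01.
  by have [] := dgP _ t01.
- exists c; first by move: c01; rewrite in_itv.
  by move: e; rewrite /g scale1r scale0r addr0 subr0 mulr1.
Qed.

End mean_value.

Section row_linear.
Context {R : realType} {n : nat} {W : normedModType R}.

Definition rowlin (D : 'I_n -> W) (h : 'rV[R]_n) : W := \sum_i h 0 i *: D i.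

Lemma rowlin_linear D : linear (rowlin D).
Proof.
move=> a x y; rewrite /rowlin scaler_sumr -big_split; apply: eq_bigr => i _ /=.
by rewrite !mxE scalerDl scalerA.
Qed.
HB.instance Definition _ D :=
  GRing.isLinear.Build R 'rV[R]_n W *:%R (rowlin D) (rowlin_linear D).

Lemma rowlin_continuous D : continuous (rowlin D).
Proof.
move=> x; apply: differentiable_continuous.
have -> : rowlin D = \sum_i (fun h : 'rV[R]_n => h 0 i *: D i).
  by apply/funext => h; rewrite fct_sumE.
apply: differentiable_sum => i; apply: differentiableZl.
exact: differentiable_coord.
Qed.

Lemma coord_le_norm (h : 'rV[R]_n) i : `|h 0 i| <= `|h|.
Proof. by rewrite [leRHS]/Num.Def.normr /= mx_normrE; exact: (le_bigmax _ _ (0, i)). Qed.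

Lemma row_norm_le (h : 'rV[R]_n) (e : R) : 0 <= e -> (forall i, `|h 0 i| <= e) -> `|h| <= e.
Proof.
move=> e0 H; rewrite [leLHS]/Num.Def.normr /= mx_normrE; apply: bigmax_le => // -[i j] _ /=.
by rewrite ord1.
Qed.

Lemma row_sum_basis (v : 'rV[R]_n) : v = \sum_i v 0 i *: basis_vec i.
Proof. exact: row_sum_delta. Qed.

End row_linear.

Section C1.
Context {R : realType} {n : nat}.
Implicit Types (f : 'rV[R]_n -> R) (p : 'rV[R]_n) (U : set 'rV[R]_n).

(** The increment is split along a staircase from p to p + h, one coordinate moving at a time. The
    mean value theorem on each leg leaves a partial derivative at a point close to p. *)
Lemma C1_is_diff f p :
  (\forall q \near p, forall i, derivable f q (basis_vec i)) ->
  (forall i, {for p, continuous (partial i f)}) ->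
  is_diff p f (rowlin (fun i => partial i f p)).
Proof.
move=> fd fc; apply: differentiable_criterion; first exact: rowlin_continuous.
move=> e e0.
have n0 : 0 < n.+1%:R :> R by [].
(* The n legs share the error e; dividing by n + 1 avoids a zero denominator when n = 0. *)
pose e' := e / n.+1%:R.
have e'0 : 0 < e' by rewrite divr_gt0.
have /nbhs_normP[d /= d0 Hd] : \forall q \near p, (forall i, derivable f q (basis_vec i)) /\
    (forall i, `|partial i f p - partial i f q| <= e').
  near=> q; split; first by near: q.
  near: q; apply: filter_forall => i.
  have /cvgrPdist_le := fc i; exact.
apply/nbhs_normP; exists d => //= h /=; rewrite sub0r normrN => hd.
(* The corners of the staircase: [tr k] keeps the first k coordinates of h. *)
pose tr (k : nat) : 'rV[R]_n := \row_j (if (j < k)%N then h 0 j else 0).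
have trn : tr n = h by apply/rowP => j; rewrite mxE ltn_ord.
have tr0 : tr 0 = 0 by apply/rowP => j; rewrite !mxE.
have trS (k : 'I_n) : tr k.+1 = tr k + h 0 k *: basis_vec k.
  apply/rowP => j; rewrite !mxE /= ltnS leq_eqVlt.
  have [/val_inj->|jk] := eqVneq (j : nat) k; first by rewrite ltnn eqxx add0r mulr1.
  rewrite (_ : (j == k) = false) ?mulr0 ?addr0//.
  by apply/negbTE; apply: contra jk => /eqP ->.
have step (k : 'I_n) : `|f (p + tr k.+1) - f (p + tr k) - h 0 k * partial k f p| <= e' * `|h|.
  have near_seg (t : R) : 0 <= t <= 1 -> `|p - (p + tr k + t *: (h 0 k *: basis_vec k))| < d.
    move=> /andP[t0 t1]; rewrite -addrA opprD addNKr normrN.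
    apply: le_lt_trans hd; apply: row_norm_le => // j; rewrite !mxE /=.
    have [->|jk] := eqVneq j k.
      rewrite ltnn add0r mulr1 normrM ger0_norm//.
      by apply: le_trans (coord_le_norm h k); rewrite ler_piMl.
    rewrite !mulr0 addr0; case: ifP => _; last by rewrite normr0.
    exact: coord_le_norm.
  have [t t01|t t01] := @MVT_line R _ f (fun q => h 0 k *: partial k f q) (p + tr k) (h 0 k *: basis_vec k).
    by apply: is_derive_scale; apply: derivableP; have [] := Hd _ (near_seg t t01).
  rewrite -addrA -trS => ->.
  rewrite /= [_ *: _]/(_ * _) -mulrBr normrM mulrC distrC.
  apply: ler_pM => //; last exact: coord_le_norm.
  by have [] := Hd _ (near_seg t t01).
have -> : f (h + p) - f p = \sum_(k < n) (f (p + tr k.+1) - f (p + tr k)).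
  by rewrite -(big_mkord xpredT (fun k => f (p + tr k.+1) - f (p + tr k))) telescope_sumr// trn tr0 addr0 [h + p]addrC.
rewrite /rowlin -sumrB; apply: le_trans (ler_norm_sum _ _ _) _.
apply: (@le_trans _ _ (\sum_(k < n) e' * `|h|)); first exact: ler_sum.
rewrite sumr_const card_ord -mulrnAl ler_wpM2r// -mulr_natr /e' -mulrA ler_piMr ?(ltW e0)//.
by rewrite mulrC ler_pdivrMr// mul1r ler_nat.
Unshelve. all: by end_near. Qed.

End C1.

(** * Symmetry of mixed second derivatives *)

Section schwarz.
Context {R : realType} {V : normedModType R}.

Lemma near_segment2 (p u w : V) (P : set V) :
  (\forall q \near p, P q) ->
  exists2 s : R, 0 < s & forall a b : R, 0 <= a <= s -> 0 <= b <= s -> P (p + a *: u + b *: w).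
Proof.
move=> /nbhs_normP[d /= d0 Hd].
have N0 : 0 < `|u| + `|w| + 1 by rewrite ltr_wpDl// addr_ge0.
exists (d / 2 / (`|u| + `|w| + 1)) => [|a b /andP[a0 al] /andP[b0 bl]]; first by rewrite !divr_gt0.
apply: Hd; rewrite /= -addrA opprD addNKr normrN.
apply: le_lt_trans (ler_normD _ _) _; rewrite !normrZ !ger0_norm//.
apply: (@le_lt_trans _ _ (d / 2 / (`|u| + `|w| + 1) * (`|u| + `|w| + 1))); last first.
  by rewrite divfK ?gt_eqF// ltr_pdivrMr// ltr_pMr// ltrDl.
have ? := normr_ge0 u; have ? := normr_ge0 w.
rewrite !mulrDr; apply: ler_wpDr; first by rewrite mulr1 !divr_ge0// ltW.
by apply: lerD; rewrite ler_wpM2r.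
Qed.

(** The mean value theorem is applied twice: along u to q |-> f(q + s w) - f(q), then along w to the
    derivative of f in direction u. *)
Lemma second_difference (f : V -> R) (p u w : V) (s : R) : 0 < s ->
  (forall a b : R, 0 <= a <= s -> 0 <= b <= s ->
    derivable f (p + a *: u + b *: w) u /\ derivable ('D_u f) (p + a *: u + b *: w) w) ->
  exists a b : R, [/\ 0 <= a <= s, 0 <= b <= s &
    f (p + s *: u + s *: w) - f (p + s *: u) - (f (p + s *: w) - f p) =
    s * (s * 'D_w ('D_u f) (p + a *: u + b *: w))].
Proof.
move=> s0 H; have s0' := ltW s0.
pose g (q : V) := f (q + s *: w) - f q.
pose dg (q : V) := s *: ('D_u f (q + s *: w) - 'D_u f q).
have sub t : 0 <= t <= 1 -> 0 <= t * s <= s.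
  by move=> /andP[t0 t1]; rewrite mulr_ge0//= ler_piMl.
have sh (q : V) : derivable f (q + s *: w) u -> is_derive q u (fun q => f (q + s *: w)) ('D_u f (q + s *: w)).
  move=> /derivableP/is_derive_shiftP fd; apply/is_derive_shiftP.
  have -> : (fun s0 : R => f (q + s0 *: u + s *: w)) = (fun s0 : R => f (q + s *: w + s0 *: u)).
    by apply/funext => x; rewrite addrAC.
  exact: fd.
have [t t01|t t01 e1] := @MVT_line R _ g dg p (s *: u).
  apply: is_derive_scale; rewrite scalerA.
  have ts := sub t t01.
  apply: is_deriveB; first by apply: sh; have [] := H (t * s) s ts; rewrite ?s0' ?lexx.
  apply: derivableP; have := H (t * s) 0 ts; rewrite scale0r addr0 lexx s0' => -[]//.
have ts := sub t t01.
have [r r01|r r01 e2] := @MVT_line R _ ('D_u f) (fun q => s *: 'D_w ('D_u f) q) (p + (t * s) *: u) (s *: w).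
  by apply: is_derive_scale; apply: derivableP; rewrite scalerA; have [] := H (t * s) (r * s) ts (sub _ r01).
exists (t * s), (r * s); split => //; first exact: sub.
rewrite scalerA in e2; move: e1; rewrite /g /dg scalerA => ->; congr (_ * _); exact: e2.
Qed.

(** The second difference is symmetric in u and w. Divided by s^2 it is a value near p of either
    mixed derivative, and both are continuous at p. *)
Lemma schwarz (f : V -> R) (p u w : V) :
  (\forall q \near p, derivable f q u /\ derivable ('D_u f) q w) ->
  (\forall q \near p, derivable f q w /\ derivable ('D_w f) q u) ->
  {for p, continuous ('D_w ('D_u f))} -> {for p, continuous ('D_u ('D_w f))} ->
  'D_w ('D_u f) p = 'D_u ('D_w f) p.
Proof.
move=> fu fw cu cw; apply/eqP; rewrite -subr_eq0 -normr_le0; apply/ler_addgt0Pl => e e0.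
rewrite addr0.
have e20 : 0 < e / 2 by rewrite divr_gt0.
have tri (x y z : R) : `|x - z| <= e / 2 -> `|y - z| <= e / 2 -> `|x - y| <= e.
  move=> h1 h2; rewrite (splitr e) -(subrKA z); apply: le_trans (ler_normD _ _) _.
  by rewrite lerD// distrC.
have cu' : \forall q \near p, `|'D_w ('D_u f) p - 'D_w ('D_u f) q| <= e / 2.
  by have /cvgrPdist_le := cu; apply.
have cw' : \forall q \near p, `|'D_u ('D_w f) p - 'D_u ('D_w f) q| <= e / 2.
  by have /cvgrPdist_le := cw; apply.
have [s1 s10 H1] := near_segment2 u w (filterI fu cu').
have [s2 s20 H2] := near_segment2 w u (filterI fw cw').
pose s := Num.min s1 s2.
have s0 : 0 < s by rewrite lt_min s10.
have s1' a : 0 <= a <= s -> 0 <= a <= s1 by rewrite le_min => /and3P[-> ->].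
have s2' a : 0 <= a <= s -> 0 <= a <= s2 by rewrite le_min => /and3P[-> _ ->].
have [a b /s1' ha /s1' hb|a [b [/s1' ha /s1' hb e1]]] := @second_difference f p u w s s0.
  by have [] := H1 a b ha hb.
have [c d /s2' hc /s2' hd|c [d [/s2' hc /s2' hd e2]]] := @second_difference f p w u s s0.
  by have [] := H2 c d hc hd.
have e3 : 'D_w ('D_u f) (p + a *: u + b *: w) = 'D_u ('D_w f) (p + c *: w + d *: u).
  apply: (@mulfI _ s); first by rewrite gt_eqF.
  apply: (@mulfI _ s); first by rewrite gt_eqF.
  apply: etrans (esym e1) (etrans _ e2).
  by rewrite [p + s *: w + _]addrAC opprD addrACA -opprD.
have [_ l1] := H1 a b ha hb; have [_ l2] := H2 c d hc hd.
rewrite e3 in l1.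
exact: tri l1 l2.
Qed.

End schwarz.

Lemma near_eq_continuous (T W : topologicalType) (f g : T -> W) (p : T) :
  {near p, f =1 g} -> {for p, continuous f} -> {for p, continuous g}.
Proof.
move=> fg fc; change (g x @[x --> p] --> g p).
have <- : f p = g p by exact: nbhs_singleton fg.
exact: cvg_trans (near_eq_cvg fg) fc.
Qed.

(** * Stability properties of smooth functions *)

Section smooth.
Context {R : realType} {n : nat}.
Implicit Types (f g : 'rV[R]_n -> R) (p : 'rV[R]_n) (U : set 'rV[R]_n).

Lemma near_open U p : open U -> U p -> \forall q \near p, U q.
Proof. by move=> oU Up; apply: open_nbhs_nbhs. Qed.

Lemma Ck_on_eq k U f g : open U -> (forall p, U p -> f p = g p) -> Ck_on k U f -> Ck_on k U g.
Proof.
move=> oU; elim: k f g => [|k IH] f g fg [fc fk]; 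
  have near_fg p : U p -> {near p, f =1 g} by move=> Up; apply: filterS (near_open oU Up) => q; exact: fg.
all: split.
- by move=> p Up; exact: near_eq_continuous (near_fg p Up) (fc p Up).
- by [].
- by move=> p Up; exact: near_eq_continuous (near_fg p Up) (fc p Up).
- move=> i; have [fd fk'] := fk i; split => [p Up|].
    exact: near_eq_derivable (near_fg p Up) (fd p Up).
  by apply: IH fk' => p Up; apply: near_eq_derive; exact: near_fg.
Qed.

Lemma Ck_onD k U f g : open U -> Ck_on k U f -> Ck_on k U g -> Ck_on k U (fun p => f p + g p).
Proof.
move=> oU; elim: k f g => [|k IH] f g [fc fk] [gc gk]; split => //.
- by move=> p Up; exact: (continuousD (fc p Up) (gc p Up)).
- by move=> p Up; exact: (continuousD (fc p Up) (gc p Up)).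
- move=> i; have [fd fk'] := fk i; have [gd gk'] := gk i; split => [p Up|].
    by apply: derivableD; [exact: fd|exact: gd].
  apply: Ck_on_eq (IH _ _ fk' gk') => // p Up.
  by rewrite /partial -deriveD//; [exact: fd|exact: gd].
Qed.

Lemma Ck_onZ k U (c : R) f : open U -> Ck_on k U f -> Ck_on k U (fun p => c * f p).
Proof.
move=> oU; elim: k f => [|k IH] f [fc fk]; split => //.
- by move=> p Up; exact: (continuousM (cvg_cst c) (fc p Up)).
- by move=> p Up; exact: (continuousM (cvg_cst c) (fc p Up)).
- move=> i; have [fd fk'] := fk i; split => [p Up|].
    by apply: derivableZ; exact: fd.
  apply: Ck_on_eq (IH _ fk') => // p Up.
  exact/esym/(deriveZ c (fd p Up)).
Qed.

Lemma smooth_on_eq U f g : open U -> (forall p, U p -> f p = g p) -> smooth_on U f -> smooth_on U g.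
Proof. by move=> oU fg sf k; exact: Ck_on_eq fg (sf k). Qed.

Lemma smooth_on_cst0 U : smooth_on U (fun=> 0).
Proof.
move=> k; elim: k => [|k IH]; split => //; try by move=> p _; exact: cst_continuous.
move=> i; split => [p _|]; first exact: derivable_cst.
by rewrite (_ : partial i _ = fun=> 0)//; apply/funext => p; rewrite /partial derive_cst.
Qed.

Lemma smooth_on_sum U (I : Type) (s : seq I) (F : I -> 'rV[R]_n -> R) (c : I -> R) : open U ->
  (forall i, smooth_on U (F i)) -> smooth_on U (fun p => \sum_(i <- s) c i * F i p).
Proof.
move=> oU sF k; elim: s => [|i s IH].
  by rewrite (_ : (fun p => _) = fun=> 0)//; [exact: smooth_on_cst0|apply/funext => p; rewrite big_nil].
rewrite (_ : (fun p => _) = fun p => c i * F i p + \sum_(i <- s) c i * F i p).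
  by apply: Ck_onD => //; apply: Ck_onZ => //; exact: sF.
by apply/funext => p; rewrite big_cons.
Qed.

Lemma smooth_partial U f i : smooth_on U f -> smooth_on U (partial i f).
Proof. by move=> sf k; have [_ /(_ i)[]] := sf k.+1. Qed.

Lemma smooth_continuous U f p : smooth_on U f -> U p -> {for p, continuous f}.
Proof. by move=> sf Up; have [fc _] := sf 0%N; exact: fc. Qed.

Lemma smooth_is_diff U f p : open U -> smooth_on U f -> U p ->
  is_diff p f (rowlin (fun i => partial i f p)).
Proof.
move=> oU sf Up; apply: C1_is_diff.
  apply: filterS (near_open oU Up) => q Uq i.
  by have [_ /(_ i)[fd _]] := sf 1%N; exact: fd.
by move=> i; apply: smooth_continuous Up; exact: smooth_partial.
Qed.

Lemma smooth_differentiable U f p : open U -> smooth_on U f -> U p -> differentiable f p.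
Proof. by move=> oU sf Up; have [] := smooth_is_diff oU sf Up. Qed.

Lemma smooth_deriveE U f p v : open U -> smooth_on U f -> U p ->
  'D_v f p = \sum_i v 0 i * partial i f p.
Proof.
move=> oU sf Up; have := smooth_is_diff oU sf Up => -[fd dE].
by rewrite deriveE// dE.
Qed.

(** Smoothness is defined by coordinate directions only; the derivative in a fixed direction is a
    combination of partial derivatives with constant coefficients. *)
Lemma smooth_derive U f v : open U -> smooth_on U f -> smooth_on U ('D_v f).
Proof.
move=> oU sf; apply: smooth_on_eq (smooth_on_sum (index_enum 'I_n) (v 0) oU (fun i => smooth_partial i sf)) => //.
by move=> p Up; rewrite (smooth_deriveE _ oU sf Up).
Qed.

Lemma smooth_schwarz U f p u w : open U -> smooth_on U f -> U p ->
  'D_w ('D_u f) p = 'D_u ('D_w f) p.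
Proof.
move=> oU sf Up.
have d v w' : \forall q \near p, derivable f q v /\ derivable ('D_v f) q w'.
  apply: filterS (near_open oU Up) => q Uq; split; apply: diff_derivable.
    exact: smooth_differentiable Uq.
  by apply: smooth_differentiable Uq => //; exact: smooth_derive.
by apply: schwarz => //; apply: smooth_continuous Up; do 2 apply: smooth_derive => //.
Qed.

End smooth.

(** * Quadratic forms *)

Section forms.
Context {R : realType} {n : nat}.
Implicit Types (G S Q A : 'M[R]_n) (u v w : 'rV[R]_n).

Definition bform G u v : R := (u *m G *m v^T) 0 0.

Lemma bformE G u v : bform G u v = \sum_i \sum_j u 0 i * G i j * v 0 j.
Proof.
rewrite /bform mxE exchange_big /=; apply: eq_bigr => j _.
by rewrite !mxE mulr_suml.
Qed.

Lemma bformDl G u u' v : bform G (u + u') v = bform G u v + bform G u' v.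
Proof. by rewrite /bform !mulmxDl mxE. Qed.
Lemma bformDr G u v v' : bform G u (v + v') = bform G u v + bform G u v'.
Proof. by rewrite /bform linearD mulmxDr mxE. Qed.
Lemma bformZl G a u v : bform G (a *: u) v = a * bform G u v.
Proof. by rewrite /bform -!scalemxAl mxE. Qed.
Lemma bformZr G a u v : bform G u (a *: v) = a * bform G u v.
Proof. by rewrite /bform linearZ -scalemxAr mxE. Qed.
Lemma bformNl G u v : bform G (- u) v = - bform G u v.
Proof. by rewrite -scaleN1r bformZl mulN1r. Qed.
Lemma bformNr G u v : bform G u (- v) = - bform G u v.
Proof. by rewrite -scaleN1r bformZr mulN1r. Qed.
Lemma bformBl G u u' v : bform G (u - u') v = bform G u v - bform G u' v.
Proof. by rewrite bformDl bformNl. Qed.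
Lemma bformBr G u v v' : bform G u (v - v') = bform G u v - bform G u v'.
Proof. by rewrite bformDr bformNr. Qed.
Lemma bform0l G v : bform G 0 v = 0.
Proof. by rewrite /bform !mul0mx mxE. Qed.
Lemma bform0r G v : bform G v 0 = 0.
Proof. by rewrite /bform trmx0 mulmx0 mxE. Qed.
Lemma bform_suml G (I : Type) (r : seq I) (F : I -> 'rV[R]_n) v :
  bform G (\sum_(i <- r) F i) v = \sum_(i <- r) bform G (F i) v.
Proof.
elim: r => [|i r IH]; first by rewrite !big_nil bform0l.
by rewrite !big_cons bformDl IH.
Qed.
Lemma bform_mxD G G' u v : bform (G + G') u v = bform G u v + bform G' u v.
Proof. by rewrite /bform mulmxDr mulmxDl mxE. Qed.
Lemma bform_mxZ a G u v : bform (a *: G) u v = a * bform G u v.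
Proof. by rewrite /bform -scalemxAr -scalemxAl mxE. Qed.
Lemma bform_mxB G G' u v : bform (G - G') u v = bform G u v - bform G' u v.
Proof. by rewrite bform_mxD -scaleN1r bform_mxZ mulN1r. Qed.
Lemma bformT G u v : bform G^T u v = bform G v u.
Proof.
rewrite /bform; have -> : u *m G^T *m v^T = (v *m G *m u^T)^T.
  by rewrite !trmx_mul trmxK mulmxA.
by rewrite mxE.
Qed.
Lemma bformC G u v : G^T = G -> bform G u v = bform G v u.
Proof. by move=> GT; rewrite -{1}GT bformT. Qed.
Lemma bform_basis G i j : bform G (basis_vec i) (basis_vec j) = G i j.
Proof. by rewrite /bform /basis_vec -rowE trmx_delta -colE !mxE. Qed.

Definition posdef G := G^T = G /\ forall v, v != 0 -> 0 < bform G v v.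

Lemma posdef_ge0 G v : posdef G -> 0 <= bform G v v.
Proof.
move=> [_ H]; have [->|/H/ltW//] := eqVneq v 0; by rewrite bform0l.
Qed.

Lemma posdef_CS G u v : posdef G -> bform G u v ^+ 2 <= bform G u u * bform G v v.
Proof.
move=> pG; have [->|v0] := eqVneq v 0; first by rewrite !bform0r mulr0 expr0n.
have vv : 0 < bform G v v by exact: pG.2.
have := posdef_ge0 (bform G v v *: u - bform G u v *: v) pG.
rewrite !(bformBl, bformBr, bformZl, bformZr) (bformC v u pG.1).
set a := bform G v v in vv *; set b := bform G u v; set c := bform G u u.
rewrite (_ : _ - _ = a * (c * a - b ^+ 2)); last by ring.
by rewrite pmulr_rge0// subr_ge0.
Qed.

Lemma posdef_unit G : posdef G -> G \in unitmx.
Proof.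
move=> [_ H]; rewrite -row_free_unit -kermx_eq0; apply/eqP/row_matrixP => i.
rewrite row0; apply/eqP/negPn/negP => /H.
by rewrite /bform -row_mul mulmx_ker row0 mul0mx mxE ltxx.
Qed.

End forms.

(** Cholesky factorization by induction on the size: G is cut into a corner entry a > 0, a row b and
    a block D, and the Schur complement D - b^T b / a is again positive definite. *)
Lemma posdef_chol (R : realType) n (G : 'M[R]_n) : posdef G ->
  exists2 C : 'M[R]_n, C \in unitmx & G = C *m C^T.
Proof.
elim: n G => [|n IH] G pG.
  exists G; first exact: posdef_unit.
  by apply/matrixP => -[].
pose G' : 'M[R]_(1 + n) := G; rewrite -[G]/G' in pG *.
have [GT GP] : G'^T = G' /\ forall v : 'rV[R]_(1 + n), v != 0 -> 0 < bform G' v v := pG.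
pose a := ulsubmx G' 0 0; pose b : 'rV[R]_n := ursubmx G'; pose D := drsubmx G'.
have GE : G' = block_mx a%:M b b^T D.
  rewrite -[G' in LHS]submxK /a /b /D; congr (block_mx _ _ _ _).
    by rewrite [ulsubmx _ in LHS]mx11_scalar.
  by rewrite -[in LHS]GT trmx_ursub.
have bE (x : R) (w : 'rV_n) : bform G' (row_mx x%:M w) (row_mx x%:M w) =
    x ^+ 2 * a + 2 * x * (b *m w^T) 0 0 + bform D w w.
  rewrite /bform GE mul_row_block tr_row_mx mul_row_col 2!mulmxDl.
  rewrite [LHS]mxE [X in X + _]mxE [X in _ + X]mxE tr_scalar_mx !mul_scalar_mx.
  rewrite !mul_mx_scalar -scalemxAl.
  have -> : (x *: (w *m b^T)) 0 0 = x * (b *m w^T) 0 0.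
    rewrite mxE; congr (_ * _).
    by rewrite -[w *m b^T]trmxK trmx_mul trmxK mxE.
  have -> : (x *: (b *m w^T)) 0 0 = x * (b *m w^T) 0 0 by rewrite mxE.
  rewrite !scale_scalar_mx [X in X + _ + _]mxE eqxx mulr1n.
  by ring.
have a0 : 0 < a.
  have := GP (row_mx 1%:M 0); rewrite bE bform0l trmx0 mulmx0 mxE mulr0 !addr0 expr1n mul1r; apply.
  rewrite row_mx_eq0 negb_and; apply/orP; left; apply/eqP => /matrixP/(_ 0 0)/eqP.
  by rewrite !mxE eqxx oner_eq0.
pose D' := D - a^-1 *: (b^T *m b).
have bbw (w : 'rV[R]_n) : bform (b^T *m b) w w = ((b *m w^T) 0 0) ^+ 2.
  rewrite /bform mulmxA -mulmxA mxE big_ord1 expr2; congr (_ * _).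
  by rewrite -[w *m b^T]trmxK trmx_mul trmxK mxE.
have pD' : posdef D'.
  split.
    rewrite /D' linearB linearZ /= trmx_mul trmxK; congr (_ - _).
    by rewrite /D trmx_drsub GT.
  (* The first coordinate - b.w / a minimizes the form of G at fixed w; the minimum is the Schur
     complement at w. *)
  move=> w w0; have := GP (row_mx (- a^-1 * (b *m w^T) 0 0)%:M w).
  rewrite bE => /(_ _)/lt_le_trans; apply.
    by move: w0; rewrite row_mx_eq0 negb_and orbC => ->.
  rewrite /D' bform_mxB bform_mxZ bbw.
  set x := (b *m w^T) 0 0; rewrite le_eqVlt; apply/orP; left; apply/eqP.
  by field; rewrite gt_eqF.
have [C' uC' D'E] := IH _ pD'.
pose C : 'M[R]_(1 + n) := block_mx (Num.sqrt a)%:M 0 ((Num.sqrt a)^-1 *: b^T) C'.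
have sa0 : Num.sqrt a != 0 by rewrite gt_eqF// sqrtr_gt0.
exists C.
  change ((C : 'M[R]_(1 + n)) \in unitmx).
  have dC : \det C = \det ((Num.sqrt a)%:M : 'M[R]_1) * \det C' := det_lblock _ _ _.
  rewrite unitmxE dC.
  by rewrite unitrM -[\det C' \is a _]unitmxE uC' andbT det_scalar1 unitfE.
change (G' = @mulmx R (1 + n) (1 + n) (1 + n) C (@trmx R (1 + n) (1 + n) C)).
rewrite GE /C tr_block_mx mulmx_block; congr block_mx.
- by rewrite trmx0 mulmx0 addr0 tr_scalar_mx -scalar_mxM -expr2 sqr_sqrtr// ltW.
- rewrite mul0mx addr0 linearZ /= trmxK mul_scalar_mx scalerA mulfV// scale1r//.
- by rewrite trmx0 mulmx0 addr0 tr_scalar_mx mul_mx_scalar scalerA mulfV// scale1r.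
- rewrite -D'E linearZ /= trmxK -scalemxAl -scalemxAr scalerA -invfM -expr2 sqr_sqrtr ?ltW//.
  by rewrite /D' addrC subrK.
Qed.

Lemma invmxM (R : comUnitRingType) n (A B : 'M[R]_n) : A \in unitmx -> B \in unitmx ->
  invmx (A *m B) = invmx B *m invmx A.
Proof.
move=> uA uB; have uAB : A *m B \in unitmx by rewrite unitmx_mul uA.
rewrite -[LHS]mulmx1 (_ : 1%:M = A *m B *m (invmx B *m invmx A)) ?mulKmx//.
by rewrite -mulmxA mulKVmx// mulmxV.
Qed.

(** * Trace inequalities for forms relative to a positive definite one *)

Section traces.
Context {R : realType} {n : nat}.
Implicit Types (G S Q A : 'M[R]_n) (u v w : 'rV[R]_n).

(** With G = C C^T, cyclicity turns the trace into that of C^-1 Q C^-T, the sum of the values of Q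
    on the rows of C^-1. *)
Lemma posdef_tr_ge0 G Q : posdef G -> (forall w, 0 <= bform Q w w) -> 0 <= \tr (invmx G *m Q).
Proof.
move=> /posdef_chol[C uC ->] H.
rewrite invmxM ?unitmx_tr// -mulmxA mxtrace_mulC; apply: sumr_ge0 => i _.
have := H (row i (invmx C)); rewrite /bform -row_mul => /le_trans; apply.
by rewrite -trmx_inv !mxE le_eqVlt; apply/orP; left; apply/eqP; apply: eq_bigr => j _; rewrite !mxE.
Qed.

(** With G = C C^T, the trace is the sum of the squares of the entries of the symmetric matrix C^-1
    A C^-T. *)
Lemma posdef_tr_sqr_ge0 G A : posdef G -> A^T = A -> 0 <= \tr (invmx G *m A *m (invmx G *m A)).
Proof.
move=> /posdef_chol[C uC ->] AT.
rewrite invmxM ?unitmx_tr//; set K := invmx C.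
have -> : invmx C^T = K^T by rewrite trmx_inv.
pose B := K *m A *m K^T.
have BT : B^T = B by rewrite /B !trmx_mul trmxK AT mulmxA.
have -> : \tr (K^T *m K *m A *m (K^T *m K *m A)) = \tr (B *m B^T).
  by rewrite BT -!mulmxA mxtrace_mulC /B !mulmxA.
clear BT; clearbody B.
by apply: sumr_ge0 => i _; rewrite mxE; apply: sumr_ge0 => j _; rewrite [_^T _ _]mxE -expr2 sqr_ge0.
Qed.

Lemma quadratic_discr (a b m : R) : 0 <= m -> (forall x : R, 0 <= a - 2 * x * b + x ^+ 2 * m) ->
  b ^+ 2 <= m * a.
Proof.
rewrite le_eqVlt => /predU1P[<-|m0] H.
  rewrite mul0r; have [->|b0] := eqVneq b 0; first by rewrite expr0n.
  (* When m = 0 the polynomial is affine; this x gives it the value -1. *)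
  have := H ((a + 1) / b / 2); rewrite mulr0 addr0.
  by rewrite (_ : 2 * _ * b = a + 1) ?opprD ?addrA; [lra|field].
have := H (b / m); rewrite (_ : _ + _ = (m * a - b ^+ 2) / m); last by field; rewrite gt_eqF.
by rewrite pmulr_lge0 ?invr_gt0// subr_ge0.
Qed.

Lemma mxtrace_sqr_sub (U P : 'M[R]_n) (x : R) : U *m P = U -> P *m P = P ->
  \tr ((U - x *: P) *m (U - x *: P)) = \tr (U *m U) - 2 * x * \tr U + x ^+ 2 * \tr P.
Proof.
move=> UP PP; have PU : \tr (P *m U) = \tr U by rewrite mxtrace_mulC UP.
rewrite mulmxBl !mulmxBr -!scalemxAl -!scalemxAr UP PP.
rewrite raddfB /= !raddfB /= !mxtraceZ PU; ring.
Qed.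

(** U = G^-1 S annihilates v^T, so U P = U for the projection P along v^T onto its G-orthogonal
    complement, of trace n - 1. The trace of (U - x P)^2 is nonnegative for all x, and its
    discriminant gives the bound with n - 1 instead of n. *)
Lemma posdef_tr_CS G S v : posdef G -> S^T = S -> v != 0 -> v *m S = 0 ->
  \tr (invmx G *m S) ^+ 2 <= n.-1%:R * \tr (invmx G *m S *m (invmx G *m S)).
Proof.
move=> pG ST v0 vS; have uG := posdef_unit pG.
have b0 : 0 < bform G v v by exact: pG.2.
set be := bform G v v in b0.
apply: quadratic_discr => // x.
pose A := S - x *: (G - be^-1 *: ((v *m G)^T *m (v *m G))).
have AT : A^T = A.
  by rewrite /A [LHS]raddfB /= linearZ /= raddfB /= [(_ *: (_^T *m _))^T]linearZ /= trmx_mul trmxK ST pG.1.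
have := posdef_tr_sqr_ge0 pG AT.
pose P : 'M[R]_n := 1%:M - be^-1 *: (v^T *m (v *m G)).
have AE : invmx G *m A = invmx G *m S - x *: P.
  have e : invmx G *m (v *m G)^T = v^T by rewrite trmx_mul pG.1 mulKmx.
  by rewrite /A mulmxBr -scalemxAr mulmxBr mulVmx// -scalemxAr (mulmxA (invmx G)) e.
have vGv : v *m G *m v^T = be%:M by rewrite [LHS]mx11_scalar.
have SP : invmx G *m S *m P = invmx G *m S.
  have Sv : S *m v^T = 0 by rewrite -[S *m v^T]trmxK trmx_mul trmxK ST vS trmx0.
  rewrite /P mulmxBr mulmx1 -scalemxAr -mulmxA (mulmxA S) Sv.
  by rewrite mul0mx mulmx0 scaler0 subr0.
have PP : P *m P = P.
  have z : v^T *m (v *m G) *m P = 0.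
    rewrite /P mulmxBr mulmx1 -scalemxAr -[v^T *m (v *m G) *m _]mulmxA (mulmxA (v *m G)) vGv.
    by rewrite mul_scalar_mx -scalemxAr scalerA mulVf ?gt_eqF// scale1r subrr.
  by rewrite {1}/P mulmxBl mul1mx -scalemxAl z scaler0 subr0.
have trP : \tr P = n.-1%:R.
  rewrite /P linearB /= mxtrace1 linearZ /= mxtrace_mulC vGv mxtrace_scalar mulr1n mulVf ?gt_eqF//.
  have n0 : (0 < n)%N.
    rewrite lt0n; apply: contra v0 => /eqP n0; apply/eqP/rowP => i.
    by have := ltn_ord i; rewrite {2}n0.
  by rewrite -[X in X%:R - 1](prednK n0) -natr1 addrK.
by rewrite AE mxtrace_sqr_sub// trP.
Qed.

End traces.

(** * Derivatives of matrices *)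

Section matrix_derivative.
Context {R : realType} {V : normedModType R}.
Variables (p v : V).

Lemma is_derive_bigsum (I : Type) (r : seq I) (P : pred I) (f : I -> V -> R) (df : I -> R) :
  (forall i, is_derive p v (f i) (df i)) ->
  is_derive p v (fun x => \sum_(i <- r | P i) f i x) (\sum_(i <- r | P i) df i).
Proof.
move=> H; elim: r => [|i r IH].
  under eq_fun do rewrite big_nil; rewrite big_nil; exact: is_derive_cst.
under eq_fun do rewrite big_cons; rewrite big_cons; case: (P i) => //.
exact: is_deriveD.
Qed.

Lemma is_derive_mul (f g : V -> R) (df dg : R) : is_derive p v f df -> is_derive p v g dg ->
  is_derive p v (fun x => f x * g x) (df * g p + f p * dg).
Proof.
move=> Hf Hg; apply: (is_derive_eq (is_deriveM Hf Hg)).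
by rewrite addrC; congr (_ + _); rewrite mulrC.
Qed.

Lemma is_derive_cmul (c : R) (f : V -> R) (df : R) : is_derive p v f df ->
  is_derive p v (fun x => c * f x) (c * df).
Proof. by move=> Hf; have := @is_deriveZ _ _ _ f c p v df Hf. Qed.

Lemma is_derive_bigprod (I : eqType) (r : seq I) (f : I -> V -> R) (df : I -> R) : uniq r ->
  (forall i, is_derive p v (f i) (df i)) ->
  is_derive p v (fun x => \prod_(i <- r) f i x)
    (\sum_(i <- r) df i * \prod_(j <- r | j != i) f j p).
Proof.
move=> + H; elim: r => [_|i r IH /= /andP[ir ur]].
  under eq_fun do rewrite big_nil; rewrite big_nil; exact: is_derive_cst.
under eq_fun do rewrite big_cons.
apply: is_derive_eq; first exact: (is_derive_mul (H i) (IH ur)).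
rewrite big_cons big_cons eqxx /=; congr (_ * _ + _).
  rewrite big_seq [RHS]big_seq_cond; apply: eq_bigl => j /=.
  by case: eqP => [->|_]; rewrite ?andbT// (negbTE ir).
rewrite mulr_sumr [LHS]big_seq [RHS]big_seq; apply: eq_bigr => j jr.
rewrite big_cons (_ : i != j); last by apply: contraNneq ir => ->.
by rewrite mulrCA.
Qed.

Definition mderiv m n (M : V -> 'M[R]_(m, n)) (M' : 'M[R]_(m, n)) :=
  forall i j, is_derive p v (fun x => M x i j) (M' i j).

Lemma mderiv_cst m n (A : 'M[R]_(m, n)) : mderiv (fun=> A) 0.
Proof. by move=> i j; rewrite mxE; exact: is_derive_cst. Qed.

Lemma mderivD m n (M N : V -> 'M[R]_(m, n)) M' N' : mderiv M M' -> mderiv N N' ->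
  mderiv (fun x => M x + N x) (M' + N').
Proof.
move=> HM HN i j; rewrite mxE; under eq_fun do rewrite mxE.
exact: is_deriveD.
Qed.

Lemma mderivM m n k (M : V -> 'M[R]_(m, n)) (N : V -> 'M[R]_(n, k)) M' N' :
  mderiv M M' -> mderiv N N' -> mderiv (fun x => M x *m N x) (M' *m N p + M p *m N').
Proof.
move=> HM HN i j; under eq_fun do rewrite mxE.
rewrite !mxE -big_split /=; apply: is_derive_bigsum => l.
exact: is_derive_mul.
Qed.

Lemma mderivZ m n (c : V -> R) (M : V -> 'M[R]_(m, n)) c' M' : is_derive p v c c' ->
  mderiv M M' -> mderiv (fun x => c x *: M x) (c' *: M p + c p *: M').
Proof.
move=> Hc HM i j; under eq_fun do rewrite mxE; rewrite !mxE.
exact: is_derive_mul.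
Qed.

Lemma mderivT m n (M : V -> 'M[R]_(m, n)) M' : mderiv M M' -> mderiv (fun x => (M x)^T) M'^T.
Proof. by move=> HM i j; under eq_fun do rewrite mxE; rewrite mxE. Qed.

Lemma mderiv_tr n (M : V -> 'M[R]_n) M' : mderiv M M' ->
  is_derive p v (fun x => \tr (M x)) (\tr M').
Proof. by move=> HM; apply: is_derive_bigsum => i; exact: HM. Qed.

Lemma mderiv_uniq m n (M : V -> 'M[R]_(m, n)) M' M'' : mderiv M M' -> mderiv M M'' -> M' = M''.
Proof.
move=> H1 H2; apply/matrixP => i j.
by have [_ <-] := H1 i j; have [_ <-] := H2 i j.
Qed.

Lemma mderiv_near m n (M N : V -> 'M[R]_(m, n)) M' : {near p, M =1 N} -> mderiv M M' -> mderiv N M'.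
Proof.
move=> MN HM i j; apply: near_eq_is_derive (HM i j).
by apply: filterS MN => x ->.
Qed.

Lemma mderivP m n (M : V -> 'M[R]_(m, n)) M' : mderiv M M' <-> is_derive p v M M'.
Proof.
split=> [HM|[dM <-] i j].
  have dM : derivable M p v by apply/derivable_mxP => i j; have [] := HM i j.
  split=> //; rewrite derive_mx//; apply/matrixP => i j; rewrite mxE.
  by have [] := HM i j.
split; first by move/derivable_mxP: dM.
by rewrite derive_mx// mxE.
Qed.

(** Jacobi's formula. Differentiating the Leibniz expansion gives one term per row; the term of row
    i is the determinant of [N i], expanded along that row. *)
Lemma mderiv_det n (M : V -> 'M[R]_n) M' : mderiv M M' ->
  is_derive p v (fun x => \det (M x)) (\tr (\adj (M p) *m M')).
Proof.
move=> HM; rewrite /determinant.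
pose N i : 'M[R]_n := \matrix_(k, j) (if k == i then M' k j else M p k j).
have -> : \tr (\adj (M p) *m M') = \sum_i \det (N i).
  rewrite mxtrace_mulC; apply: eq_bigr => i _; rewrite (expand_det_row (N i) i) mxE.
  apply: eq_bigr => j _; rewrite !mxE eqxx; congr (_ * (_ * \det _)).
  by apply/matrixP => k l; rewrite !mxE eq_sym -if_neg neq_lift.
rewrite exchange_big /=; apply: is_derive_bigsum => s.
rewrite -mulr_sumr; apply: is_deriveZ.
apply: is_derive_eq; first by apply: is_derive_bigprod; [exact: index_enum_uniq|move=> i; exact: HM].
apply: eq_bigr => i _; rewrite [RHS](bigD1 i)//= !mxE eqxx; congr (_ * _).
by apply: eq_bigr => j ji; rewrite mxE (negbTE ji).
Qed.

(** The cofactor formula shows that the inverse has a derivative; differentiating M M^-1 = 1 then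
    determines it. *)
Lemma mderiv_inv n (M : V -> 'M[R]_n) M' : (\forall x \near p, M x \in unitmx) ->
  mderiv M M' -> mderiv (fun x => invmx (M x)) (- (invmx (M p) *m M' *m invmx (M p))).
Proof.
move=> uM HM; have uMp : M p \in unitmx := nbhs_singleton uM.
have d0 : \det (M p) != 0 by move: uMp; rewrite unitmxE unitfE.
have HA : exists A', mderiv (fun x => \adj (M x)) A'.
  exists (\matrix_(i, j) 'D_v (fun x => (\adj (M x)) i j) p) => i j.
  rewrite mxE; apply: derivableP; under eq_fun do rewrite mxE /cofactor.
  apply: derivableZ; apply: (@ex_derive _ _ _ _ _ _ (\tr (\adj (row' j (col' i (M p))) *m (row' j (col' i M'))))).
  by apply: (@mderiv_det _ (fun x => row' j (col' i (M x)))) => k l; under eq_fun do rewrite !mxE; rewrite !mxE.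
have [A' {}HA] := HA.
have HI : exists I', mderiv (fun x => invmx (M x)) I'.
  have Hd : is_derive p v (fun x => (\det (M x))^-1) ('D_v (fun x => (\det (M x))^-1) p).
    by apply: derivableP; apply: derivableV => //; have [] := mderiv_det HM.
  eexists; apply: (@mderiv_near _ _ (fun x => (\det (M x))^-1 *: \adj (M x))).
    by apply: filterS uM => x ux; rewrite /invmx ux.
  exact: mderivZ.
have [I' {}HI] := HI; suff <- : I' = - (invmx (M p) *m M' *m invmx (M p)) by [].
have H1 : mderiv (fun x => M x *m invmx (M x)) 0.
  apply: (@mderiv_near _ _ (fun=> 1%:M)); last exact: mderiv_cst.
  by apply: filterS uM => x ux; rewrite mulmxV.
have := mderiv_uniq (mderivM HM HI) H1 => /(congr1 (mulmx (invmx (M p)))).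
rewrite mulmx0 mulmxDr mulKmx// mulmxA => /eqP; rewrite addrC addr_eq0 => /eqP.
exact.
Qed.

End matrix_derivative.

(** * Scalar differential inequalities *)

Section comparison.
Context {R : realType}.
Implicit Types (f g m h k e : R -> R) (s t r a b c x u : R).

Lemma is_derive_continuous (W : normedModType R) (f : R -> W) (t : R) (d : W) :
  is_derive t 1 f d -> {for t, continuous f}.
Proof. by move=> [fd _]; apply: differentiable_continuous; apply/derivable1_diffP. Qed.

Lemma MVT_pos f g (a b : R) : (forall t, a <= t -> is_derive t 1 f (g t)) -> a < b ->
  exists2 c : R, a < c < b & f b - f a = g c * (b - a).
Proof.
move=> H ab; have [|c|c] := @MVT R f g a b ab.
- by move=> x; rewrite in_itv/= => /andP[/ltW ax _]; exact: H.
- apply: derivable_within_continuous => x; rewrite in_itv/= => /andP[ax _].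
  by have [] := H x ax.
- by rewrite in_itv/= => cab e; exists c.
Qed.

Lemma ge0_deriv_ndecr f g a : (forall t, a < t -> is_derive t 1 f (g t)) ->
  (forall t, a < t -> 0 <= g t) -> forall s t, a < s -> s <= t -> f s <= f t.
Proof.
move=> H H0 s t s0; rewrite le_eqVlt => /predU1P[->//|st].
have [u su|c /andP[sc _] e] := @MVT_pos f g s t _ st.
  by apply: H; exact: lt_le_trans su.
rewrite -subr_ge0 e mulr_ge0//; last by rewrite subr_ge0 ltW.
by apply: H0; exact: lt_trans sc.
Qed.

Lemma le0_deriv_nincr f g a : (forall t, a < t -> is_derive t 1 f (g t)) ->
  (forall t, a < t -> g t <= 0) -> forall s t, a < s -> s <= t -> f t <= f s.
Proof.
move=> H H0 s t s0 st; rewrite -lerN2.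
apply: (@ge0_deriv_ndecr (fun x => - f x) (fun x => - g x) a) => // [x x0|x x0].
  by apply: is_deriveN; exact: H.
by rewrite oppr_ge0 H0.
Qed.

(** Facts about rays are available for t > 0 only; this carries them to the limit t = 0. *)
Lemma le_near0_right (a b : R) f : {for 0, continuous f} ->
  (forall s, 0 < s -> s < b -> a <= f s) -> 0 < b -> a <= f 0.
Proof.
move=> cf H b0; apply/ler_addgt0Pr => e e0.
have /cvgrPdist_le/(_ e e0)/nbhs_normP[d /= d0 Hd] := cf.
pose s := Num.min (d / 2) (b / 2).
have s0 : 0 < s by rewrite lt_min !divr_gt0.
have sb : s < b by apply: le_lt_trans (_ : b / 2 < b); rewrite ?ge_min ?lexx ?orbT// ltr_pdivrMr// ltr_pMr// ltrDl.
have sd : s < d by apply: le_lt_trans (_ : d / 2 < d); rewrite ?ge_min ?lexx ?orbT// ltr_pdivrMr// ltr_pMr// ltrDl.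
have := Hd s; rewrite /= sub0r normrN gtr0_norm// => /(_ sd).
have := H s s0 sb; rewrite ler_norml => ? /andP[? ?]; lra.
Qed.

Lemma convex_chord f g : (forall t, 0 < t -> is_derive t 1 f (g t)) ->
  (forall s t, 0 < s -> s <= t -> g s <= g t) ->
  forall r s t, 0 < r -> r < s -> s < t -> (f s - f r) * (t - s) <= (f t - f s) * (s - r).
Proof.
move=> H H1 r s t r0 rs st; have s0 := lt_trans r0 rs.
have [u ru|c /andP[rc cs] ->] := @MVT_pos f g r s _ rs.
  by apply: H; exact: lt_le_trans ru.
have [u su|d /andP[sd _] ->] := @MVT_pos f g s t _ st.
  by apply: H; exact: lt_le_trans su.
rewrite -!mulrA [(s - r) * _]mulrC; apply: ler_wpM2r.
  by rewrite mulr_ge0// subr_ge0 ltW.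
by apply: H1; [exact: lt_trans rc|exact/ltW/(lt_trans cs)].
Qed.

(* The hypotheses say that t |-> t * Num.sqrt (m t) is convex; it is asymptotic to
   t * Num.sqrt (m 0) at 0. *)
Lemma sqrt_convex_growth m h k :
  {for 0, continuous m} -> (forall t, 0 < t -> 0 < m t) ->
  (forall t, 0 < t -> is_derive t 1 (fun s => s ^+ 2 * m s) (2 * h t)) ->
  (forall t, 0 < t -> is_derive t 1 h (k t)) ->
  (forall t, 0 < t -> h t ^+ 2 <= t ^+ 2 * m t * k t) ->
  forall t, 0 < t -> m 0 <= m t.
Proof.
move=> cm m0 dm dh hk.
pose a t := t ^+ 2 * m t.
have a0 t : 0 < t -> 0 < a t by move=> t0; rewrite mulr_gt0 ?exprn_gt0 ?m0.
pose f t := Num.sqrt (a t).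
have f0 t : 0 < t -> 0 < f t by move=> t0; rewrite sqrtr_gt0 a0.
have fE t : 0 < t -> f t = t * Num.sqrt (m t).
  by move=> t0; rewrite /f /a sqrtrM ?sqr_ge0// sqrtr_sqr gtr0_norm.
have df t : 0 < t -> is_derive t 1 f (h t / f t).
  move=> t0; have := is_derive1_comp (@is_derive1_sqrt _ (a t) (a0 _ t0)) (dm t t0).
  move/is_derive_eq; apply; rewrite /f -/(a t).
  by field; rewrite gt_eqF// sqrtr_gt0 a0.
have ddf t : 0 < t -> is_derive t 1 (fun s => h s / f s) ((k t - h t ^+ 2 / a t) / f t).
  move=> t0; have ft : f t != 0 by rewrite gt_eqF// f0.
  have dV : is_derive t 1 (fun s => (f s)^-1) (- (f t) ^- 2 * (h t / f t)).
    have [df1 df2] := df t t0.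
    by split; [exact: derivableV|rewrite deriveV// df2].
  apply: (is_derive_eq (is_derive_mul (dh t t0) dV)).
  have -> : a t = f t ^+ 2 by rewrite sqr_sqrtr// ltW// a0.
  by field.
have mono : forall s t, 0 < s -> s <= t -> h s / f s <= h t / f t.
  apply: (@ge0_deriv_ndecr _ _ 0 ddf) => t t0.
  apply: divr_ge0; last by rewrite ltW ?f0.
  by rewrite subr_ge0 ler_pdivrMr ?a0// mulrC hk.
have chord := convex_chord df mono.
have slope s t : 0 < s -> s < t -> m s <= m t.
  move=> s0 st; have t0 := lt_trans s0 st.
  suff : f s * t <= f t * s.
    rewrite !fE// [s * _]mulrC [t * _]mulrC -!mulrA [t * s]mulrC ler_pM2r ?mulr_gt0// => H.
    by move: H; rewrite ler_psqrt// nnegrE ltW// m0.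
  (* The chord inequality at r < s < t is continued to r = 0, where f vanishes. It then says that
     f(s) / s <= f(t) / t, hence that m is nondecreasing. *)
  pose G r := f s * (t - s) - r * Num.sqrt (m r) * (t - s) - (f t - f s) * (s - r).
  have cG : {for 0, continuous (fun r => - G r)}.
    apply: continuousN; apply: continuousB; first apply: continuousB.
    - exact: cst_continuous.
    - apply: continuousM; last exact: cst_continuous.
      apply: continuousM; first exact: cvg_id.
      exact: (continuous_comp cm (@sqrt_continuous _ _)).
    - apply: continuousM; first exact: cst_continuous.
      by apply: continuousB; [exact: cst_continuous|exact: cvg_id].
  have := @le_near0_right 0 s (fun r => - G r) cG.
  rewrite /G mul0r mul0r !subr0 oppr_ge0 => H.
  suff : f s * (t - s) - (f t - f s) * s <= 0 by lra.
  apply: H => // r r0 rs; rewrite oppr_ge0 -fE// -mulrBl subr_le0; exact: chord.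
move=> t t0.
have := @le_near0_right (- m t) t (fun r => - m r) (continuousN cm).
by rewrite lerN2; apply => // s s0 st; rewrite lerN2 slope.
Qed.

Lemma sinh_gt0 (x : R) : 0 < x -> 0 < sinh x.
Proof. by move=> x0; rewrite /sinh divr_gt0// subr_gt0 ltr_expR; lra. Qed.

Definition cosh (x : R) : R := (expR x + expR (- x)) / 2.

Lemma is_derive_sinh (k t : R) : is_derive t 1 (fun s => sinh (k * s)) (k * cosh (k * t)).
Proof.
rewrite /sinh /cosh; apply: is_derive_eq.
rewrite /GRing.scale /=; lra.
Qed.

Lemma is_derive_cosh (k t : R) : is_derive t 1 (fun s => cosh (k * s)) (k * sinh (k * t)).
Proof.
rewrite /sinh /cosh; apply: is_derive_eq.
rewrite /GRing.scale /=; lra.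
Qed.

Lemma sinh_ge x : 0 <= x -> x <= sinh x.
Proof.
rewrite le_eqVlt => /predU1P[<-|x0]; first by rewrite /sinh oppr0 subrr mul0r.
have d t : is_derive t 1 (fun s => sinh (1 * s) - s) (1 * cosh (1 * t) - 1).
  by apply: is_deriveB; exact: is_derive_sinh.
have cosh_ge1 t : 1 <= cosh t.
  rewrite /cosh ler_pdivlMr// mul1r expRN.
  have e0 := expR_gt0 t; set e := expR t in e0 *.
  rewrite -subr_ge0 (_ : _ - _ = (e - 1) ^+ 2 / e); last by field; rewrite gt_eqF.
  by rewrite divr_ge0 ?sqr_ge0// ltW.
(* Monotonicity is only obtained strictly above the base point; the base -1 allows a start at 0. *)
have := @ge0_deriv_ndecr _ _ (-1) (fun t _ => d t) _ 0 x _ (ltW x0).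
rewrite mulr0 mul1r subr0 {1}/sinh oppr0 subrr mul0r subr_ge0; apply.
  by move=> t _; rewrite mul1r subr_ge0.
by rewrite ltrN10.
Qed.

(** Sturm comparison of t e(t) with S(t) = sinh (k t). The Wronskian W = (t e)' S - t e S' is
    nonincreasing and shown to be nonpositive, so t e / S is nonincreasing, and its values near 0
    are controlled by e(0) / k. *)
Lemma sinh_comparison (e y y' : R -> R) (k : R) : 0 < k ->
  {for 0, continuous e} -> e 0 = 1 -> (forall t, 0 < t -> 0 < e t) ->
  (forall t, 0 < t -> is_derive t 1 (fun s => s * e s) (y t)) ->
  (forall t, 0 < t -> is_derive t 1 y (y' t)) ->
  (forall t, 0 < t -> y' t <= k ^+ 2 * (t * e t)) ->
  forall t, 0 < t -> e t <= sinh (k * t) / (k * t).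
Proof.
move=> k0 ce e1 epos dy dy' yk.
pose S t := sinh (k * t); pose C t := cosh (k * t).
have S0 t : 0 < t -> 0 < S t by move=> t0; rewrite sinh_gt0// mulr_gt0.
pose W t := y t * S t - t * e t * (k * C t).
have dS t : is_derive t 1 S (k * C t) by exact: is_derive_sinh.
have dC t : is_derive t 1 C (k * S t) by exact: is_derive_cosh.
have dW t : 0 < t -> is_derive t 1 W (y' t * S t - t * e t * (k ^+ 2 * S t)).
  move=> t0; have h1 := is_derive_mul (dy' t t0) (dS t).
  have h2 := is_derive_mul (dy t t0) (is_derive_cmul k (dC t)).
  apply: (is_derive_eq (is_deriveB h1 h2)).
  by rewrite /GRing.scale /=; ring.
have Wdec s t : 0 < s -> s <= t -> W t <= W s.
  apply: (@le0_deriv_nincr W _ 0 dW) => {}t t0.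
  by rewrite mulrA -mulrBl pmulr_lle0 ?S0// subr_le0 mulrC yk.
have dV t : 0 < t -> is_derive t 1 (fun s => (S s)^-1) (- (S t) ^- 2 * (k * C t)).
  move=> t0; have [df1 df2] := dS t; have := gt_eqF (S0 t t0) => /negbT ?.
  by split; [exact: derivableV|rewrite deriveV// df2].
pose u t := t * e t * (S t)^-1.
have du t : 0 < t -> is_derive t 1 u (W t / S t ^+ 2).
  move=> t0; apply: (is_derive_eq (is_derive_mul (dy t t0) (dV t t0))).
  by rewrite /W; field; rewrite gt_eqF ?S0.
(* No bound on y near 0 is available, so W(0+) = 0 is not immediate. If W(t) > 0, then u + c coth(k
   s) with c = W(t) / k is nondecreasing on (0, t]; multiplying by S(s) and letting s tend to 0
   gives c <= 0, a contradiction. *)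
have W0 t : 0 < t -> W t <= 0.
  move=> t0; rewrite leNgt; apply/negP => Wt.
  pose c := W t / k; have c0 : 0 < c by rewrite divr_gt0.
  pose q s := - (u s + c * (C s * (S s)^-1)).
  have dq s : 0 < s -> is_derive s 1 q (- ((W s - W t) / S s ^+ 2)).
    move=> s0; have h := is_derive_mul (dC s) (dV s s0).
    apply: (is_derive_eq (is_deriveN (is_deriveD (du s s0) (is_derive_cmul c h)))).
    have SC : C s ^+ 2 = 1 + S s ^+ 2.
      rewrite /C /S /cosh /sinh expRN; have := gt_eqF (expR_gt0 (k * s)) => /negbT ?.
      by field.
    rewrite /GRing.scale /=; congr (- _).
    rewrite (_ : k * S s / S s + C s * (- S s ^- 2 * (k * C s)) = k * (1 - C s ^+ 2 / S s ^+ 2)).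
      by rewrite SC /c; field; rewrite !gt_eqF ?S0.
    by field; rewrite gt_eqF ?S0.
  have bound s : 0 < s -> s < t -> c <= - q t * S s.
    move=> s0 st.
    have [x sx|x /andP[sx xt] ex] := @MVT_pos q (fun s => - ((W s - W t) / S s ^+ 2)) s t _ st.
      by apply: dq; exact: lt_le_trans sx.
    have x0 := lt_trans s0 sx.
    have : q t <= q s.
      rewrite -subr_le0 ex pmulr_lle0 ?subr_gt0// oppr_le0 divr_ge0 ?sqr_ge0//.
      by rewrite subr_ge0 Wdec// ltW.
    rewrite {2}/q lerNr => /(ler_wpM2r (ltW (S0 s s0))).
    move=> H; apply: le_trans H; rewrite mulrDl -[c * _ * _]mulrA mulfVK ?gt_eqF ?S0//.
    have C1 : 1 <= C s.
      rewrite /C /cosh ler_pdivlMr// mul1r expRN.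
      have e0 := expR_gt0 (k * s); set E := expR _ in e0 *.
      rewrite -subr_ge0 (_ : _ - _ = (E - 1) ^+ 2 / E); last by field; rewrite gt_eqF.
      by rewrite divr_ge0 ?sqr_ge0// ltW.
    rewrite divfK ?gt_eqF ?S0// ler_wpDl//; last by rewrite ler_peMr// ltW.
    by rewrite mulr_ge0 ?ltW// epos.
  have cS : {for 0, continuous (fun s => - q t * S s)}.
    apply: continuousM; first exact: cst_continuous.
    exact: is_derive_continuous (dS 0).
  have := le_near0_right cS bound t0.
  by rewrite {1}/S mulr0 /sinh oppr0 subrr mul0r mulr0 leNgt c0.
have udec s t : 0 < s -> s <= t -> u t <= u s.
  apply: (@le0_deriv_nincr u _ 0 du) => {}t t0.
  by rewrite pmulr_lle0 ?W0// invr_gt0 exprn_gt0 ?S0.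
move=> t t0.
(* Since sinh(k s) >= k s, one has u(t) <= u(s) <= e(s) / k for s < t, and s tends to 0. *)
have ut : u t <= e 0 / k.
  apply: (@le_near0_right _ t (fun s => e s / k)) => //.
    by apply: continuousM => //; exact: cst_continuous.
  move=> s s0 st; apply: le_trans (udec s t s0 (ltW st)) _.
  rewrite /u ler_pdivrMr ?S0// mulrAC ler_pdivlMr// -mulrA mulrCA ler_wpM2l ?(ltW (epos s s0))//.
  by rewrite [s * k]mulrC; apply: sinh_ge; rewrite mulr_ge0// ltW.
move: ut; rewrite /u e1 ler_pdivrMr ?S0// => H.
rewrite ler_pdivlMr ?mulr_gt0// -/(S t).
move: H; rewrite mul1r [_ * S t]mulrC => /(ler_wpM2r (ltW k0)).
rewrite divfK ?gt_eqF// => H.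
by rewrite (_ : e t * (k * t) = t * e t * k); [exact: H|ring].
Qed.

End comparison.

(** * Christoffel symbols and curvature *)

Section trilinear.
Context {R : realType} {n : nat}.
Implicit Types (T : 'I_n -> 'I_n -> 'I_n -> R) (u v : 'rV[R]_n).

Definition tri T u v : 'rV[R]_n := \row_k \sum_i \sum_j T k i j * u 0 i * v 0 j.

Lemma triDl T u u' v : tri T (u + u') v = tri T u v + tri T u' v.
Proof.
apply/rowP => k; rewrite !mxE -big_split; apply: eq_bigr => i _ /=.
rewrite -big_split; apply: eq_bigr => j _ /=; rewrite !mxE; ring.
Qed.
Lemma triDr T u v v' : tri T u (v + v') = tri T u v + tri T u v'.
Proof.
apply/rowP => k; rewrite !mxE -big_split; apply: eq_bigr => i _ /=.
rewrite -big_split; apply: eq_bigr => j _ /=; rewrite !mxE; ring.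
Qed.
Lemma triZl T a u v : tri T (a *: u) v = a *: tri T u v.
Proof.
apply/rowP => k; rewrite !mxE mulr_sumr; apply: eq_bigr => i _ /=.
rewrite mulr_sumr; apply: eq_bigr => j _ /=; rewrite !mxE; ring.
Qed.
Lemma triZr T a u v : tri T u (a *: v) = a *: tri T u v.
Proof.
apply/rowP => k; rewrite !mxE mulr_sumr; apply: eq_bigr => i _ /=.
rewrite mulr_sumr; apply: eq_bigr => j _ /=; rewrite !mxE; ring.
Qed.
Lemma triNl T u v : tri T (- u) v = - tri T u v.
Proof. by rewrite -scaleN1r triZl scaleN1r. Qed.
Lemma triC T u v : (forall k i j, T k i j = T k j i) -> tri T u v = tri T v u.
Proof.
move=> TC; apply/rowP => k; rewrite !mxE exchange_big; apply: eq_bigr => i _ /=.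
by apply: eq_bigr => j _; rewrite TC mulrAC.
Qed.

Lemma tri_bilin T u v : tri T u v = \sum_i \sum_j (u 0 i * v 0 j) *: tri T (basis_vec i) (basis_vec j).
Proof.
have lin w (I : Type) (r : seq I) (F : I -> 'rV[R]_n) : tri T (\sum_(i <- r) F i) w = \sum_(i <- r) tri T (F i) w.
  elim: r => [|i r IH]; last by rewrite !big_cons triDl IH.
  by rewrite !big_nil -(scale0r 0) triZl !scale0r.
have linr w (I : Type) (r : seq I) (F : I -> 'rV[R]_n) : tri T w (\sum_(i <- r) F i) = \sum_(i <- r) tri T w (F i).
  elim: r => [|i r IH]; last by rewrite !big_cons triDr IH.
  by rewrite !big_nil -(scale0r 0) triZr !scale0r.
rewrite {1}(row_sum_basis u) lin; apply: eq_bigr => i _.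
rewrite {1}(row_sum_basis v) linr; apply: eq_bigr => j _.
by rewrite triZl triZr scalerA.
Qed.

Lemma mderiv_tri (V : normedModType R) (p w : V) (T : V -> 'I_n -> 'I_n -> 'I_n -> R) T'
   (u v : V -> 'rV[R]_n) u' v' :
  (forall k i j, is_derive p w (fun x => T x k i j) (T' k i j)) ->
  mderiv p w u u' -> mderiv p w v v' ->
  mderiv p w (fun x => tri (T x) (u x) (v x))
    (tri T' (u p) (v p) + tri (T p) u' (v p) + tri (T p) (u p) v').
Proof.
move=> HT Hu Hv i0 k; rewrite ord1 {i0}; under eq_fun do rewrite mxE.
rewrite !mxE -!big_split; apply: is_derive_bigsum => i /=.
rewrite -!big_split; apply: is_derive_bigsum => j /=.
apply: (is_derive_eq (is_derive_mul (is_derive_mul (HT k i j) (Hu 0 i)) (Hv 0 j))).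
by rewrite mulrDl.
Qed.

End trilinear.

Section chain.
Context {R : realType} {n : nat} {V : normedModType R}.

Lemma chain_line (h : 'rV[R]_n -> R) (x : V -> 'rV[R]_n) (p v : V) x' :
  differentiable h (x p) -> mderiv p v x x' -> is_derive p v (fun q => h (x q)) ('D_x' h (x p)).
Proof.
move=> dh /mderivP/is_derive_shiftP dx; apply/is_derive_shiftP.
pose y (s : R) := x (p + s *: v).
have y0 : y 0 = x p by rewrite /y scale0r addr0.
have dy : differentiable y 0 by have [? _] := dx; exact/derivable1_diffP.
have dc : differentiable (h \o y) 0 by apply: differentiable_comp => //; rewrite y0.
have -> : 'D_x' h (x p) = 'D_1 (h \o y) 0.
  have e : 'd (h \o y) 0 1 = 'd h (y 0) ('d y 0 1) by rewrite diff_comp// y0.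
  have ey : 'd y 0 1 = x' by rewrite -deriveE//; have [_ ->] := dx.
  by rewrite deriveE// [RHS]deriveE// e ey y0.
by apply: derivableP; apply/derivable1_diffP.
Qed.

Lemma near_eq_differentiable (W : normedModType R) (f h : V -> W) (p : V) :
  {near p, f =1 h} -> differentiable f p -> differentiable h p.
Proof.
move=> fh df; have fhp : f p = h p := nbhs_singleton fh.
suff [] : is_diff p h ('d f p) by [].
apply: differentiable_criterion; first exact: diff_continuous.
move=> e e0; have /eqaddoP/(_ e e0) := diff_locally df.
have {}fh : \forall d \near (0 : V), f (d + p) = h (d + p).
  by move: fh; rewrite (near_shift 0 p) /= subr0.
move=> H; near=> d.
have <- : f (d + p) = h (d + p) by near: d; exact: fh.
rewrite -fhp.
have : `|(f \o shift p - (cst (f p) + 'd f p)) d| <= e * `|id d| by near: d; exact: H.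
by rewrite -[(_ - _) d]/(f (d + p) - (f p + 'd f p d)) opprD addrA.
Unshelve. all: by end_near. Qed.

Lemma differentiable_bigsum (I : Type) (r : seq I) (P : pred I) (f : I -> V -> R) (p : V) :
  (forall i, differentiable (f i) p) -> differentiable (fun x => \sum_(i <- r | P i) f i x) p.
Proof.
move=> H; elim: r => [|i r IH]; first by under eq_fun do rewrite big_nil; exact: differentiable_cst.
by under eq_fun do rewrite big_cons; case: (P i) => //; exact: differentiableD.
Qed.

Lemma differentiable_bigprod (I : Type) (r : seq I) (P : pred I) (f : I -> V -> R) (p : V) :
  (forall i, differentiable (f i) p) -> differentiable (fun x => \prod_(i <- r | P i) f i x) p.
Proof.
move=> H; elim: r => [|i r IH]; first by under eq_fun do rewrite big_nil; exact: differentiable_cst.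
by under eq_fun do rewrite big_cons; case: (P i) => //; exact: differentiableM.
Qed.

Lemma differentiable_det m (M : V -> 'M[R]_m) (p : V) :
  (forall i j, differentiable (fun x => M x i j) p) -> differentiable (fun x => \det (M x)) p.
Proof.
move=> H; apply: differentiable_bigsum => s; apply: differentiableM; first exact: differentiable_cst.
by apply: differentiable_bigprod => i; exact: H.
Qed.

Lemma differentiable_invmx m (M : V -> 'M[R]_m) (p : V) : (\forall q \near p, M q \in unitmx) ->
  (forall i j, differentiable (fun x => M x i j) p) ->
  forall i j, differentiable (fun x => invmx (M x) i j) p.
Proof.
move=> uM H i j; apply: (@near_eq_differentiable _ (fun x => (\det (M x))^-1 * \adj (M x) i j)).
  by apply: filterS uM => x ux; rewrite /invmx ux [RHS]mxE.
apply: differentiableM.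
  apply: differentiableV; first exact: differentiable_det.
  by have := nbhs_singleton uM; rewrite unitmxE unitfE.
under eq_fun do rewrite mxE; apply: differentiableM; first exact: differentiable_cst.
apply: differentiable_det => k l; under eq_fun do rewrite !mxE; exact: H.
Qed.

End chain.

Lemma diff_deriveE (R : realType) n (h : 'rV[R]_n -> R) p u : differentiable h p ->
  'D_u h p = \sum_i u 0 i * partial i h p.
Proof.
move=> dh; rewrite deriveE// {1}(row_sum_basis u) linear_sum; apply: eq_bigr => i _.
by rewrite linearZ /partial deriveE.
Qed.

Section christoffel.
Context {R : realType} {n : nat}.
Variables (g : 'rV[R]_n -> 'M[R]_n) (D : set 'rV[R]_n).
Hypothesis oD : open D.
Hypothesis gsm : forall a b, smooth_on D (fun p => g p a b).
Hypothesis gpd : forall p, D p -> posdef (g p).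
Implicit Types (p : 'rV[R]_n) (u v w z : 'rV[R]_n).

Definition Gam p := tri (fun k i j => christoffel g k i j p).
Definition dGam p z := tri (fun k i j => 'D_z (christoffel g k i j) p).
Definition dmet p z : 'M[R]_n := \matrix_(a, b) 'D_z (fun q => g q a b) p.

Let gsym p a b : D p -> g p a b = g p b a.
Proof. by move=> /gpd[e _]; rewrite -[in LHS]e mxE. Qed.

Lemma partial_metricC p i a b : D p ->
  partial i (fun q => g q a b) p = partial i (fun q => g q b a) p.
Proof.
move=> Dp; apply: near_eq_derive; apply: filterS (near_open oD Dp) => q Dq.
exact: gsym.
Qed.

Lemma dmetT p z : D p -> (dmet p z)^T = dmet p z.
Proof.
move=> Dp; apply/matrixP => a b; rewrite !mxE; apply: near_eq_derive.
by apply: filterS (near_open oD Dp) => q Dq; exact: gsym.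
Qed.

Lemma christoffelC p k i j : D p -> christoffel g k i j p = christoffel g k j i p.
Proof.
move=> Dp; rewrite /christoffel; congr (_ * _); apply: eq_bigr => l _; congr (_ * _).
by rewrite (@partial_metricC p l i j)// [partial i _ p + _]addrC.
Qed.

Lemma GamC p u v : D p -> Gam p u v = Gam p v u.
Proof. by move=> Dp; apply: triC => k i j; exact: christoffelC. Qed.

(** Lowering the upper index cancels the inverse metric and leaves the Christoffel symbols of the
    first kind. *)
Lemma christoffel_lower p i j c : D p -> \sum_k christoffel g k i j p * g p k c =
  2^-1 * (partial i (fun q => g q j c) p + partial j (fun q => g q i c) p - partial c (fun q => g q i j) p).
Proof.
move=> Dp; rewrite /christoffel.
pose X l := partial i (fun q => g q j l) p + partial j (fun q => g q i l) p - partial l (fun q => g q i j) p.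
under eq_bigr => k _ do rewrite -mulrA mulr_suml.
rewrite -mulr_sumr exchange_big /=; congr (_ * _).
rewrite (eq_bigr (fun l => (g p *m invmx (g p)) c l * X l)); last first.
  move=> l _; rewrite mxE mulr_suml; apply: eq_bigr => k _.
  by rewrite (gsym c k Dp) /X; ring.
rewrite mulmxV; last exact/posdef_unit/gpd.
rewrite (bigD1 c)//= mxE eqxx mul1r big1 ?addr0// => l lc.
by rewrite mxE eq_sym (negbTE lc) mul0r.
Qed.

(** The Koszul formula, extended by linearity from coordinate vectors to constant vectors u, v,
    w. *)
Lemma metric_Gam p u v w : D p -> bform (g p) (Gam p u v) w =
  2^-1 * (bform (dmet p u) v w + bform (dmet p v) u w - bform (dmet p w) u v).
Proof.
move=> Dp; rewrite /Gam tri_bilin bform_suml.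
have dE z a b : dmet p z a b = \sum_i z 0 i * partial i (fun q => g q a b) p.
  by rewrite mxE (smooth_deriveE _ oD (gsm a b)).
pose Y i j c := partial i (fun q => g q j c) p.
have E1 : bform (dmet p u) v w = \sum_i \sum_j \sum_c u 0 i * v 0 j * w 0 c * Y i j c.
  rewrite bformE exchange_big /=.
  under eq_bigr => c _ do under eq_bigr => j _ do rewrite dE mulr_sumr mulr_suml.
  under eq_bigr => c _ do rewrite exchange_big.
  rewrite exchange_big /=; apply: eq_bigr => i _; rewrite exchange_big /=.
  by apply: eq_bigr => j _; apply: eq_bigr => c _; rewrite /Y; ring.
have E2 : bform (dmet p v) u w = \sum_i \sum_j \sum_c u 0 i * v 0 j * w 0 c * Y j i c.
  rewrite bformE; apply: eq_bigr => i _ /=.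
  under eq_bigr => c _ do rewrite dE mulr_sumr mulr_suml.
  rewrite exchange_big /=.
  by apply: eq_bigr => j _; apply: eq_bigr => c _; rewrite /Y; ring.
have E3 : bform (dmet p w) u v = \sum_i \sum_j \sum_c u 0 i * v 0 j * w 0 c * Y c i j.
  rewrite bformE; apply: eq_bigr => i _ /=; apply: eq_bigr => j _.
  rewrite dE mulr_sumr mulr_suml.
  by apply: eq_bigr => c _; rewrite /Y; ring.
rewrite E1 E2 E3 -sumrN -!big_split mulr_sumr; apply: eq_bigr => i _ /=.
rewrite bform_suml -sumrN -!big_split mulr_sumr; apply: eq_bigr => j _ /=.
rewrite bformZl -sumrN -!big_split mulr_sumr bformE exchange_big /= mulr_sumr.
apply: eq_bigr => c _; rewrite -mulr_suml.
have -> : \sum_k tri (fun k i j => christoffel g k i j p) (basis_vec i) (basis_vec j) 0 k * g p k c =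
   \sum_k christoffel g k i j p * g p k c.
  apply: eq_bigr => k _; congr (_ * _); rewrite mxE (bigD1 i)//= (bigD1 j)//= !mxE !eqxx !mulr1.
  rewrite !big1 ?addr0// => [i' i'i|j' j'j]; last by rewrite !mxE (negbTE j'j) mulr0.
  by rewrite big1// => j' _; rewrite !mxE (negbTE i'i) mulr0 mul0r.
by rewrite christoffel_lower// /Y; ring.
Qed.

Lemma metric_is_derive (V : normedModType R) (q z : V) (x : V -> 'rV[R]_n) x' : D (x q) ->
  mderiv q z x x' -> mderiv q z (fun s => g (x s)) (dmet (x q) x').
Proof.
move=> Dx Hx a b; rewrite mxE.
apply: (@chain_line _ _ _ (fun p => g p a b)) => //.
exact: smooth_differentiable (gsm a b) Dx.
Qed.

(** A' + Gam(x', A) is the covariant derivative of A along x; by the Koszul formula the two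
    Christoffel terms add up to the derivative of the metric. The parameter space V is arbitrary
    because the rule serves both for the time on a ray and for variations of the initial
    velocity. *)
Lemma metric_compat (V : normedModType R) (q z : V) (x A B : V -> 'rV[R]_n) x' A' B' :
  D (x q) -> mderiv q z x x' -> mderiv q z A A' -> mderiv q z B B' ->
  is_derive q z (fun s => bform (g (x s)) (A s) (B s))
    (bform (g (x q)) (A' + Gam (x q) x' (A q)) (B q) +
     bform (g (x q)) (A q) (B' + Gam (x q) x' (B q))).
Proof.
move=> Dx Hx HA HB; have gx := metric_is_derive Dx Hx.
have := mderivM (mderivM HA gx) (mderivT HB) => /(_ 0 0) H.
apply: (is_derive_eq H); rewrite [LHS]mxE mulmxDl.
set p := x q in Dx gx H *; set a := A q; set b := B q.
rewrite -/(bform (g p) a B') [X in X + _]mxE -/(bform (g p) A' b) -/(bform (dmet p x') a b).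
rewrite bformDl bformDr [bform (g p) a (Gam _ _ _)]bformC; last by case: (gpd Dx).
have sy r u v : bform (dmet p r) u v = bform (dmet p r) v u by rewrite bformC ?dmetT.
rewrite (metric_Gam x' a b Dx) (metric_Gam x' b a Dx) (sy x' b a) (sy b x' a) (sy a x' b).
move: (bform _ A' b) (bform _ a B') (bform _ a b) (bform (dmet p a) b x') (bform _ a x') => *.
by field.
Qed.

Lemma christoffel_differentiable p k i j : D p -> differentiable (christoffel g k i j) p.
Proof.
move=> Dp; have nD := near_open oD Dp.
apply: differentiableM; first exact: differentiable_cst.
have pd a b c : differentiable (partial a (fun q => g q b c)) p.
  by apply: smooth_differentiable Dp => //; exact: smooth_partial.
apply: differentiable_bigsum => l; apply: differentiableM.
  apply: (@differentiable_invmx R _ n g p) => [|a b]; last exact: smooth_differentiable (gsm a b) Dp.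
  by apply: filterS nD => q Dq; exact/posdef_unit/gpd.
by apply: differentiableB => //; exact: differentiableD.
Qed.

(** The index formula for R(u, v)v in invariant form, the shape in which curvature emerges from the
    second covariant derivative of a Jacobi field. *)
Lemma riemann_uvvE p u v : D p ->
  riemann_uvv g p u v = dGam p u v v - dGam p v u v + Gam p u (Gam p v v) - Gam p v (Gam p u v).
Proof.
move=> Dp; apply/rowP => l; rewrite !mxE.
have dE z k i j : 'D_z (christoffel g k i j) p = \sum_a z 0 a * partial a (christoffel g k i j) p.
  by apply: diff_deriveE; exact: christoffel_differentiable.
pose C := christoffel g.
have E1 : \sum_i \sum_j 'D_u (C l i j) p * v 0 i * v 0 j =
    \sum_i \sum_j \sum_k partial i (C l j k) p * (u 0 i * v 0 j * v 0 k).
  under eq_bigr => i _ do under eq_bigr => j _ do rewrite dE -mulrA mulr_suml.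
  under eq_bigr => i _ do rewrite exchange_big.
  rewrite exchange_big /=; apply: eq_bigr => i _.
  by apply: eq_bigr => j _; apply: eq_bigr => k _; ring.
have E2 : \sum_i \sum_j 'D_v (C l i j) p * u 0 i * v 0 j =
    \sum_i \sum_j \sum_k partial j (C l i k) p * (u 0 i * v 0 j * v 0 k).
  apply: eq_bigr => i _; rewrite exchange_big /=; apply: eq_bigr => k _.
  by rewrite dE -mulrA mulr_suml; apply: eq_bigr => a _; ring.
have E3 : \sum_i \sum_j C l i j p * u 0 i * Gam p v v 0 j =
    \sum_i \sum_j \sum_k (\sum_m C m j k p * C l i m p) * (u 0 i * v 0 j * v 0 k).
  apply: eq_bigr => i _.
  under [RHS]eq_bigr => j _ do under eq_bigr => k _ do rewrite mulr_suml.
  under [RHS]eq_bigr => j _ do rewrite exchange_big.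
  rewrite [RHS]exchange_big /=; apply: eq_bigr => m _; rewrite mxE mulr_sumr.
  apply: eq_bigr => j _; rewrite mulr_sumr; apply: eq_bigr => k _; rewrite /C; ring.
have E4 : \sum_i \sum_j C l i j p * v 0 i * Gam p u v 0 j =
    \sum_i \sum_j \sum_k (\sum_m C m i k p * C l j m p) * (u 0 i * v 0 j * v 0 k).
  rewrite [RHS]exchange_big /=; apply: eq_bigr => i _.
  under [RHS]eq_bigr => j _ do under eq_bigr => k _ do rewrite mulr_suml.
  under [RHS]eq_bigr => j _ do rewrite exchange_big.
  rewrite [RHS]exchange_big /=; apply: eq_bigr => m _; rewrite mxE mulr_sumr.
  apply: eq_bigr => j _; rewrite mulr_sumr; apply: eq_bigr => k _; rewrite /C; ring.
rewrite E1 E2 E3 E4 -!sumrN -!big_split; apply: eq_bigr => i _ /=.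
rewrite -!sumrN -!big_split; apply: eq_bigr => j _ /=.
rewrite -!sumrN -!big_split; apply: eq_bigr => k _ /=.
rewrite /riemann big_split /= sumrN -!mulrA -mulrBl -mulrDl -mulrBl -/C; congr (_ * _).
by rewrite addrA.
Qed.

End christoffel.

(** * Jacobi fields along rays *)

(* Sealed: unification would otherwise unfold iterated derivatives. *)
HB.lock Definition d1 {R : realType} {n : nat} (phi : 'rV[R]_n -> 'rV[R]_n) (w y : 'rV[R]_n) : 'rV[R]_n :=
  \row_k 'D_w (fun q => phi q 0 k) y.
HB.lock Definition d2 {R : realType} {n : nat} (phi : 'rV[R]_n -> 'rV[R]_n) (u w y : 'rV[R]_n) : 'rV[R]_n :=
  \row_k 'D_u ('D_w (fun q => phi q 0 k)) y.
HB.lock Definition d3 {R : realType} {n : nat} (phi : 'rV[R]_n -> 'rV[R]_n) (z u w y : 'rV[R]_n) : 'rV[R]_n :=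
  \row_k 'D_z ('D_u ('D_w (fun q => phi q 0 k))) y.

Lemma is_derive_mulc (R : realType) (V : normedModType R) (p w : V) (f : V -> R) (df c : R) :
  is_derive p w f df -> is_derive p w (fun x => f x * c) (df * c).
Proof.
move=> Hf; rewrite mulrC; under eq_fun do rewrite mulrC; exact: is_derive_cmul.
Qed.

Section map_derivatives.
Context {R : realType} {n : nat}.
Variables (phi : 'rV[R]_n -> 'rV[R]_n) (U : set 'rV[R]_n).
Hypothesis oU : open U.
Hypothesis phism : smooth_map_on U phi.
Implicit Types (y u v w z : 'rV[R]_n) (t s : R).

Local Notation d1 := (d1 phi).
Local Notation d2 := (d2 phi).
Local Notation d3 := (d3 phi).
Definition jac y : 'M[R]_n := \matrix_(i, k) partial i (fun q => phi q 0 k) y.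

Lemma d1k w y k : d1 w y 0 k = 'D_w (fun q => phi q 0 k) y.
Proof. by rewrite unlock mxE. Qed.
Lemma d2k u w y k : d2 u w y 0 k = 'D_u ('D_w (fun q => phi q 0 k)) y.
Proof. by rewrite unlock mxE. Qed.
Lemma d3k z u w y k : d3 z u w y 0 k = 'D_z ('D_u ('D_w (fun q => phi q 0 k))) y.
Proof. by rewrite unlock mxE. Qed.
Lemma trik (T : 'I_n -> 'I_n -> 'I_n -> R) u v k : tri T u v 0 k = \sum_i \sum_j T k i j * u 0 i * v 0 j.
Proof. exact: mxE. Qed.


Lemma d1E w y : U y -> d1 w y = w *m jac y.
Proof.
move=> Uy; apply/rowP => k; rewrite d1k (smooth_deriveE _ oU (phism k) Uy) mxE.
by apply: eq_bigr => i _; rewrite mxE.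
Qed.

Lemma d2E u w y : U y ->
  d2 u w y = tri (fun k i j => partial i (partial j (fun q => phi q 0 k)) y) u w.
Proof.
move=> Uy; apply/rowP => k; rewrite d2k trik.
rewrite (smooth_deriveE _ oU (smooth_derive w oU (phism k)) Uy); apply: eq_bigr => i _.
rewrite (_ : partial i _ y = \sum_j w 0 j * partial i (partial j (fun q => phi q 0 k)) y).
  by rewrite mulr_sumr; apply: eq_bigr => j _; rewrite mulrA [LHS]mulrC mulrA.
have -> : partial i ('D_w (fun q => phi q 0 k)) y = partial i (fun q => \sum_j w 0 j * partial j (fun q => phi q 0 k) q) y.
  apply: near_eq_derive; apply: filterS (near_open oU Uy) => q Uq.
  exact: smooth_deriveE Uq.
apply: derive_val; apply: is_derive_bigsum => j; apply: is_derive_cmul.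
apply: derivableP; apply: diff_derivable; apply: smooth_differentiable Uy => //.
exact: smooth_partial.
Qed.

Lemma d2C u w y : U y -> d2 u w y = d2 w u y.
Proof.
move=> Uy; apply/rowP => k; apply: (etrans (d2k u w y k)); apply: etrans (esym (d2k w u y k)).
exact: (smooth_schwarz w u oU (phism k) Uy).
Qed.

Lemma d3C v w y : U y -> d3 v v w y = d3 w v v y.
Proof.
move=> Uy; apply/rowP => k; apply: (etrans (d3k v v w y k)); apply: etrans (esym (d3k w v v y k)).
apply: etrans _ (esym (smooth_schwarz v w oU (smooth_derive v oU (phism k)) Uy)).
apply: near_eq_derive; apply: filterS (near_open oU Uy) => q Uq.
exact: (smooth_schwarz _ _ oU (phism k) Uq).
Qed.

Lemma is_derive_ray (f : 'rV[R]_n -> R) v t : differentiable f (t *: v) ->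
  is_derive t 1 (fun s => f (s *: v)) ('D_v f (t *: v)).
Proof.
move=> fd; apply: (@chain_line _ _ _ f (fun s : R => s *: v)) => //.
move=> i j; under eq_fun do rewrite mxE.
by apply: (is_derive_eq (is_derive_mulc _ (is_derive_id _ _))); rewrite mul1r.
Qed.

Lemma is_derive_dir (f : 'rV[R]_n -> R) v w t : differentiable f (t *: v) ->
  is_derive v w (fun q => f (t *: q)) (t * 'D_w f (t *: v)).
Proof.
move=> fd; have -> : t * 'D_w f (t *: v) = 'D_(t *: w) f (t *: v).
  by rewrite !deriveE// linearZ.
apply: (@chain_line _ _ _ f (fun q : 'rV[R]_n => t *: q)) => //.
apply/mderivP; apply: is_deriveZ.
Qed.

(** The lemmas [mderiv_ray*] vary the time on a fixed ray; the lemmas [mderiv_dir*] vary the initial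
    velocity at a fixed time, which produces Jacobi fields. *)
Lemma mderiv_ray0 v t : U (t *: v) -> mderiv t 1 (fun s => phi (s *: v)) (d1 v (t *: v)).
Proof.
move=> Uy i k; rewrite ord1 d1k; apply: (@is_derive_ray (fun q => phi q 0 k)).
exact: smooth_differentiable (phism k) Uy.
Qed.
Lemma mderiv_ray1 w v t : U (t *: v) -> mderiv t 1 (fun s => d1 w (s *: v)) (d2 v w (t *: v)).
Proof.
move=> Uy i k; rewrite ord1 d2k; under eq_fun do rewrite d1k.
by apply: is_derive_ray; apply: smooth_differentiable Uy => //; exact: smooth_derive.
Qed.
Lemma mderiv_ray2 u w v t : U (t *: v) -> mderiv t 1 (fun s => d2 u w (s *: v)) (d3 v u w (t *: v)).
Proof.
move=> Uy i k; rewrite ord1 d3k; under eq_fun do rewrite d2k.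
by apply: is_derive_ray; apply: smooth_differentiable Uy => //; do 2 apply: smooth_derive => //.
Qed.
Lemma mderiv_dir0 w v t : U (t *: v) -> mderiv v w (fun q => phi (t *: q)) (t *: d1 w (t *: v)).
Proof.
move=> Uy i k; rewrite ord1 mxE d1k; apply: (@is_derive_dir (fun q => phi q 0 k)).
exact: smooth_differentiable (phism k) Uy.
Qed.
Lemma mderiv_dir1 u w v t : U (t *: v) ->
  mderiv v w (fun q => d1 u (t *: q)) (t *: d2 w u (t *: v)).
Proof.
move=> Uy i k; rewrite ord1 mxE d2k; under eq_fun do rewrite d1k.
by apply: is_derive_dir; apply: smooth_differentiable Uy => //; exact: smooth_derive.
Qed.

Lemma near_scale v t : U (t *: v) -> \forall q \near v, U (t *: q).
Proof.
move=> Uy; have /near_open/(_ Uy) H := oU.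
exact: (@scaler_continuous _ _ t v _ H).
Qed.
Lemma near_ray v t : U (t *: v) -> \forall s \near t, U (s *: v).
Proof.
move=> Uy; have /near_open/(_ Uy) H := oU.
exact: (@scalel_continuous _ _ v t _ H).
Qed.

Lemma mderiv_dirJ w v t : U (t *: v) ->
  mderiv v w (fun q => jac (t *: q)) (t *: \matrix_(i, k) 'D_w (partial i (fun q => phi q 0 k)) (t *: v)).
Proof.
move=> Uy i k; rewrite !mxE; under eq_fun do rewrite mxE.
by apply: is_derive_dir; apply: smooth_differentiable Uy => //; exact: smooth_partial.
Qed.

(** Both the direction and the base point depend on q, hence two terms. By symmetry of second
    derivatives this variation of the velocity is also the time derivative of the Jacobi field. *)
Lemma mderiv_dirV w v t : U (t *: v) ->
  mderiv v w (fun q => d1 q (t *: q)) (d1 w (t *: v) + t *: d2 v w (t *: v)).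
Proof.
move=> Uy; apply: (@mderiv_near _ _ _ _ _ _ (fun q => q *m jac (t *: q))).
  by apply: filterS (near_scale Uy) => q Uq; rewrite d1E.
have Hid : mderiv v w (fun q => q) w by apply/mderivP; exact: is_derive_id.
have H := mderivM Hid (mderiv_dirJ w Uy).
rewrite d1E// d2C//; suff -> : d2 w v (t *: v) = v *m \matrix_(i, k) 'D_w (partial i (fun q => phi q 0 k)) (t *: v).
  by rewrite scalemxAr.
apply/rowP => k; rewrite d2k mxE.
have -> : 'D_w ('D_v (fun q => phi q 0 k)) (t *: v) = 'D_w (fun q => \sum_j v 0 j * partial j (fun q => phi q 0 k) q) (t *: v).
  apply: near_eq_derive; apply: filterS (near_open oU Uy) => q Uq.
  exact: smooth_deriveE Uq.
apply: derive_val; apply: is_derive_bigsum => j; rewrite mxE; apply: is_derive_cmul.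
apply: derivableP; apply: diff_derivable; apply: smooth_differentiable Uy => //.
exact: smooth_partial.
Qed.

Lemma mderiv_dir2 w v t : U (t *: v) ->
  mderiv v w (fun q => d2 q q (t *: q)) (2 *: d2 v w (t *: v) + t *: d3 w v v (t *: v)).
Proof.
move=> Uy; pose T q k i j := partial i (partial j (fun q => phi q 0 k)) (t *: q).
apply: (@mderiv_near _ _ _ _ _ _ (fun q => tri (T q) q q)).
  by apply: filterS (near_scale Uy) => q Uq; rewrite d2E.
have Hid : mderiv v w (fun q => q) w by apply/mderivP; exact: is_derive_id.
have HT k i j : is_derive v w (fun q => T q k i j) (t * 'D_w (partial i (partial j (fun q => phi q 0 k))) (t *: v)).
  by apply: is_derive_dir; apply: smooth_differentiable Uy => //; do 2 apply: smooth_partial.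
have := mderiv_tri HT Hid Hid.
suff -> : tri (fun k i j => t * 'D_w (partial i (partial j (fun q => phi q 0 k))) (t *: v)) v v + tri (T v) w v +
    tri (T v) v w = 2 *: d2 v w (t *: v) + t *: d3 w v v (t *: v) by [].
rewrite /T -!d2E// (d2C w)// -addrA -[in X in _ + X = _]mulr2n -scaler_nat addrC; congr (_ + _).
apply/rowP => k; rewrite [RHS]mxE trik.
pose F i j := partial i (partial j (fun q => phi q 0 k)).
have H i j : is_derive (t *: v) w (F i j) ('D_w (F i j) (t *: v)).
  apply: derivableP; apply: diff_derivable; apply: smooth_differentiable Uy => //.
  by do 2 apply: smooth_partial.
have e : d3 w v v (t *: v) 0 k = \sum_i \sum_j 'D_w (F i j) (t *: v) * v 0 i * v 0 j.
  apply: etrans (d3k _ _ _ _ _) _.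
  apply: (@etrans _ _ ('D_w (fun q => \sum_i \sum_j F i j q * v 0 i * v 0 j) (t *: v))).
    apply: near_eq_derive; apply: filterS (near_open oU Uy) => q Uq.
    by have /rowP/(_ k) := d2E v v Uq; rewrite d2k trik.
  apply: derive_val; apply: is_derive_bigsum => i; apply: is_derive_bigsum => j.
  by do 2 apply: is_derive_mulc.
rewrite e mulr_sumr; apply: eq_bigr => i _; rewrite mulr_sumr; apply: eq_bigr => j _.
by rewrite !mulrA.
Qed.

End map_derivatives.

Section jacobi.
Context {R : realType} {n : nat}.
Variables (g : 'rV[R]_n -> 'M[R]_n) (D : set 'rV[R]_n).
Hypothesis oD : open D.
Hypothesis gsm : forall a b, smooth_on D (fun p => g p a b).
Hypothesis gpd : forall p, D p -> posdef (g p).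
Variables (phi : 'rV[R]_n -> 'rV[R]_n) (U : set 'rV[R]_n).
Hypothesis oU : open U.
Hypothesis phism : smooth_map_on U phi.
Hypothesis phiD : forall y, U y -> D (phi y).
Local Notation d1 := (d1 phi).
Local Notation d2 := (d2 phi).
Local Notation d3 := (d3 phi).
(* phi maps the rays t |-> t *: v to geodesics, at t = 1; other t follow by scaling (geo_ray). *)
Hypothesis geo : forall y, U y -> d2 y y y + Gam g (phi y) (d1 y y) (d1 y y) = 0.
Implicit Types (y u v w z : 'rV[R]_n) (t s : R).

Lemma dGamC p z u v : D p -> dGam g p z u v = dGam g p z v u.
Proof.
move=> Dp; apply: triC => k i j; apply: near_eq_derive.
by apply: filterS (near_open oD Dp) => q Dq; exact: (christoffelC oD gpd).
Qed.

Lemma Gam_mderiv (V : normedModType R) (p z : V) (x u v : V -> 'rV[R]_n) x' u' v' : D (x p) ->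
  mderiv p z x x' -> mderiv p z u u' -> mderiv p z v v' ->
  mderiv p z (fun q => Gam g (x q) (u q) (v q))
    (dGam g (x p) x' (u p) (v p) + Gam g (x p) u' (v p) + Gam g (x p) (u p) v').
Proof.
move=> Dx Hx Hu Hv.
have HT k i j : is_derive p z (fun q => christoffel g k i j (x q)) ('D_x' (christoffel g k i j) (x p)).
  by apply: chain_line => //; exact: (christoffel_differentiable oD gsm gpd).
exact: (mderiv_tri HT Hu Hv).
Qed.

Definition pullback y : 'M[R]_n := jac phi y *m g (phi y) *m (jac phi y)^T.

Lemma pullbackE u w y : U y -> bform (pullback y) u w = bform (g (phi y)) (d1 u y) (d1 w y).
Proof.
by move=> Uy; rewrite /bform /pullback (d1E oU phism u Uy) (d1E oU phism w Uy) trmx_mul !mulmxA.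
Qed.

Lemma geo_ray v t : t != 0 -> U (t *: v) ->
  d2 v v (t *: v) = - Gam g (phi (t *: v)) (d1 v (t *: v)) (d1 v (t *: v)).
Proof.
move=> t0 Uy; have := geo Uy.
have -> : d2 (t *: v) (t *: v) (t *: v) = (t * t) *: d2 v v (t *: v).
  by rewrite !(d2E oU phism)// triZl triZr scalerA.
have -> : d1 (t *: v) (t *: v) = t *: d1 v (t *: v).
  by rewrite !(d1E oU phism)// scalemxAl.
rewrite /Gam triZl triZr scalerA -scalerDr => /eqP; rewrite scaler_eq0 mulf_eq0 (negbTE t0) /=.
by rewrite addr_eq0 => /eqP.
Qed.

(* The coordinate and the covariant derivative along the ray of the Jacobi field
   J_w(t) = t *: d1 w (t *: v). *)
Definition KJ w v t := d1 w (t *: v) + t *: d2 v w (t *: v).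
Definition DJ w v t := KJ w v t + Gam g (phi (t *: v)) (d1 v (t *: v)) (t *: d1 w (t *: v)).

(** The geodesic equation at time t holds for all initial velocities near v, so its derivative at v
    in the direction w vanishes. The left-hand side is the time derivative of [KJ w v]. *)
Lemma linearized_geodesic w v t : t != 0 -> U (t *: v) ->
  2 *: d2 v w (t *: v) + t *: d3 w v v (t *: v) =
  - dGam g (phi (t *: v)) (t *: d1 w (t *: v)) (d1 v (t *: v)) (d1 v (t *: v))
  - 2 *: Gam g (phi (t *: v)) (d1 v (t *: v)) (KJ w v t).
Proof.
move=> t0 Uy; have HV := mderiv_dirV oU phism w Uy.
have H := mderivD (mderiv_dir2 oU phism w Uy)
  (Gam_mderiv (phiD Uy) (mderiv_dir0 oU phism w Uy) HV HV).
have H0 : mderiv v w (fun q => d2 q q (t *: q) + Gam g (phi (t *: q)) (d1 q (t *: q)) (d1 q (t *: q))) 0.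
  apply: (@mderiv_near _ _ _ _ _ _ (fun=> 0)); last exact: mderiv_cst.
  apply: filterS (near_scale oU Uy) => q Uq.
  by rewrite (geo_ray t0 Uq) addNr.
have := mderiv_uniq H H0; rewrite -/(KJ w v t).
rewrite [Gam g _ (KJ w v t) _](GamC oD gpd); last exact: phiD.
move: (dGam _ _ _ _ _) (Gam _ _ _ _) (_ + t *: d3 _ _ _ _) => a b c /eqP.
rewrite addr_eq0 => /eqP ->; rewrite -addrA -mulr2n -scaler_nat opprD.
by [].
Qed.

Lemma mderiv_J w v t : U (t *: v) -> mderiv t 1 (fun s => s *: d1 w (s *: v)) (KJ w v t).
Proof.
move=> Uy; have := mderivZ (is_derive_id t 1) (mderiv_ray1 oU phism w Uy).
by rewrite scale1r.
Qed.

Lemma mderiv_K w v t : t != 0 -> U (t *: v) -> mderiv t 1 (KJ w v)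
  (- dGam g (phi (t *: v)) (t *: d1 w (t *: v)) (d1 v (t *: v)) (d1 v (t *: v))
  - 2 *: Gam g (phi (t *: v)) (d1 v (t *: v)) (KJ w v t)).
Proof.
move=> t0 Uy; rewrite -linearized_geodesic//.
have := mderivD (mderiv_ray1 oU phism w Uy)
  (mderivZ (is_derive_id t 1) (mderiv_ray2 oU phism v w Uy)).
rewrite scale1r (d3C oU phism)// addrA -mulr2n -scaler_nat; exact.
Qed.

(** D_t D_t J = - R(J, V)V, where A + Gam(V, DJ) is the second covariant derivative. It is the
    linearized geodesic equation, regrouped with the geodesic equation for V itself. *)
Lemma jacobi_equation w v t : t != 0 -> U (t *: v) -> exists2 A,
  mderiv t 1 (DJ w v) A &
  A + Gam g (phi (t *: v)) (d1 v (t *: v)) (DJ w v t) =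
  - riemann_uvv g (phi (t *: v)) (t *: d1 w (t *: v)) (d1 v (t *: v)).
Proof.
move=> t0 Uy; have Dp := phiD Uy; eexists.
  apply: mderivD (mderiv_K w t0 Uy) _.
  apply: (Gam_mderiv Dp); [exact: mderiv_ray0 Uy|exact: (mderiv_ray1 oU phism)|exact: mderiv_J].
rewrite (riemann_uvvE oD gsm gpd)// geo_ray// /DJ.
rewrite (dGamC _ (t *: _) _ Dp) (GamC oD gpd (t *: _) (Gam _ _ _ _) Dp) (GamC oD gpd (t *: _) (d1 _ _) Dp).
rewrite /Gam triDr triNl -/(Gam g (phi (t *: v))).
set V := d1 v _; set J := t *: d1 w _; set K := KJ w v t; set p := phi _.
move: (dGam g p J V V) (dGam g p V V J) (Gam g p V K) (Gam g p (Gam g p V V) J) (Gam g p V (Gam g p V J)) => a b c d e.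
apply/rowP => k; rewrite !mxE; ring.
Qed.

Lemma speed_const v t : t != 0 -> U (t *: v) -> is_derive t 1 (fun s => bform (pullback (s *: v)) v v) 0.
Proof.
move=> t0 Uy; have Dp := phiD Uy.
have HV := mderiv_ray1 oU phism v Uy.
have := metric_compat oD gsm gpd Dp (mderiv_ray0 oU phism Uy) HV HV.
rewrite geo_ray// addNr bform0l bform0r addr0.
apply: near_eq_is_derive; apply: filterS (near_ray oU Uy) => s Us; exact/esym/pullbackE.
Qed.

Lemma mderiv_V v w t : U (t *: v) -> mderiv v w (fun q => d1 q (t *: q)) (KJ w v t).
Proof. exact: mderiv_dirV. Qed.

Lemma DJ_dir w v t : U (t *: v) ->
  KJ w v t + Gam g (phi (t *: v)) (t *: d1 w (t *: v)) (d1 v (t *: v)) = DJ w v t.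
Proof. by move=> Uy; rewrite /DJ (GamC oD gpd)//; exact: phiD. Qed.

Section gauss.
Variables (G0 : 'M[R]_n).
Hypothesis G0s : G0^T = G0.

Lemma is_derive_bform_dir (v w u : 'rV[R]_n) : is_derive v w (fun q => bform G0 q u) (bform G0 w u).
Proof.
have Hid : mderiv v w (fun q => q) w by apply/mderivP; exact: is_derive_id.
have := mderivM (mderivM Hid (mderiv_cst v w G0)) (mderiv_cst v w u^T) => /(_ 0 0) H.
by apply: (is_derive_eq H); rewrite !mulmx0 !addr0.
Qed.

Lemma is_derive_bform_dir2 (v w : 'rV[R]_n) : is_derive v w (fun q => bform G0 q q) (2 * bform G0 v w).
Proof.
have Hid : mderiv v w (fun q => q) w by apply/mderivP; exact: is_derive_id.
have := mderivM (mderivM Hid (mderiv_cst v w G0)) (mderivT Hid) => /(_ 0 0) H.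
apply: (is_derive_eq H); rewrite mulmx0 addr0 mxE -/(bform G0 w v) -/(bform G0 v w).
by rewrite (bformC w v G0s) mulr2n mulrDl !mul1r.
Qed.

(** D_t J_w is the covariant derivative of the velocity V in the direction w, so its product with V
    is half the derivative of |V|^2 = G0(v, v) in that direction. *)
Lemma DJ_velocity v w t : t != 0 -> U (t *: v) ->
  (forall q, U (t *: q) -> bform (pullback (t *: q)) q q = bform G0 q q) ->
  bform (g (phi (t *: v))) (d1 v (t *: v)) (DJ w v t) = bform G0 v w.
Proof.
move=> t0 Uy gauss1; have Dp := phiD Uy; have HV := mderiv_V w Uy.
have H := metric_compat oD gsm gpd Dp (mderiv_dir0 oU phism w Uy) HV HV.
rewrite DJ_dir// in H.
have H' : is_derive v w (fun q => bform (g (phi (t *: q))) (d1 q (t *: q)) (d1 q (t *: q))) (2 * bform G0 v w).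
  apply: near_eq_is_derive (is_derive_bform_dir2 v w).
  by apply: filterS (near_scale oU Uy) => q Uq; rewrite -gauss1// pullbackE.
have e : 2 * bform (g (phi (t *: v))) (d1 v (t *: v)) (DJ w v t) = 2 * bform G0 v w.
  have [_ <-] := H'; have [_ ->] := H.
  by rewrite [X in X + _]bformC ?mulr2n ?mulrDl ?mul1r//; case: (gpd Dp).
by move/mulfI: e; apply.
Qed.

(** Gauss lemma in differentiated form: the derivative of <V, J_w> is <V, D_t J_w>, because V is
    parallel along the geodesic. *)
Lemma gauss_radial v w t : t != 0 -> U (t *: v) ->
  (forall q, U (t *: q) -> bform (pullback (t *: q)) q q = bform G0 q q) ->
  is_derive t 1 (fun s => s * bform (pullback (s *: v)) v w) (bform G0 v w).
Proof.
move=> t0 Uy gauss1; have Dp := phiD Uy.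
have := metric_compat oD gsm gpd Dp (mderiv_ray0 oU phism Uy) (mderiv_ray1 oU phism v Uy) (mderiv_J w Uy).
rewrite geo_ray// addNr bform0l add0r -/(DJ w v t) DJ_velocity//.
apply: near_eq_is_derive; apply: filterS (near_ray oU Uy) => s Us.
by rewrite bformZr pullbackE.
Qed.

(* The rows of JJ are the Jacobi fields J_a of the basis vectors. Writing V for the velocity of
   the ray, HH = <DJ_a, J_b> is half the derivative of <J_a, J_b> = t^2 pullback (t *: v), and
   QQ = <R(J_a, V)V, J_b>. *)
Definition JJ v t : 'M[R]_n := t *: jac phi (t *: v).
Definition DD v t : 'M[R]_n := \matrix_a DJ (basis_vec a) v t.
Definition HH v t : 'M[R]_n := DD v t *m g (phi (t *: v)) *m (JJ v t)^T.
Definition QQ v t : 'M[R]_n :=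
  (\matrix_a riemann_uvv g (phi (t *: v)) (t *: d1 (basis_vec a) (t *: v)) (d1 v (t *: v)))
    *m g (phi (t *: v)) *m (JJ v t)^T.

Lemma row_JJ a v t : U (t *: v) -> row a (JJ v t) = t *: d1 (basis_vec a) (t *: v).
Proof. by move=> Uy; rewrite (d1E oU phism)// /basis_vec -rowE /JJ; apply/rowP => k; rewrite !mxE. Qed.

Lemma mx_bformE (A B G : 'M[R]_n) a b : (A *m G *m B^T) a b = bform G (row a A) (row b B).
Proof.
rewrite /bform tr_row -row_mul; move: (A *m G) => C.
rewrite !mxE; apply: eq_bigr => j _; by rewrite !mxE.
Qed.

Lemma HHE v t a b : U (t *: v) ->
  HH v t a b = bform (g (phi (t *: v))) (DJ (basis_vec a) v t) (t *: d1 (basis_vec b) (t *: v)).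
Proof. by move=> Uy; rewrite /HH mx_bformE rowK row_JJ. Qed.

Lemma QQE v t a b : U (t *: v) ->
  QQ v t a b = bform (g (phi (t *: v)))
    (riemann_uvv g (phi (t *: v)) (t *: d1 (basis_vec a) (t *: v)) (d1 v (t *: v)))
    (t *: d1 (basis_vec b) (t *: v)).
Proof. by move=> Uy; rewrite /QQ mx_bformE rowK row_JJ. Qed.

(** Differentiate <V, J_b> = t G0(v, e_b) in the direction e_a: this gives <D_t J_a, J_b> + <V, B a
    b> = t G0 a b. Here [B a b], the covariant derivative of J_b in direction a, is symmetric
    because the connection is torsion free. *)
Lemma HH_sym v t : t != 0 -> U (t *: v) ->
  (forall q, U (t *: q) -> bform (pullback (t *: q)) q q = bform G0 q q) ->
  (forall q w, U (t *: q) -> bform (pullback (t *: q)) q w = bform G0 q w) ->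
  (HH v t)^T = HH v t.
Proof.
move=> t0 Uy gauss1 gauss2; have Dp := phiD Uy.
pose B a b := (t * t) *: d2 (basis_vec a) (basis_vec b) (t *: v) +
  Gam g (phi (t *: v)) (t *: d1 (basis_vec a) (t *: v)) (t *: d1 (basis_vec b) (t *: v)).
have BC a b : B a b = B b a by rewrite /B (d2C oU phism)// (GamC oD gpd).
suff HB a b : HH v t a b + bform (g (phi (t *: v))) (d1 v (t *: v)) (B a b) = t * G0 a b.
  have G0C a b : G0 a b = G0 b a by rewrite -[in LHS]G0s mxE.
  apply/matrixP => a b; rewrite mxE; apply: (addIr (bform (g (phi (t *: v))) (d1 v (t *: v)) (B a b))).
  by rewrite HB BC HB G0C.
have HJ : mderiv v (basis_vec a) (fun q => t *: d1 (basis_vec b) (t *: q))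
    ((t * t) *: d2 (basis_vec a) (basis_vec b) (t *: v)).
  have := mderivZ (is_derive_cst t v (basis_vec a)) (mderiv_dir1 oU phism (basis_vec b) (basis_vec a) Uy).
  by rewrite scale0r add0r scalerA.
have := metric_compat oD gsm gpd Dp (mderiv_dir0 oU phism (basis_vec a) Uy) (mderiv_V (basis_vec a) Uy) HJ.
rewrite DJ_dir// -HHE// => -[_ <-].
have := is_derive_cmul t (is_derive_bform_dir v (basis_vec a) (basis_vec b)).
rewrite bform_basis => -[_ <-]; apply: near_eq_derive.
apply: filterS (near_scale oU Uy) => q Uq.
by rewrite bformZr -pullbackE// gauss2.
Qed.

Lemma is_derive_P v t a b : t != 0 -> U (t *: v) ->
  is_derive t 1 (fun s => s ^+ 2 * pullback (s *: v) a b) (HH v t a b + HH v t b a).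
Proof.
move=> t0 Uy; have Dp := phiD Uy.
have := metric_compat oD gsm gpd Dp (mderiv_ray0 oU phism Uy) (mderiv_J (basis_vec a) Uy) (mderiv_J (basis_vec b) Uy).
rewrite -/(DJ (basis_vec a) v t) -/(DJ (basis_vec b) v t) -HHE//.
rewrite [X in _ + X]bformC; last by case: (gpd Dp).
rewrite -HHE//; apply: near_eq_is_derive; apply: filterS (near_ray oU Uy) => s Us.
by rewrite bformZl bformZr mulrA -expr2 -pullbackE// bform_basis.
Qed.

(** The derivative of <D_t J_a, J_b> is the curvature term plus <D_t J_a, D_t J_b>. As the J_a form
    a basis, the latter is expressed by [HH] and the pulled-back metric, which removes the chart
    from the quadratic term. *)
Lemma is_derive_HH v t : t != 0 -> U (t *: v) -> jac phi (t *: v) \in unitmx ->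
  mderiv t 1 (HH v) (HH v t *m invmx (t ^+ 2 *: pullback (t *: v)) *m (HH v t)^T - QQ v t).
Proof.
move=> t0 Uy uJ a b; have Dp := phiD Uy.
have uJJ : JJ v t \in unitmx by rewrite /JJ unitmxZ// unitfE.
have gT : (g (phi (t *: v)))^T = g (phi (t *: v)) by case: (gpd Dp).
have -> : HH v t *m invmx (t ^+ 2 *: pullback (t *: v)) *m (HH v t)^T =
    DD v t *m g (phi (t *: v)) *m (DD v t)^T.
  have -> : t ^+ 2 *: pullback (t *: v) = JJ v t *m g (phi (t *: v)) *m (JJ v t)^T.
    by rewrite /JJ linearZ /= -!scalemxAl -scalemxAr scalerA -expr2.
  have ug := posdef_unit (gpd Dp).
  rewrite invmxM ?unitmx_tr ?unitmx_mul ?uJJ// invmxM// /HH.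
  rewrite -(mulmxA _ _ (invmx (JJ v t)^T *m _)) mulKVmx ?unitmx_tr//.
  rewrite -(mulmxA _ _ (invmx _ *m _)) mulKVmx//.
  by rewrite trmx_mul trmxK trmx_mul gT -!mulmxA mulKmx.
have [A HA eA] := jacobi_equation (basis_vec a) t0 Uy.
have := metric_compat oD gsm gpd Dp (mderiv_ray0 oU phism Uy) HA (mderiv_J (basis_vec b) Uy).
rewrite eA bformNl -QQE// -/(DJ (basis_vec b) v t).
rewrite [X in is_derive _ _ _ X -> _](_ : _ = (DD v t *m g (phi (t *: v)) *m (DD v t)^T - QQ v t) a b); last first.
  have mxBE (A1 B1 : 'M[R]_n) : (A1 - B1) a b = A1 a b - B1 a b by rewrite !mxE.
  by rewrite mxBE (mx_bformE (DD v t) (DD v t)) /DD !rowK addrC.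
apply: near_eq_is_derive; apply: filterS (near_ray oU Uy) => s Us.
by rewrite HHE.
Qed.

End gauss.

End jacobi.

(** * Comparison in normal coordinates *)

Lemma continuous_bigsum (R : realType) (T : topologicalType) (x : T) (I : Type) (r : seq I) (F : I -> T -> R) :
  (forall i, {for x, continuous (F i)}) -> {for x, continuous (fun y => \sum_(i <- r) F i y)}.
Proof.
move=> H; elim: r => [|i r IH].
  rewrite (_ : (fun y => _) = fun=> 0); first exact: cst_continuous.
  by apply/funext => y; rewrite big_nil.
rewrite (_ : (fun y => _) = fun y => F i y + \sum_(i <- r) F i y); first exact: (continuousD (H i) IH).
by apply/funext => y; rewrite big_cons.
Qed.

Lemma continuous_bigprod (R : realType) (T : topologicalType) (x : T) (I : Type) (r : seq I) (F : I -> T -> R) :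
  (forall i, {for x, continuous (F i)}) -> {for x, continuous (fun y => \prod_(i <- r) F i y)}.
Proof.
move=> H; elim: r => [|i r IH].
  rewrite (_ : (fun y => _) = fun=> 1); first exact: cst_continuous.
  by apply/funext => y; rewrite big_nil.
rewrite (_ : (fun y => _) = fun y => F i y * \prod_(i <- r) F i y); first exact: (continuousM (H i) IH).
by apply/funext => y; rewrite big_cons.
Qed.

Lemma tr_invmx_lin (R : realType) n (P Q B : 'M[R]_n) (a b x : R) : P \in unitmx ->
  \tr (invmx P *m (Q + a *: (b *: P - x *: B))) = \tr (invmx P *m Q) + a * (b * n%:R - x * \tr (invmx P *m B)).
Proof.
move=> uP; rewrite mulmxDr -scalemxAr mulmxBr -!scalemxAr (mulVmx uP).
by rewrite raddfD /= mxtraceZ raddfB /= !mxtraceZ mxtrace1.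
Qed.

Section sectional.
Context {R : realType} {n : nat}.
Variables (g : 'rV[R]_n -> 'M[R]_n) (D : set 'rV[R]_n).
Hypothesis oD : open D.
Hypothesis gsm : forall a b, smooth_on D (fun p => g p a b).
Hypothesis gpd : forall p, D p -> posdef (g p).

Lemma riemann_uvvk p u v l : riemann_uvv g p u v 0 l =
  \sum_i \sum_j \sum_k riemann g l i j k p * u 0 i * v 0 j * v 0 k.
Proof. exact: mxE. Qed.

Lemma riemann_uvvDl p u u' v : riemann_uvv g p (u + u') v = riemann_uvv g p u v + riemann_uvv g p u' v.
Proof.
apply/rowP => l; rewrite [RHS]mxE !riemann_uvvk -big_split; apply: eq_bigr => i _ /=.
rewrite -big_split; apply: eq_bigr => j _ /=; rewrite -big_split; apply: eq_bigr => k _ /=.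
by rewrite mxE mulrDr !mulrDl.
Qed.

Lemma riemann_uvvZl p a u v : riemann_uvv g p (a *: u) v = a *: riemann_uvv g p u v.
Proof.
apply/rowP => l; rewrite [RHS]mxE !riemann_uvvk mulr_sumr; apply: eq_bigr => i _ /=.
rewrite mulr_sumr; apply: eq_bigr => j _ /=; rewrite mulr_sumr; apply: eq_bigr => k _ /=.
by rewrite mxE mulrCA !mulrA.
Qed.

Lemma riemann_uvv_suml p v (I : Type) (r : seq I) (F : I -> 'rV[R]_n) :
  riemann_uvv g p (\sum_(i <- r) F i) v = \sum_(i <- r) riemann_uvv g p (F i) v.
Proof.
elim: r => [|i r IH]; last by rewrite !big_cons riemann_uvvDl IH.
by rewrite !big_nil -(scale0r 0) riemann_uvvZl !scale0r.
Qed.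

Lemma riemann_vvv p v : D p -> riemann_uvv g p v v = 0.
Proof. by move=> Dp; rewrite (riemann_uvvE oD gsm gpd)// subrr add0r subrr. Qed.

Lemma riemann_u00 p u : riemann_uvv g p u 0 = 0.
Proof.
apply/rowP => l; rewrite riemann_uvvk [RHS]mxE big1// => i _; rewrite big1// => j _; rewrite big1// => k _.
by rewrite !mxE !mulr0.
Qed.

(** This clears the denominator of [sectional_form]. For linearly dependent u and v, both the Gram
    determinant and <R(u, v)v, u> vanish; otherwise the Gram determinant is positive. *)
Lemma sectional_bound p (c : R) u v : D p -> 0 <= c ->
  (forall s : 'M[R]_(2, n), row_free s -> - c <= sectional_form g p (row 0 s) (row 1 s) <= 0) ->
  - c * (bform (g p) u u * bform (g p) v v - bform (g p) u v ^+ 2)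
   <= bform (g p) (riemann_uvv g p u v) u <= 0.
Proof.
move=> Dp c0 K; have pG := gpd Dp.
have [->|v0] := eqVneq v 0.
  have e : bform (g p) u u * bform (g p) 0 0 - bform (g p) u 0 ^+ 2 = 0.
    by rewrite !bform0r mulr0 expr0n subrr.
  by rewrite e mulr0 riemann_u00 bform0l lexx.
have [[a ->]|uv] := pselect (exists a, u = a *: v).
  rewrite riemann_uvvZl riemann_vvv// scaler0 bform0l lexx andbT bformZl bformZr bformZl.
  by rewrite (_ : _ - _ = 0) ?mulr0//; ring.
pose s : 'M[R]_(2, n) := \matrix_(i < 2) (if i == 0 then u else v).
have s0 : row 0 s = u by rewrite rowK.
have s1 : row 1 s = v by rewrite rowK.
have fs : row_free s.
  rewrite -kermx_eq0; apply/eqP/row_matrixP => i; rewrite row0.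
  set d : 'rV[R]_2 := row i _.
  have : d *m s = 0 by rewrite /d -row_mul mulmx_ker row0.
  rewrite mulmx_sum_row big_ord_recl big_ord1 (_ : lift ord0 ord0 = 1); last exact/val_inj.
  rewrite s0 s1 => e.
  have d0 : d 0 0 = 0.
    apply/eqP/negPn/negP => d0; apply: uv; exists (- (d 0 0)^-1 * d 0 1).
    apply: (scalerI d0); rewrite scalerA mulrA mulrN mulfV// mulN1r scaleNr.
    by apply/eqP; rewrite -addr_eq0; apply/eqP.
  have d1 : d 0 1 = 0.
    by move: e; rewrite d0 scale0r add0r => /eqP; rewrite scaler_eq0 (negbTE v0) orbF => /eqP.
  apply/rowP => j; rewrite [RHS]mxE; have : (j == 0) || (j == 1) by case: j => -[|[|]].
  by case/orP => /eqP ->.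
have den : 0 < bform (g p) u u * bform (g p) v v - bform (g p) u v ^+ 2.
  have w0 : bform (g p) v v *: u - bform (g p) u v *: v != 0.
    apply/eqP => /eqP; rewrite subr_eq0 => /eqP e; apply: uv.
    exists ((bform (g p) v v)^-1 * bform (g p) u v).
    by rewrite -scalerA -e scalerA mulVf ?scale1r// gt_eqF// pG.2.
  have vv := pG.2 _ v0; have := pG.2 _ w0.
  rewrite !(bformBl, bformBr, bformZl, bformZr) (bformC v u pG.1).
  move: (bform _ v v) (bform _ u v) (bform _ u u) vv => a b d vv.
  rewrite (_ : _ - _ = a * (d * a - b ^+ 2)); last by ring.
  by rewrite pmulr_rgt0.
have := K s fs; rewrite s0 s1 /sectional_form.
rewrite -/(bform (g p) (riemann_uvv g p u v) u) -/(bform (g p) u u) -/(bform (g p) v v) -/(bform (g p) u v).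
by rewrite ler_pdivlMr// ler_pdivrMr// mul0r.
Qed.

End sectional.

(* A chart around the point with normal coordinates y, the metric having the matrix G in
   normal coordinates; the curvature bounds are known in this chart at that point only. *)
Definition normal_chart (R : realType) (n : nat) (c : R) (G : 'rV[R]_n -> 'M[R]_n) (y : 'rV[R]_n) : Prop :=
  exists (g : 'rV[R]_n -> 'M[R]_n) (D : set 'rV[R]_n) (phi : 'rV[R]_n -> 'rV[R]_n) (U : set 'rV[R]_n),
  [/\ [/\ open D, forall a b, smooth_on D (fun p => g p a b) & forall p, D p -> posdef (g p)],
      [/\ open U, smooth_map_on U phi, forall z, U z -> D (phi z) & U y],
      forall z, U z -> d2 phi z z z + Gam g (phi z) (d1 phi z z) (d1 phi z z) = 0,
      forall z, U z -> G z = pullback g phi z /\ jac phi z \in unitmx &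
      forall s : 'M[R]_(2, n), row_free s -> - c <= sectional_form g (phi y) (row 0 s) (row 1 s) <= 0].

Section normal_coordinates.
Context {R : realType} {n : nat}.
Variables (c : R) (G : 'rV[R]_n -> 'M[R]_n).
Hypothesis c0 : 0 < c.
Hypothesis NC : forall y, normal_chart c G y.
Hypothesis Gc : forall a b, {for 0, continuous (fun y => G y a b)}.
Implicit Types (u v w q y : 'rV[R]_n) (t s : R).

Lemma G_posdef y : posdef (G y).
Proof.
have [g [D [phi [U [[oD gsm gpd] [oU psm pD Uy] _ /(_ y Uy)[-> uJ] _]]]]] := NC y.
have [gT gP] := gpd _ (pD _ Uy); split.
  by rewrite /pullback !trmx_mul trmxK gT mulmxA.
move=> v v0; have := gP (v *m jac phi y); rewrite /bform /pullback trmx_mul !mulmxA; apply.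
by apply: contra v0 => /eqP e; rewrite -(mulmxK uJ v) e mul0mx.
Qed.

Lemma bformG_continuous v u w : {for 0, continuous (fun t : R => bform (G (t *: v)) u w)}.
Proof.
have -> : (fun t : R => bform (G (t *: v)) u w) =
    (fun t : R => \sum_i \sum_j u 0 i * G (t *: v) i j * w 0 j).
  by apply/funext => t; rewrite bformE.
apply: continuous_bigsum => i; apply: continuous_bigsum => j.
apply: continuousM; last exact: cst_continuous.
apply: continuousM; first exact: cst_continuous.
apply: (@continuous_comp _ _ _ (fun t : R => t *: v) (fun y => G y i j)); first exact: scalel_continuous.
by rewrite scale0r; exact: Gc.
Qed.

Lemma const_from_zero (f : R -> R) : {for 0, continuous f} -> (forall t, 0 < t -> is_derive t 1 f 0) ->
  forall t, 0 < t -> f t = f 0.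
Proof.
move=> cf df t t0; apply/eqP; rewrite eq_le; apply/andP; split.
  apply: (@le_near0_right _ _ t f cf) => // s s0 st.
  by apply: (@le0_deriv_nincr _ f (fun=> 0) 0 df) => //; exact: ltW.
rewrite -lerN2; apply: (@le_near0_right _ _ t (fun x => - f x)) => //; first exact: continuousN.
move=> s s0 st; rewrite lerN2.
by apply: (@ge0_deriv_ndecr _ f (fun=> 0) 0 df) => //; exact: ltW.
Qed.

(** The speed of the ray is locally constant for t > 0, each time having its own chart; the
    statement involves only G, so the local facts glue. Continuity of G at 0 gives the constant. *)
Lemma gauss1 q : bform (G q) q q = bform (G 0) q q.
Proof.
have := @const_from_zero (fun t => bform (G (t *: q)) q q) (@bformG_continuous q q q) _ 1 ltr01.
rewrite scale1r scale0r; apply => t t0.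
have [g [D [phi [U [[oD gsm gpd] [oU psm pD Uy] geo GG _]]]]] := NC (t *: q).
have := speed_const oD gsm gpd oU psm pD geo (lt0r_neq0 t0) Uy.
apply: near_eq_is_derive; apply: filterS (near_ray oU Uy) => s Us.
by have [-> _] := GG _ Us.
Qed.

Lemma gauss1_ray q t : t != 0 -> bform (G (t *: q)) q q = bform (G 0) q q.
Proof.
move=> t0; have := gauss1 (t *: q); rewrite !bformZl !bformZr => /(mulfI t0)/(mulfI t0).
exact.
Qed.

Lemma gauss2 q w : bform (G q) q w = bform (G 0) q w.
Proof.
(* The derivative of f vanishes for t > 0, and the factor t makes f vanish at 0. *)
pose f t := t * bform (G (t *: q)) q w - t * bform (G 0) q w.
have cf : {for 0, continuous f}.
  apply: continuousB; apply: continuousM; [exact: cvg_id|exact: bformG_continuous|exact: cvg_id|exact: cst_continuous].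
have := const_from_zero cf _ ltr01; rewrite /f !mul0r subrr !mul1r scale1r => H.
apply/eqP; rewrite -subr_eq0; apply/eqP; apply: H => t t0.
have [g [D [phi [U [[oD gsm gpd] [oU psm pD Uy] geo GG _]]]]] := NC (t *: q).
have t1 := lt0r_neq0 t0; have [G0T _] := G_posdef 0.
have dG : is_derive t 1 (fun s => s * bform (G (s *: q)) q w) (bform (G 0) q w).
  have g1 q' : U (t *: q') -> bform (pullback g phi (t *: q')) q' q' = bform (G 0) q' q'.
    by move=> Uq'; have [<- _] := GG _ Uq'; exact: gauss1_ray.
  apply: near_eq_is_derive (gauss_radial oD gsm gpd oU psm pD geo G0T w t1 Uy g1).
  apply: filterS (near_ray oU Uy) => s Us.
  by have [-> _] := GG _ Us.
have := is_deriveB dG (is_derive_mulc (bform (G 0) q w) (is_derive_id t 1)).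
by rewrite mul1r subrr.
Qed.

Lemma gauss2_ray q w t : t != 0 -> bform (G (t *: q)) q w = bform (G 0) q w.
Proof. by move=> t0; have := gauss2 (t *: q) w; rewrite !bformZl => /(mulfI t0). Qed.

Lemma gauss2_mx q t : t != 0 -> q *m G (t *: q) = q *m G 0.
Proof.
move=> t0; apply/rowP => k; have := gauss2_ray q (basis_vec k) t0.
by rewrite /bform /basis_vec trmx_delta -!colE !mxE.
Qed.

Section ray.
Variable v : 'rV[R]_n.
Local Notation P := (fun t : R => t ^+ 2 *: G (t *: v)).

Lemma P_posdef t : t != 0 -> posdef (P t).
Proof.
move=> t0; have [GT GP] := G_posdef (t *: v); split; first by rewrite linearZ /= GT.
move=> w w0; rewrite bform_mxZ mulr_gt0 ?GP// exprn_even_gt0//.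
Qed.

(* The matrix HH of each chart, expressed by G only and therefore the same in all charts. *)
Definition Hm t : 'M[R]_n := \matrix_(a, b) (2^-1 * 'D_1 (fun s => s ^+ 2 * G (s *: v) a b) t).

(** The facts proved in a chart around the point at time t, restated for G. Q is the curvature form
    <R(J_w, V)V, J_w>; its bounds use |V|^2 = G0(v, v), |J_w|^2 = P(w, w) and <J_w, V> = P(w, v) /
    t. *)
Lemma Hm_riccati t : 0 < t ->
  [/\ mderiv t 1 P (2 *: Hm t), (Hm t)^T = Hm t &
     exists2 Q : 'M[R]_n, mderiv t 1 Hm (Hm t *m invmx (P t) *m Hm t - Q) &
      forall w, - c * (bform (G 0) v v * bform (P t) w w - (t^-1 * bform (P t) w v) ^+ 2) <= bform Q w w <= 0].
Proof.
move=> t0; have [g [D [phi [U [[oD gsm gpd] [oU psm pD Uy] geo GG sec]]]]] := NC (t *: v).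
have t1 := lt0r_neq0 t0; have [G0T _] := G_posdef 0.
have g1 q s : s != 0 -> U (s *: q) -> bform (pullback g phi (s *: q)) q q = bform (G 0) q q.
  by move=> s0 Us; have [<- _] := GG _ Us; exact: gauss1_ray.
have g2 q w s : s != 0 -> U (s *: q) -> bform (pullback g phi (s *: q)) q w = bform (G 0) q w.
  by move=> s0 Us; have [<- _] := GG _ Us; exact: gauss2_ray.
have HT s : s != 0 -> U (s *: v) -> (HH g phi v s)^T = HH g phi v s.
  move=> s0 Us; apply: (HH_sym oD gsm gpd oU psm pD G0T s0 Us) => [q Uq|q w Uq]; [exact: g1|exact: g2].
(* For all s in the chart and not only s = t: to differentiate [Hm] at t, its identification with
   [HH] is needed on a neighbourhood. *)
have dP s : s != 0 -> U (s *: v) -> mderiv s 1 P (2 *: HH g phi v s).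
  move=> s0 Us a b; have H := is_derive_P oD gsm gpd oU psm pD a b s0 Us.
  have e : HH g phi v s a b + HH g phi v s b a = (2 *: HH g phi v s) a b.
    by rewrite [RHS]mxE -{2}(HT s s0 Us) [X in _ + X]mxE mulr2n mulrDl !mul1r.
  rewrite -e; apply: near_eq_is_derive H; apply: filterS (near_ray oU Us) => r Ur.
  by have [-> _] := GG _ Ur; rewrite [RHS]mxE.
have HE s : s != 0 -> U (s *: v) -> HH g phi v s = Hm s.
  move=> s0 Us; apply/matrixP => a b; rewrite [RHS]mxE.
  have [_] := dP s s0 Us a b; under eq_fun do rewrite mxE.
  by move=> ->; rewrite [X in _ = _ * X]mxE mulrA mulVf// mul1r.
split; first by rewrite -HE//; exact: dP.
  by rewrite -HE//; exact: HT.
have [GE uJ] := GG _ Uy.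
exists (QQ g phi v t).
  have := is_derive_HH oD gsm gpd oU psm pD geo t1 Uy uJ.
  rewrite HT// HE// GE; apply: mderiv_near.
  have tn0 : \forall s \near t, s != 0.
    by apply: filterS (lt_nbhsr t0) => s /lt0r_neq0.
  near=> s; apply: HE; first by near: s.
  by near: s; exact: near_ray.
move=> w; pose p := phi (t *: v); pose V := d1 phi v (t *: v).
pose Jw := t *: d1 phi w (t *: v).
have Dp : D p by exact: pD.
have JwE : Jw = w *m JJ phi v t by rewrite /Jw (d1E oU psm)// /JJ scalemxAr.
have QE : bform (QQ g phi v t) w w = bform (g p) (riemann_uvv g p Jw V) Jw.
  have -> : riemann_uvv g p Jw V = w *m \matrix_a riemann_uvv g p (t *: d1 phi (basis_vec a) (t *: v)) V.
    rewrite mulmx_sum_row; under [RHS]eq_bigr do rewrite rowK -riemann_uvvZl.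
    rewrite -riemann_uvv_suml; congr riemann_uvv.
    rewrite JwE mulmx_sum_row; apply: eq_bigr => a _.
    by rewrite (row_JJ oU psm).
  by rewrite JwE /bform /QQ trmx_mul !mulmxA.
have VV : bform (g p) V V = bform (G 0) v v.
  by rewrite -(@gauss1_ray v t)// GE (pullbackE g oU psm).
have WW : bform (g p) Jw Jw = bform (P t) w w.
  by rewrite /Jw bformZl bformZr mulrA -expr2 bform_mxZ GE (pullbackE g oU psm).
have WV : bform (g p) Jw V = t^-1 * bform (P t) w v.
  by rewrite /Jw bformZl bform_mxZ GE (pullbackE g oU psm)// mulrA expr2 mulKf.
have := @sectional_bound _ _ g D oD gsm gpd p c Jw V Dp (ltW c0) sec.
by rewrite QE VV WW WV [bform (P t) w w * _]mulrC.
Unshelve. all: by end_near. Qed.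

(** By the Gauss lemma v P(t) = t^2 v G(0), whose derivative 2 t v G(0) equals 2 v Hm(t). The radial
    vector is thus an eigenvector of Hm relative to P, with the flat eigenvalue 1 / t. *)
Lemma vHm t : 0 < t -> v *m Hm t = t^-1 *: (v *m P t).
Proof.
move=> t0; have [dP _ _] := Hm_riccati t0; have t1 := lt0r_neq0 t0.
have H1 := mderivM (mderiv_cst t 1 v) dP.
have H2 : mderiv t 1 (fun s => v *m P s) ((2 * t) *: (v *m G 0)).
  apply: (@mderiv_near _ _ _ _ _ _ (fun s => s ^+ 2 *: (v *m G 0))).
    by apply: filterS (lt_nbhsr t0) => s s0; rewrite -scalemxAr gauss2_mx// lt0r_neq0.
  have d2 : is_derive t 1 (fun s : R => s ^+ 2) (2 * t).
    by split; [exact: exprn_derivable|rewrite exp_derive expr1 [_ *: _]mulr1].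
  by have := mderivZ d2 (mderiv_cst t 1 (v *m G 0)); rewrite scaler0 addr0.
have := mderiv_uniq H1 H2; rewrite mul0mx add0r -scalemxAr -scalerA => /(scalerI (_ : 2 != 0))-> //.
by rewrite -scalemxAr gauss2_mx// scalerA expr2 mulKf.
Unshelve. all: by end_near. Qed.

End ray.

(** The length t sqrt(G(t v)(w, w)) of the Jacobi field is convex: the second derivative of half its
    square is (H P^-1 H - Q)(w, w) with Q <= 0, and Cauchy-Schwarz for P between w and w H P^-1
    gives H(w, w)^2 <= P(w, w) (H P^-1 H)(w, w). *)
Lemma metric_expands v w : bform (G 0) w w <= bform (G v) w w.
Proof.
have [->|w0] := eqVneq w 0; first by rewrite !bform0l.
have := @sqrt_convex_growth _ (fun t => bform (G (t *: v)) w w) (fun t => bform (Hm v t) w w)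
  (fun t => 'D_1 (fun t => bform (Hm v t) w w) t) (@bformG_continuous v w w) _ _ _ _ 1 ltr01.
rewrite scale0r scale1r; apply.
- by move=> t _; exact: (G_posdef _).2.
- move=> t t0; have [dP _ _] := Hm_riccati v t0.
  have := mderivM (mderivM (mderiv_cst t 1 w) dP) (mderiv_cst t 1 w^T) => /(_ 0 0).
  rewrite mulmx0 addr0 mul0mx add0r -/(bform (2 *: Hm v t) w w) bform_mxZ.
  by apply: near_eq_is_derive; near=> s; rewrite -/(bform _ w w) bform_mxZ.
- move=> t t0; have [_ _ [Q dH _]] := Hm_riccati v t0.
  have := mderivM (mderivM (mderiv_cst t 1 w) dH) (mderiv_cst t 1 w^T) => /(_ 0 0)[d _].
  exact: derivableP.
- move=> t t0; have [_ HT [Q dH QB]] := Hm_riccati v t0.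
  have := mderivM (mderivM (mderiv_cst t 1 w) dH) (mderiv_cst t 1 w^T) => /(_ 0 0)[_].
  rewrite mulmx0 addr0 mul0mx add0r -/(bform _ w w) => ->.
  have /andP[_ Q0] := QB w; have pP := P_posdef v (lt0r_neq0 t0).
  rewrite -[t ^+ 2 * bform _ _ _]bform_mxZ bform_mxB mulrBr ler_wpDr//; first by rewrite oppr_ge0 mulr_ge0_le0// posdef_ge0.
  set P := t ^+ 2 *: _ in pP *; set H := Hm v t in HT *.
  have := posdef_CS w (w *m H *m invmx P) pP.
  have uP := posdef_unit pP.
  have iPT : (invmx P)^T = invmx P by rewrite trmx_inv pP.1.
  have -> : bform P w (w *m H *m invmx P) = bform H w w.
    by rewrite /bform !trmx_mul iPT HT !mulmxA mulmxK.
  have -> : bform P (w *m H *m invmx P) (w *m H *m invmx P) = bform (H *m invmx P *m H) w w.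
    by rewrite /bform !trmx_mul iPT HT !mulmxA mulmxKV.
  exact.
Unshelve. all: by end_near. Qed.

Lemma G_det_gt0 y : 0 < \det (G y).
Proof.
have [C uC ->] := posdef_chol (G_posdef y).
rewrite det_mulmx det_tr -expr2 exprn_even_gt0//.
by move: uC; rewrite unitmxE unitfE.
Qed.

Lemma ln_det_ray v t : 0 < t ->
  is_derive t 1 (fun s => ln (\det (G (s *: v)))) (2 * (\tr (invmx (t ^+ 2 *: G (t *: v)) *m Hm v t) - n%:R / t)).
Proof.
move=> t0; have [dP _ _] := Hm_riccati v t0; have t1 := lt0r_neq0 t0.
have pP := P_posdef v t1; have uP := posdef_unit pP.
set P := t ^+ 2 *: G (t *: v) in pP uP *; set H := Hm v t in dP *.
have dPE s : \det (s ^+ 2 *: G (s *: v)) = s ^+ 2 ^+ n * \det (G (s *: v)) by rewrite detZ.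
have dP0 s : 0 < s -> 0 < \det (s ^+ 2 *: G (s *: v)).
  by move=> s0; rewrite dPE mulr_gt0 ?G_det_gt0// !exprn_gt0.
have D1 := is_derive1_comp (is_derive1_ln (dP0 t t0)) (mderiv_det dP).
have D2 := is_derive_cmul (2 * n%:R) (is_derive1_ln t0).
have D3 := is_deriveB D1 D2.
have e : (\det P)^-1 * \tr (\adj P *m (2 *: H)) - 2 * n%:R * t^-1 = 2 * (\tr (invmx P *m H) - n%:R / t).
  rewrite /invmx uP -scalemxAl -scalemxAr !mxtraceZ.
  by move: (\tr _) (\det P)^-1 => a b; field.
rewrite -e; apply: near_eq_is_derive (is_derive_eq D3 _); last by [].
apply: filterS (lt_nbhsr t0) => s s0 /=.
change (ln (\det (s ^+ 2 *: G (s *: v))) - 2 * n%:R * ln s = ln (\det (G (s *: v)))).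
rewrite dPE lnM ?posrE ?G_det_gt0 ?exprn_gt0// -exprM lnXn// -[_ *+ (2 * n)]mulr_natl natrM.
by rewrite addrAC subrr add0r.
Qed.

(* Half the derivative of ln det G along the ray: t ^+ 2 in t ^+ 2 *: G contributes n / t. *)
Definition zr v t := \tr (invmx (t ^+ 2 *: G (t *: v)) *m Hm v t) - n%:R / t.

(* Traces of the Riccati equation for Hm; since v is an eigenvector (vHm), Cauchy-Schwarz for the
   trace only involves its complement, of dimension n - 1. *)
Lemma zr_riccati v t : v != 0 -> 0 < t -> (1 < n)%N -> exists2 z',
  is_derive t 1 (zr v) z' &
  z' <= - (zr v t ^+ 2 / n.-1%:R) - 2 * zr v t / t + n.-1%:R * c * bform (G 0) v v.
Proof.
move=> v0 t0 n1; have [dP HT [Q dH QB]] := Hm_riccati v t0; have t1 := lt0r_neq0 t0.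
have pP := P_posdef v t1; have uP := posdef_unit pP.
have uPn : \forall s \near t, s ^+ 2 *: G (s *: v) \in unitmx.
  apply: filterS (lt_nbhsr t0) => s s0; apply: posdef_unit; apply: P_posdef; exact: lt0r_neq0.
have dI := mderiv_inv uPn dP.
set P := t ^+ 2 *: G (t *: v) in pP uP dI QB dH *; set H := Hm v t in dP dI HT dH *.
have D1 := mderiv_tr (mderivM dI dH).
have D2 : is_derive t 1 (fun s : R => n%:R / s) (- (n%:R / t ^+ 2)).
  have [d1 d2] : is_derive t 1 (fun s : R => s^-1) (- t ^- 2).
    by split; [exact: derivableV|rewrite deriveV// derive_id [_ *: _]mulr1].
  by have := is_derive_cmul n%:R (DeriveDef d1 d2); rewrite mulrN.
have D3 := is_deriveB D1 D2.
pose U := invmx P *m H.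
have N0 : 0 < n.-1%:R :> R by rewrite ltr0n; case: (n) n1 => [|[]].
have nE : n%:R = n.-1%:R + 1 :> R by rewrite natr1 prednK// ltnW.
have vH : v *m H = t^-1 *: (v *m P) by exact: vHm.
(* P / t is the value of H in flat space; the difference annihilates v and has trace [zr v t]
   relative to P. *)
pose S := H - t^-1 *: P.
have ST : S^T = S by rewrite /S linearB linearZ /= HT pP.1.
have vS : v *m S = 0 by rewrite /S mulmxBr -scalemxAr vH subrr.
have US : invmx P *m S = U - t^-1 *: 1%:M by rewrite /S mulmxBr -scalemxAr mulVmx.
have trS : \tr (invmx P *m S) = zr v t.
  by rewrite US raddfB /= mxtraceZ mxtrace1 /zr mulrC.
have := posdef_tr_CS pP ST v0 vS.
rewrite trS US (@mxtrace_sqr_sub _ _ U 1%:M t^-1) ?mulmx1// mxtrace1.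
have -> : \tr U = zr v t + n%:R / t by rewrite /zr subrK.
move=> CS.
(* Q + c (|v|^2 P - B / t^2) is nonnegative by the lower curvature bound. Relative to P, the traces
   of P and of B / t^2 are n and |v|^2, whence the factor n - 1. *)
have trQ : - (n.-1%:R * c * bform (G 0) v v) <= \tr (invmx P *m Q).
  set r2 := bform (G 0) v v in QB *.
  have vPv : bform P v v = t ^+ 2 * r2.
    by rewrite /P bform_mxZ gauss1_ray.
  pose B := (v *m P)^T *m (v *m P).
  have BE w : bform B w w = bform P w v ^+ 2.
    rewrite (bformC w v pP.1) /bform /B mulmxA -mulmxA mxE big_ord1 expr2; congr (_ * _).
    rewrite (_ : w *m (v *m P)^T = (v *m P *m w^T)^T) ?[_^T _ _]mxE//.
    by rewrite [RHS]trmx_mul trmxK.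
  have pos w : 0 <= bform (Q + c *: (r2 *: P - t^-1 ^+ 2 *: B)) w w.
    have /andP[+ _] := QB w.
    rewrite bform_mxD (bform_mxZ c) bform_mxB (bform_mxZ r2) (bform_mxZ (t^-1 ^+ 2)) BE exprMn mulNr => h.
    by rewrite -lerBlDr sub0r.
  have := posdef_tr_ge0 pP pos.
  rewrite tr_invmx_lin//.
  have -> : \tr (invmx P *m B) = t ^+ 2 * r2.
    have e : invmx P *m (v *m P)^T = v^T by rewrite trmx_mul pP.1 mulKmx.
    by rewrite /B (mulmxA (invmx P)) e mxtrace_mulC -vPv /bform /mxtrace big_ord1.
  rewrite nE -subr_ge0 => h; rewrite -subr_ge0; move: h.
  by rewrite (_ : _ - _ = \tr (invmx P *m Q) - - (n.-1%:R * c * r2))//; field.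
eexists; first exact: D3.
rewrite opprK -/P -/H.
have -> : \tr (- (invmx P *m (2 *: H) *m invmx P) *m H + invmx P *m (H *m invmx P *m H - Q)) =
   - \tr (U *m U) - \tr (invmx P *m Q).
  rewrite mulNmx -!scalemxAr -!scalemxAl mulmxBr !mulmxA.
  rewrite raddfD /= raddfN /= raddfB /= mxtraceZ /U ?mulmxA.
  by move: (\tr _) (\tr _) => a b; ring.
move: CS trQ; rewrite -[n.-1%:R * _]mulrC -ler_pdivrMr// nE.
move: (zr v t ^+ 2 / n.-1%:R) (zr v t) (\tr (U *m U)) (\tr (invmx P *m Q)) n.-1%:R (bform (G 0) v v) => A z a b N r CS trQ.
have e : (N + 1) / t ^+ 2 = t^-1 ^+ 2 * (N + 1) by rewrite exprVn mulrC.
have e2 : 2 * t^-1 * (z + (N + 1) / t) = 2 * z / t + 2 * (t^-1 ^+ 2 * (N + 1)) by field.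
rewrite e2 in CS; rewrite e.
move: (t^-1 ^+ 2 * (N + 1)) (2 * z / t) CS => x y CS; lra.
Qed.

(** With N = n - 1 and z = [zr v], the function e = (det G(t v) / det G(0))^(1/(2N)) satisfies (t
    e)'' <= k^2 t e, where k^2 = c |v|^2 for the metric at the pole. The sinh comparison at t = 1 is
    then raised to the power N. *)
Lemma det_comparison v : v != 0 ->
  Num.sqrt (\det (G v)) <= Num.sqrt (\det (G 0)) *
    (sinh (Num.sqrt c * Num.sqrt (bform (G 0) v v)) / (Num.sqrt c * Num.sqrt (bform (G 0) v v))) ^+ n.-1.
Proof.
move=> v0; have r0 : 0 < bform (G 0) v v by exact: (G_posdef 0).2.
(* For n = 1 the exponent n - 1 is 0 and cannot be divided by; there v G(v) = v G(0) already
   determines the single entry of G(v). *)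
have [n1|n1] := leqP n 1.
  have n0 : (0 < n)%N.
    rewrite lt0n; apply: contra v0 => /eqP n0; apply/eqP/rowP => i.
    by have := ltn_ord i; rewrite {2}n0.
  have e1 : n = 1%N by apply/eqP; rewrite eqn_leq n1.
  have e0 : n.-1 = 0%N by move: n1; case: (n) => [|[]].
  suff -> : G v = G 0 by rewrite e0 expr0 mulr1.
  have := @gauss2_mx v 1 (oner_neq0 _); rewrite scale1r => e.
  have uv : exists i, v 0 i != 0.
    apply/existsP; apply: contraNT v0; rewrite negb_exists => /forallP H.
    by apply/eqP/rowP => i; have := H i; rewrite negbK mxE => /eqP.
  have [i vi] := uv; apply/matrixP => a b.
  have same (j : 'I_n) : j = i.
    apply: val_inj => /=; have := ltn_ord j; have := ltn_ord i; rewrite {2 4}e1 !ltnS !leqn0.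
    by move=> /eqP -> /eqP ->.
  have := congr1 (fun M : 'rV[R]_n => M 0 b) e; rewrite !mxE.
  have sumE (F : 'I_n -> R) : \sum_j F j = F i.
    by rewrite (bigD1 i)//= big1 ?addr0// => j; rewrite (same j) eqxx.
  by rewrite !sumE (same a) => /(mulfI vi).
have N0 : 0 < n.-1%:R :> R by rewrite ltr0n; case: (n) n1 => [|[]].
set N := n.-1%:R in N0; set r2 := bform (G 0) v v in r0 *.
pose k := Num.sqrt c * Num.sqrt r2.
have k0 : 0 < k by rewrite mulr_gt0// sqrtr_gt0.
have k2 : k ^+ 2 = c * r2 by rewrite exprMn !sqr_sqrtr// ltW.
pose l t := ln (\det (G (t *: v))).
(* The exponent 1 / (2 N) makes e' / e = z / N, so that the quadratic term z^2 / N of the Riccati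
   inequality cancels in (t e)''. *)
pose e t := expR ((l t - l 0) / (2 * N)).
pose y t := e t * (1 + t * zr v t / N).
have dl t : 0 < t -> is_derive t 1 l (2 * zr v t) by move=> t0; exact: ln_det_ray.
have de t : 0 < t -> is_derive t 1 e (e t * (zr v t / N)).
  move=> t0; have h := is_deriveB (dl t t0) (is_derive_cst (l 0) t 1).
  have h2 := is_derive_mulc (2 * N)^-1 h.
  apply: (is_derive_eq (is_derive1_comp (is_derive_expR _) h2)).
  rewrite [X in X * _ = _](_ : _ = e t)// subr0; congr (_ * _); field.
  by rewrite gt_eqF.
have ce : {for 0, continuous e}.
  apply: (@continuous_comp _ _ _ (fun t => (l t - l 0) / (2 * N)) expR); last exact: continuous_expR.
  apply: continuousM; last exact: cst_continuous.
  apply: continuousB; last exact: cst_continuous.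
  apply: (@continuous_comp _ _ _ (fun t => \det (G (t *: v))) (@ln R)); last first.
    by apply: continuous_ln; rewrite G_det_gt0.
  apply: continuous_bigsum => s; apply: continuousM; first exact: cst_continuous.
  apply: continuous_bigprod => i.
  move: (perm.fun_of_perm.body s i) => j.
  apply: (@continuous_comp _ _ _ (fun t : R => t *: v) (fun y => G y i j)).
    exact: scalel_continuous.
  by rewrite scale0r; exact: Gc.
have ee : e 1 <= sinh (k * 1) / (k * 1).
  have dy t : 0 < t -> exists2 y', is_derive t 1 y y' & y' <= k ^+ 2 * (t * e t).
    move=> t0; have [z' dz hz] := zr_riccati v0 t0 n1.
    have h1 := is_derive_mulc N^-1 (is_derive_mul (is_derive_id t 1) dz).
    have h := is_derive_mul (de t t0) (is_deriveD (is_derive_cst (1 : R) t 1) h1).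
    eexists; first exact: h.
    rewrite [(cst 1 + _) t](_ : _ = 1 + t * zr v t / N)// add0r mul1r k2.
    have e0 : 0 < e t by exact: expR_gt0.
    move: hz; rewrite -/N -/r2; move: (zr v t) => z hz.
    rewrite (_ : _ + _ = e t * ((2 * z + t * z ^+ 2 / N + t * z') / N)); last by field; rewrite gt_eqF.
    rewrite (_ : c * r2 * _ = e t * (c * r2 * t)); last by ring.
    rewrite ler_pM2l// ler_pdivrMr//.
    have := ler_wpM2l (ltW t0) hz.
    rewrite (_ : t * (_ + _) = - (t * z ^+ 2 / N) - 2 * z + c * r2 * t * N); last by field; rewrite !gt_eqF.
    by move: (t * z ^+ 2 / N) (c * r2 * t * N) (t * z') => *; lra.
  pose y' t := 'D_1 y t.
  apply: (@sinh_comparison _ e y y' k k0 ce) => [|t t0|t t0|t t0|t t0|].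
  - by rewrite /e subrr mul0r expR0.
  - exact: expR_gt0.
  - apply: (is_derive_eq (is_derive_mul (is_derive_id t 1) (de t t0))).
    by rewrite /y; ring.
  - by have [? [d _] _] := dy t t0; exact: derivableP.
  - by have [? [_ <-] ?] := dy t t0.
  - exact: ltr01.
rewrite mulr1 in ee.
rewrite -/k.
have d0 := G_det_gt0 0; have dv := G_det_gt0 v.
have sE q : Num.sqrt (\det (G q)) = expR (ln (\det (G q)) / 2).
  have dq := G_det_gt0 q.
  rewrite -{1}(lnK (_ : \det (G q) \in Num.pos)) ?posrE//.
  rewrite -[X in expR X](divfK (_ : 2 != 0)) ?pnatr_eq0// mulrC expRM_natl.
  by rewrite sqrtr_sqr gtr0_norm ?expR_gt0// mulrC.
rewrite !sE; have -> : expR (ln (\det (G v)) / 2) = expR (ln (\det (G 0)) / 2) * e 1 ^+ n.-1.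
  rewrite /e -expRM_natl -expRD /l scale1r scale0r; congr expR; rewrite -/N; field.
  by rewrite gt_eqF.
by rewrite ler_pM2l ?expR_gt0//; apply: lerXn2r; rewrite ?nnegrE ?expR_ge0// (le_trans _ ee)// expR_ge0.
Qed.

End normal_coordinates.

(** * Uniqueness of geodesics *)

Section locally_lipschitz.
Context {R : realType} {n : nat}.
Implicit Types (p x y : 'rV[R]_n) (f h : 'rV[R]_n -> R).

(** The local bound is carried along with the Lipschitz estimate to make the notion stable under
    products. *)
Definition loclip p f := exists C e : R, [/\ 0 <= C, 0 < e &
  forall x y, `|x - p| < e -> `|y - p| < e -> `|f x| <= C /\ `|f x - f y| <= C * `|x - y|].

Lemma loclip_cst p (a : R) : loclip p (fun=> a).
Proof.
exists `|a|, 1; split=> // x y _ _; split=> //.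
by rewrite subrr normr0 mulr_ge0.
Qed.

Lemma loclipD p f h : loclip p f -> loclip p h -> loclip p (fun x => f x + h x).
Proof.
move=> [C [e [C0 e0 Hf]]] [C' [e' [C'0 e'0 Hh]]].
exists (C + C'), (Num.min e e'); split; rewrite ?addr_ge0 ?lt_min ?e0//.
move=> x y; rewrite !lt_min => /andP[xe xe'] /andP[ye ye'].
have [f1 f2] := Hf x y xe ye; have [h1 h2] := Hh x y xe' ye'.
split; first by rewrite (le_trans (ler_normD _ _))// lerD.
by rewrite opprD addrACA mulrDl (le_trans (ler_normD _ _))// lerD.
Qed.

Lemma loclipM p f h : loclip p f -> loclip p h -> loclip p (fun x => f x * h x).
Proof.
move=> [C [e [C0 e0 Hf]]] [C' [e' [C'0 e'0 Hh]]].
exists (C * C' + C * C'), (Num.min e e'); split; rewrite ?addr_ge0 ?mulr_ge0 ?lt_min ?e0//.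
move=> x y; rewrite !lt_min => /andP[xe xe'] /andP[ye ye'].
have [f1 f2] := Hf x y xe ye; have [h1 h2] := Hh x y xe' ye'.
have [h3 _] := Hh y y ye' ye'.
split; first by rewrite normrM ler_wpDr ?mulr_ge0// ler_pM.
rewrite (_ : _ - _ = (f x - f y) * h y + f x * (h x - h y)); last by ring.
apply: le_trans (ler_normD _ _) _; rewrite !normrM [leRHS]mulrDl; apply: lerD.
  by rewrite mulrAC ler_pM.
by rewrite -mulrA ler_pM.
Qed.

Lemma loclip_sum p (I : Type) (r : seq I) (F : I -> 'rV[R]_n -> R) :
  (forall i, loclip p (F i)) -> loclip p (fun x => \sum_(i <- r) F i x).
Proof.
move=> H; elim: r => [|i r IH]; first by under eq_fun do rewrite big_nil; exact: loclip_cst.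
by under eq_fun do rewrite big_cons; exact: loclipD.
Qed.

Lemma loclip_prod p (I : Type) (r : seq I) (F : I -> 'rV[R]_n -> R) :
  (forall i, loclip p (F i)) -> loclip p (fun x => \prod_(i <- r) F i x).
Proof.
move=> H; elim: r => [|i r IH]; first by under eq_fun do rewrite big_nil; exact: loclip_cst.
by under eq_fun do rewrite big_cons; exact: loclipM.
Qed.

Lemma loclip_det p m (M : 'rV[R]_n -> 'M[R]_m) : (forall i j, loclip p (fun x => M x i j)) ->
  loclip p (fun x => \det (M x)).
Proof.
move=> H; apply: loclip_sum => s; apply: loclipM; first exact: loclip_cst.
by apply: loclip_prod => i; exact: H.
Qed.

Lemma loclipV p f : f p != 0 -> loclip p f -> loclip p (fun x => (f x)^-1).
Proof.
move=> fp [C [e [C0 e0 Hf]]].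
have a0 : 0 < `|f p| by rewrite normr_gt0.
set a := `|f p| in a0.
(* Within this radius f varies by at most a / 2, so |f| stays above a / 2; C + 1 avoids division by
   zero. *)
pose e' := Num.min e (a / 2 / (C + 1)).
have C1 : 0 < C + 1 by rewrite ltr_wpDl.
have e'0 : 0 < e' by rewrite lt_min e0 !divr_gt0.
have low x : `|x - p| < e' -> a / 2 <= `|f x|.
  rewrite lt_min => /andP[xe xa].
  have pp : `|p - p| < e by rewrite subrr normr0.
  have [_ h] := Hf x p xe pp.
  have : `|f x - f p| <= a / 2.
    apply: le_trans h _; apply: (@le_trans _ _ ((C + 1) * (a / 2 / (C + 1)))).
      by apply: ler_pM => //; [lra|exact: ltW].
    by rewrite mulrC divfK// gt_eqF.
  have := ler_normB (f x) (f x - f p); rewrite opprB addrC subrK -/a => h1 h2; lra.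
exists (2 / a + C * (2 / a) * (2 / a)), e'; have a20 : 0 < 2 / a by rewrite divr_gt0.
have a2' := ltW a20; split=> //; first by apply: addr_ge0 => //; do 2!apply: mulr_ge0 => //.
move=> x y xe ye; have lx := low x xe; have ly := low y ye.
have a2 : 0 < a / 2 by rewrite divr_gt0.
have inv z : a / 2 <= `|f z| -> `|(f z)^-1| <= 2 / a.
  move=> lz; rewrite normfV -[2 / a]invf_div lef_pV2 ?posrE//.
  exact: lt_le_trans lz.
split; first by rewrite ler_wpDr ?inv//; do 2!apply: mulr_ge0 => //.
have nz z : a / 2 <= `|f z| -> f z != 0.
  by move=> lz; rewrite -normr_gt0; exact: lt_le_trans lz.
rewrite (_ : _ - _ = - (f x - f y) * (f x)^-1 * (f y)^-1); last first.
  by field; rewrite !nz.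
have [xe1 _] : `|x - p| < e /\ True by move: xe; rewrite lt_min => /andP[].
have [ye1 _] : `|y - p| < e /\ True by move: ye; rewrite lt_min => /andP[].
have [_ h] := Hf x y xe1 ye1.
rewrite !normrM normrN; apply: (@le_trans _ _ (C * `|x - y| * (2 / a) * (2 / a))).
  by apply: ler_pM; rewrite ?mulr_ge0// ?inv//; apply: ler_pM; rewrite ?inv.
have -> : C * `|x - y| * (2 / a) * (2 / a) = C * (2 / a) * (2 / a) * `|x - y| by move: (2 / a) => ?; ring.
by rewrite ler_wpM2r// lerDr.
Qed.

Lemma loclip_near p f h : {near p, f =1 h} -> loclip p f -> loclip p h.
Proof.
move=> /nbhs_normP[d /= d0 fh] [C [e [C0 e0 Hf]]]; exists C, (Num.min e d); split=> //.
  by rewrite lt_min e0.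
move=> x y; rewrite !lt_min => /andP[xe xd] /andP[ye yd].
have fx : f x = h x by apply: fh; rewrite /= distrC.
have fy : f y = h y by apply: fh; rewrite /= distrC.
by rewrite -fx -fy; exact: Hf.
Qed.

(** Near p each partial derivative exceeds its size at p by at most 1; the mean value theorem on
    segments inside a ball turns the sum of these bounds into a Lipschitz constant. *)
Lemma smooth_loclip (U : set 'rV[R]_n) p f : open U -> smooth_on U f -> U p -> loclip p f.
Proof.
move=> oU sf Up.
pose C := \sum_i (`|partial i f p| + 1).
have C0 : 0 <= C by apply: sumr_ge0 => i _; rewrite addr_ge0.
have near1 : \forall q \near p, [/\ U q, `|f q| <= `|f p| + 1 & forall i, `|partial i f q| <= `|partial i f p| + 1].
  have bnd h : smooth_on U h -> \forall q \near p, `|h q| <= `|h p| + 1.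
    move=> sh; have /cvgrPdist_le/(_ 1 ltr01) := smooth_continuous sh Up.
    apply: filterS => q hq; rewrite -[h q](subrK (h p)) addrC (le_trans (ler_normD _ _))// lerD2l.
    by rewrite distrC.
  near=> q; split; [near: q|near: q|near: q].
  - exact: near_open.
  - exact: bnd.
  - by apply: filter_forall => i; apply: bnd; exact: smooth_partial.
have /nbhs_normP[d /= d0 Hd] := near1.
exists (Num.max C (`|f p| + 1)), d; split; rewrite ?le_max ?C0// => x y xd yd.
have Hx : ball_ Num.Def.normr p d x by rewrite /= distrC.
split; first by rewrite le_max; have [_ -> _] := Hd _ Hx; rewrite orbT.
have seg (t : R) : 0 <= t <= 1 -> ball_ Num.Def.normr p d (y + t *: (x - y)).
  move=> /andP[t0 t1] /=; rewrite distrC.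
  rewrite (_ : y + t *: (x - y) - p = (1 - t) *: (y - p) + t *: (x - p)); last first.
    apply/rowP => k; rewrite !mxE; ring.
  apply: le_lt_trans (ler_normD _ _) _; rewrite !normrZ !ger0_norm// ?subr_ge0//.
  have : (1 - t) * `|y - p| <= (1 - t) * Num.max `|y - p| `|x - p|.
    by apply: ler_wpM2l; rewrite ?subr_ge0// le_max lexx.
  have : t * `|x - p| <= t * Num.max `|y - p| `|x - p|.
    by apply: ler_wpM2l; rewrite // le_max lexx orbT.
  have : Num.max `|y - p| `|x - p| < d by rewrite gt_max yd.
  move: (Num.max _ _) => m; nra.
have [t t01|t t01] := @MVT_line _ _ f (fun q => 'D_(x - y) f q) y (x - y).
  apply: derivableP; apply: diff_derivable; apply: smooth_differentiable (oU) sf _.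
  by have [] := Hd _ (seg t t01).
rewrite [y + (x - y)]addrC subrK => ->; have [Uq _ bq] := Hd _ (seg t t01).
rewrite (smooth_deriveE _ oU sf Uq); apply: le_trans (ler_norm_sum _ _ _) _.
apply: (@le_trans _ _ (C * `|x - y|)); last by rewrite ler_wpM2r// le_max lexx.
rewrite mulr_suml; apply: ler_sum => i _; rewrite normrM mulrC.
by apply: ler_pM => //; exact: coord_le_norm.
Unshelve. all: by end_near. Qed.

End locally_lipschitz.

Section christoffel_lipschitz.
Context {R : realType} {n : nat}.
Variables (g : 'rV[R]_n -> 'M[R]_n) (D : set 'rV[R]_n).
Hypothesis oD : open D.
Hypothesis gsm : forall a b, smooth_on D (fun p => g p a b).
Hypothesis gpd : forall p, D p -> posdef (g p).

Lemma christoffel_loclip p k i j : D p -> loclip p (christoffel g k i j).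
Proof.
move=> Dp; have gl a b : loclip p (fun q => g q a b) by exact: smooth_loclip (gsm a b) Dp.
have pl c a b : loclip p (partial c (fun q => g q a b)).
  by apply: smooth_loclip Dp => //; exact: smooth_partial.
have pNl c a b : loclip p (fun q => - partial c (fun q => g q a b) q).
  by under eq_fun do rewrite -mulN1r; apply: loclipM => //; exact: loclip_cst.
apply: loclipM; first exact: loclip_cst.
apply: loclip_sum => l; apply: loclipM; last by apply: loclipD => //; exact: loclipD.
apply: (@loclip_near _ _ _ (fun x => (\det (g x))^-1 * \adj (g x) k l)).
  by apply: filterS (near_open oD Dp) => x Dx; rewrite /invmx posdef_unit ?[RHS]mxE//; exact: gpd.
apply: loclipM.
  apply: loclipV; last exact: loclip_det.
  by have := posdef_unit (gpd Dp); rewrite unitmxE unitfE.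
under eq_fun do rewrite mxE; apply: loclipM; first exact: loclip_cst.
by apply: loclip_det => a b; under eq_fun do rewrite !mxE.
Qed.

Lemma nincr_segment (f f' : R -> R) (a b : R) : (forall t, a <= t -> t < b -> is_derive t 1 f (f' t)) ->
  (forall t, a <= t -> t < b -> f' t <= 0) -> forall t, a <= t -> t < b -> f t <= f a.
Proof.
move=> H H0 t at_ tb; have [s||s /[!in_itv]/= /andP[as_ st] e] := @MVT_segment _ f f' a t at_.
- by rewrite in_itv/= => /andP[/ltW as_ st]; apply: H => //; exact: lt_trans tb.
- apply: derivable_within_continuous => s; rewrite in_itv/= => /andP[as_ st].
  by have [] := H s as_ (le_lt_trans st tb).
- rewrite -subr_le0 e mulr_le0_ge0 ?subr_ge0//.
  by apply: H0 => //; exact: le_lt_trans tb.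
Qed.

(** The function f(t) e^(-K t) has a nonpositive derivative and starts at 0. *)
Lemma gronwall (f f' : R -> R) (a b K : R) : (forall t, a <= t -> t < b -> is_derive t 1 f (f' t)) ->
  (forall t, a <= t -> t < b -> f' t <= K * f t) -> f a = 0 -> forall t, a <= t -> t < b -> f t <= 0.
Proof.
move=> H H0 fa t at_ tb.
have de (s : R) : is_derive s 1 (fun s : R => expR (- K * s)) (expR (- K * s) * - K).
  have := is_derive1_comp (is_derive_expR (- K * s)) (is_derive_cmul (- K) (is_derive_id s 1)).
  by rewrite mulr1.
have := @nincr_segment (fun s => f s * expR (- K * s)) (fun s => (f' s - K * f s) * expR (- K * s)) a b.
move=> /(_ _ _ t at_ tb); rewrite fa mul0r pmulr_lle0 ?expR_gt0//; apply.
- move=> s as_ sb; apply: (is_derive_eq (is_derive_mul (H s as_ sb) (de s))); ring.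
- by move=> s as_ sb; rewrite pmulr_lle0 ?expR_gt0// subr_le0 H0.
Qed.

End christoffel_lipschitz.

Section ode_uniqueness.
Context {R : realType} {m : nat}.

(** F is Lipschitz near the initial value only, so the solutions are compared while both stay in
    that neighbourhood; this is why e is small and the conclusion is forward in time. *)
Lemma ode_unique (F : 'I_m -> 'rV[R]_m -> R) (x y : R -> 'rV[R]_m) (a b : R) : a < b ->
  (forall k, loclip (x a) (F k)) ->
  (forall t, a <= t -> t < b -> mderiv t 1 x (\row_k F k (x t))) ->
  (forall t, a <= t -> t < b -> mderiv t 1 y (\row_k F k (y t))) ->
  x a = y a ->
  exists2 e : R, 0 < e & forall t, a <= t -> t < a + e -> x t = y t.
Proof.
move=> ab LF Hx Hy xy.
have [C [d [C0 d0 HF]]] : exists C d : R, [/\ 0 <= C, 0 < d & forall k q r,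
    `|q - x a| < d -> `|r - x a| < d -> `|F k q - F k r| <= C * `|q - r|].
  have /choice[Cd HCd] : forall k, exists Cd : R * R, [/\ 0 <= Cd.1, 0 < Cd.2 & forall q r,
      `|q - x a| < Cd.2 -> `|r - x a| < Cd.2 -> `|F k q - F k r| <= Cd.1 * `|q - r|].
    move=> k; have [C [d [C0 d0 H]]] := LF k; exists (C, d); split=> //= q r qd rd.
    by have [] := H q r qd rd.
  exists (\sum_k (Cd k).1), (\big[Num.min/1]_k (Cd k).2); split.
  - by apply: sumr_ge0 => k _; have [] := HCd k.
  - by elim/big_ind: _ => [|? ? ? ?|k _] //; [rewrite lt_min; apply/andP|have [] := HCd k].
  - move=> k q r qd rd; have [Ck0 dk0 Hk] := HCd k.
    apply: (le_trans (Hk q r _ _)).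
    + by apply: lt_le_trans qd _; exact: bigmin_le_cond.
    + by apply: lt_le_trans rd _; exact: bigmin_le_cond.
    + rewrite ler_wpM2r// (bigD1 k)//= lerDl sumr_ge0// => j _.
      by have [] := HCd j.
have near_a (z : R -> 'rV[R]_m) : (forall t, a <= t -> t < b -> mderiv t 1 z (\row_k F k (z t))) ->
    z a = x a -> \forall t \near a, `|z t - x a| < d.
  move=> Hz za; have H k : \forall t \near a, `|z t 0 k - x a 0 k| < d / 2.
    have := is_derive_continuous (Hz a (lexx a) ab 0 k) => /cvgrPdist_lt/(_ (d / 2)).
    rewrite divr_gt0// => /(_ isT); apply: filterS => t; rewrite za distrC; exact.
  apply: filterS (@filter_forall _ _ (fun k t => `|z t 0 k - x a 0 k| < d / 2) (nbhs a) _ H) => t Ht.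
  apply: (@le_lt_trans _ _ (d / 2)); last by lra.
  by apply: row_norm_le => [|k]; rewrite ?divr_ge0 ?ltW// !mxE Ht.
have [e e0 He] : exists2 e : R, 0 < e & forall t, a <= t -> t < a + e ->
    [/\ t < b, `|x t - x a| < d & `|y t - x a| < d].
  have bn : \forall t \near a, t < b by exact: lt_nbhsl.
  have := near_a x Hx erefl; have := near_a y Hy (esym xy); move: bn.
  move=> /nbhs_normP[e1 /= p1 H1] /nbhs_normP[e2 /= p2 H2] /nbhs_normP[e3 /= p3 H3].
  exists (Num.min e1 (Num.min e2 e3)); first by rewrite !lt_min p1 p2.
  move=> t at_; rewrite -ltrBlDl => te.
  have : `|a - t| < Num.min e1 (Num.min e2 e3) by rewrite distrC ger0_norm// subr_ge0.
  by rewrite !lt_min => /and3P[t1 t2 t3]; split; [exact: H1|exact: H3|exact: H2].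
exists e => // t at_ te.
(* The squared Euclidean distance is differentiable, unlike the sup norm, and dominates its square;
   it satisfies u' <= 2 m C u. *)
pose u t := \sum_k (x t 0 k - y t 0 k) ^+ 2.
have le_u s : `|x s - y s| ^+ 2 <= u s.
  have us0 : 0 <= u s by apply: sumr_ge0 => k _; exact: sqr_ge0.
  rewrite -[u s]sqr_sqrtr// ler_pXn2r ?nnegrE ?sqrtr_ge0//.
  apply: row_norm_le => [|k]; first exact: sqrtr_ge0.
  rewrite !mxE -sqrtr_sqr ler_wsqrtr// /u (bigD1 k)//= lerDl.
  by apply: sumr_ge0 => j _; exact: sqr_ge0.
suff : u t <= 0.
  move=> /(le_trans (le_u t)) h; apply/eqP; rewrite -subr_eq0 -normr_eq0.
  by have := sqr_ge0 `|x t - y t| => h2; rewrite -sqrf_eq0 eq_le h.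
apply: (@gronwall _ u (fun t => \sum_k 2 * (x t 0 k - y t 0 k) * (F k (x t) - F k (y t))) a (a + e) (2 * m%:R * C)) => //.
- move=> s as_ se; have [sb _ _] := He s as_ se.
  apply: is_derive_bigsum => k.
  have h : is_derive s 1 (fun t => x t 0 k - y t 0 k) (F k (x s) - F k (y s)).
    by apply: is_derive_eq (is_deriveB (Hx s as_ sb 0 k) (Hy s as_ sb 0 k)) _; rewrite !mxE.
  under eq_fun do rewrite expr2.
  by apply: (is_derive_eq (is_derive_mul h h)); ring.
- move=> s as_ se; have [sb xd yd] := He s as_ se.
  apply: (@le_trans _ _ (\sum_(k < m) 2 * C * u s)).
    apply: ler_sum => k _; apply: le_trans (ler_norm _) _; rewrite !normrM ger0_norm//.
    rewrite -!mulrA ler_wpM2l//; apply: (@le_trans _ _ (C * `|x s - y s| ^+ 2)); last by rewrite ler_wpM2l.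
    rewrite expr2 mulrCA; apply: ler_pM => //; last exact: HF.
    by have := coord_le_norm (x s - y s) k; rewrite !mxE.
  rewrite sumr_const card_ord -[(_ * _) *+ m]mulr_natl; move: (u s) m%:R => us mm.
  by rewrite (_ : mm * _ = 2 * mm * C * us)//; ring.
- by rewrite /u xy big1// => k _; rewrite subrr expr0n.
Qed.

End ode_uniqueness.

Section geodesic_ode.
Context {R : realType} {n : nat}.
Variables (g : 'rV[R]_n -> 'M[R]_n) (D : set 'rV[R]_n).
Hypothesis oD : open D.
Hypothesis gsm : forall a b, smooth_on D (fun p => g p a b).
Hypothesis gpd : forall p, D p -> posdef (g p).

Lemma loclip_nonexp m (L : 'rV[R]_m -> 'rV[R]_n) f p :
  (forall x y, `|L x - L y| <= `|x - y|) -> loclip (L p) f -> loclip p (fun x => f (L x)).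
Proof.
move=> HL [C [e [C0 e0 Hf]]]; exists C, e; split=> // x y xe ye.
have [] := Hf (L x) (L y) (le_lt_trans (HL _ _) xe) (le_lt_trans (HL _ _) ye).
by move=> h1 h2; split=> //; apply: le_trans h2 _; rewrite ler_wpM2l.
Qed.

Lemma loclip_coord p k : loclip p (fun x : 'rV[R]_n => x 0 k).
Proof.
exists (`|p| + 1), 1; have p1 : 0 <= `|p| + 1 by rewrite addr_ge0.
split=> //.
move=> x y xp yp; split.
  apply: le_trans (coord_le_norm x k) _; rewrite -[x](subrK p) addrC.
  by apply: le_trans (ler_normD _ _) _; rewrite lerD2l ltW.
have := coord_le_norm (x - y) k; rewrite !mxE => /le_trans; apply.
by rewrite -[leLHS]mul1r ler_wpM2r// lerDr.
Qed.

Lemma geodesic_ode_unique (x y v w : R -> 'rV[R]_n) (a b : R) : a < b ->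
  (forall t, a <= t -> t < b -> [/\ D (x t), mderiv t 1 x (v t) & mderiv t 1 v (- Gam g (x t) (v t) (v t))]) ->
  (forall t, a <= t -> t < b -> [/\ D (y t), mderiv t 1 y (w t) & mderiv t 1 w (- Gam g (y t) (w t) (w t))]) ->
  x a = y a -> v a = w a ->
  exists2 e : R, 0 < e & forall t, a <= t -> t < a + e -> x t = y t.
Proof.
move=> ab Hx Hy xy vw.
have [Dp _ _] := Hx a (lexx a) ab.
(* The geodesic equation as a first-order system on pairs (position, velocity), stored as rows of
   length n + n. *)
pose F (k : 'I_(n + n)) (z : 'rV[R]_(n + n)) : R := match fintype.split k with
  | inl i => rsubmx z 0 i
  | inr i => - (\sum_a \sum_b christoffel g i a b (lsubmx z) * rsubmx z 0 a * rsubmx z 0 b) end.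
have FE (q u : 'rV[R]_n) : \row_k F k (row_mx q u) = row_mx u (- Gam g q u u).
  apply/rowP => k; rewrite !mxE /F; case: fintype.split => i; rewrite ?row_mxKl ?row_mxKr ?row_mxKl//.
  by rewrite [RHS]mxE /Gam /tri [in RHS]mxE.
have H (x' v' : R -> 'rV[R]_n) : (forall t, a <= t -> t < b -> [/\ D (x' t), mderiv t 1 x' (v' t) & mderiv t 1 v' (- Gam g (x' t) (v' t) (v' t))]) ->
    forall t, a <= t -> t < b -> mderiv t 1 (fun t => row_mx (x' t) (v' t)) (\row_k F k (row_mx (x' t) (v' t))).
  move=> Hx' t at_ tb; have [_ h1 h2] := Hx' t at_ tb; rewrite FE => i k.
  by rewrite mxE; under eq_fun do rewrite mxE; case: fintype.split.
have lipl (z z' : 'rV[R]_(n + n)) : `|lsubmx z - lsubmx z'| <= `|z - z'|.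
  apply: row_norm_le => // k; rewrite !mxE.
  by have := coord_le_norm (z - z') (lshift n k); rewrite !mxE.
have lipr (z z' : 'rV[R]_(n + n)) : `|rsubmx z - rsubmx z'| <= `|z - z'|.
  apply: row_norm_le => // k; rewrite !mxE.
  by have := coord_le_norm (z - z') (rshift n k); rewrite !mxE.
have [k|||//|e e0 He] := @ode_unique _ _ F (fun t => row_mx (x t) (v t)) (fun t => row_mx (y t) (w t)) a b ab.
- have rl i : loclip (row_mx (x a) (v a)) (fun z => rsubmx z 0 i).
    by apply: (@loclip_nonexp _ _ (fun z => z 0 i)) => //; exact: loclip_coord.
  rewrite /F; case: fintype.split => i; first exact: rl.
  under eq_fun do rewrite -mulN1r; apply: loclipM; first exact: loclip_cst.
  do 2!apply: loclip_sum => ?; do 2!apply: loclipM => //.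
  by apply: loclip_nonexp => //; rewrite row_mxKl; exact: (christoffel_loclip oD gsm gpd).
- exact: H.
- exact: H.
- by rewrite /= xy vw.
by exists e => // t h1 h2; have /eq_row_mx[] := He t h1 h2.
Qed.

End geodesic_ode.

(** At the last time up to which two geodesics are known to agree, nothing is known to the right;
    the left difference quotients suffice to identify the velocities. *)
Lemma derive1_left_eq (R : realType) (V : normedModType R) (f g : R -> V) (t e : R) : 0 < e ->
  derivable f t 1 -> derivable g t 1 -> (forall s, t - e < s -> s <= t -> f s = g s) ->
  derive1 f t = derive1 g t.
Proof.
move=> e0 df dg fg; rewrite !derive1E.
have sub : (0 : R)^'- `=>` 0^'.
  move=> A; rewrite /at_left /dnbhs /within /=; apply: filterS => x Ax x0.
  by apply: Ax; rewrite lt_eqF.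
have lf := cvg_trans (cvg_app _ sub) df; have lg := cvg_trans (cvg_app _ sub) dg.
have eq : {near (0 : R)^'-, (fun h : R => h^-1 *: ((f \o shift t) (h *: (1 : R)) - f t)) =1
    (fun h : R => h^-1 *: ((g \o shift t) (h *: (1 : R)) - g t))}.
  near=> h; rewrite /= fg ?[f t]fg//; rewrite ?ltrBlDr ?ltrDl//.
  - rewrite /GRing.scale /= mulr1 [h + t]addrC -ltrBlDl; near: h.
    apply: filterS (@nbhs_left_gt _ 0 (- e) _) => [h|]; last by rewrite oppr_lt0.
    by lra.
  - rewrite /GRing.scale /= mulr1 gerDr; near: h; apply: nbhs_left_le.
have lf' : h^-1 *: ((g \o shift t) (h *: (1 : R)) - g t) @[h --> (0 : R)^'-] --> 'D_1 f t.
  by apply: cvg_trans lf; exact: near_eq_cvg eq.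
exact: (@cvg_unique _ (@norm_hausdorff _ V) _ _ _ _ lf' lg).
Unshelve. all: by end_near. Qed.

Lemma derivable_mderiv (R : realType) n (f : R -> 'rV[R]_n) t : derivable f t 1 ->
  mderiv t 1 f (derive1 f t).
Proof. by move=> /derivableP; rewrite -derive1E => df; apply/mderivP. Qed.

Section charts.
Context {R : realType} {n : nat}.
Variable M : riemannianManifold R n.
Implicit Types (i j : chart M) (c : R -> M).

Lemma cod_dom i (x : M) : dom i x -> cod i (coord i x).
Proof. by exists x. Qed.

Lemma metric_posdef i p : cod i p -> posdef (metric i p).
Proof. by move=> ip; split; [exact: metric_sym|exact: metric_pos]. Qed.

Lemma near_dom (T : topologicalType) (f : T -> M) t i : {for t, continuous f} -> dom i (f t) ->
  \forall s \near t, dom i (f s).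
Proof. by move=> fc fi; apply: fc; apply: open_nbhs_nbhs; split=> //; exact: dom_open. Qed.

Lemma geodesic_continuous c : geodesic c -> continuous c.
Proof. by case=> [[]]. Qed.

Lemma geodesic_mderiv c i t : geodesic c -> dom i (c t) ->
  mderiv t 1 (coord i \o c) (derive1 (coord i \o c) t) /\
  mderiv t 1 (derive1 (coord i \o c))
    (- Gam (metric i) (coord i (c t)) (derive1 (coord i \o c) t) (derive1 (coord i \o c) t)).
Proof.
move=> [[cc c1] geo] it; have [dx _] := c1 i t it; have [dv E] := geo i t it.
split.
  exact: derivable_mderiv dx.
have := derivable_mderiv dv; congr (mderiv _ _ _ _).
apply/rowP => k; have := E k; move=> /eqP; rewrite addr_eq0 => /eqP ->; rewrite [RHS]mxE; congr (- _).
by rewrite /Gam trik.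
Qed.

(** Let T be the supremum of the times up to which the curves agree. They agree at T because M is
    Hausdorff, with the same velocity by left derivatives; local uniqueness in a chart at T
    continues the agreement past T. *)
Lemma geodesic_unique c1 c2 i : geodesic c1 -> geodesic c2 -> dom i (c1 0) -> c1 0 = c2 0 ->
  derive1 (coord i \o c1) 0 = derive1 (coord i \o c2) 0 -> forall t, 0 <= t -> c1 t = c2 t.
Proof.
move=> g1 g2 i0 c0 v0 t t0.
have cc1 := geodesic_continuous g1; have cc2 := geodesic_continuous g2.
apply: contrapT => ct.
pose S := [set s : R | 0 <= s /\ forall r, 0 <= r <= s -> c1 r = c2 r].
have S0 : S 0 by split=> // r; rewrite -eq_le => /eqP <-.
have Sub : has_sup S.
  split; first by exists 0.
  exists t => s [s0 Hs]; rewrite leNgt; apply/negP => ts; apply: ct; apply: Hs.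
  by rewrite t0 ltW.
pose T := sup S.
have T0 : 0 <= T by exact: ub_le_sup Sub.2 _ S0.
have lt_T s : 0 <= s -> s < T -> c1 s = c2 s.
  move=> s0 sT; have Ts : 0 < T - s by rewrite subr_gt0.
  have [e [e0 He] se] := sup_adherent Ts Sub.
  by apply: He; rewrite s0 ltW//; move: se; rewrite opprB [T + _]addrC subrK.
have eqT : c1 T = c2 T.
  move: T0; rewrite le_eqVlt => /orP[/eqP <-//|T0].
  apply: (@cvg_unique _ (@carrier_hausdorff _ _ M) (c2 @ T^'-)).
    apply: cvg_trans; last exact: cvg_at_left_filter (cc1 T).
    apply: near_eq_cvg; near=> s; apply: lt_T; last by near: s; exact: nbhs_left_lt.
    by near: s; exact: nbhs_left_ge.
  exact: cvg_at_left_filter (cc2 T).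
have [j [jT vT]] : exists j, dom j (c1 T) /\ derive1 (coord j \o c1) T = derive1 (coord j \o c2) T.
  move: T0; rewrite le_eqVlt => /orP[/eqP <-|T0]; first by exists i.
  exists (chart_at (c1 T)); split; first exact: chart_atP.
  have j1 := chart_atP (c1 T); have j2 := j1; rewrite {2}eqT in j2.
  have [[_ d1] _] := g1; have [[_ d2] _] := g2.
  apply: (@derive1_left_eq _ _ _ _ T T) => //; [exact: (d1 _ _ j1).1|exact: (d2 _ _ j2).1|].
  move=> s; rewrite subrr => s0; rewrite le_eqVlt => /orP[/eqP ->|sT] /=; first by rewrite eqT.
  by rewrite (lt_T s (ltW s0) sT).
have [b Tb Hb] : exists2 b, T < b & forall s, T <= s -> s < b -> dom j (c1 s) /\ dom j (c2 s).
  have jT2 := jT; rewrite eqT in jT2.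
  have : \forall s \near T, dom j (c1 s) /\ dom j (c2 s).
    by apply: filterI; [exact: near_dom (cc1 T) jT|exact: near_dom (cc2 T) jT2].
  move=> /nbhs_normP[e /= e0 He]; exists (T + e); first by rewrite ltrDl.
  by move=> s Ts sT; apply: He => /=; rewrite distrC ger0_norm ?subr_ge0// ltrBlDl.
have op : open (cod j) by exact: cod_open.
have [|||//|e e0 He] := @geodesic_ode_unique _ _ (metric j) (cod j) op (@metric_smooth _ _ M j) (@metric_posdef j)
  (coord j \o c1) (coord j \o c2) (derive1 (coord j \o c1)) (derive1 (coord j \o c2)) T b Tb.
- move=> s Ts sb; have [h1 _] := Hb s Ts sb; have [m1 m2] := geodesic_mderiv g1 h1.
  by split=> //; exact: cod_dom.
- move=> s Ts sb; have [_ h1] := Hb s Ts sb; have [m1 m2] := geodesic_mderiv g2 h1.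
  by split=> //; exact: cod_dom.
- by rewrite /= eqT.
pose r := Num.min (T + e / 2) ((T + b) / 2).
have Tr : T < r by rewrite lt_min; apply/andP; split; lra.
suff /(ub_le_sup Sub.2) : S r by rewrite leNgt Tr.
split; first by rewrite (le_trans T0)// ltW.
move=> s /andP[s0 sr]; have [sT|Ts] := ltP s T; first exact: lt_T.
have : s < b /\ s < T + e by move: sr; rewrite le_min => /andP[h1 h2]; split; lra.
move=> [sb se]; have [h1 h2] := Hb s Ts sb; have /= h := He s Ts se.
by rewrite -(coordK h1) h coordK.
Unshelve. all: by end_near. Qed.

Lemma mderiv_comp_scale (x : R -> 'rV[R]_n) (a t : R) x' : mderiv (a * t) 1 x x' ->
  mderiv t 1 (fun s => x (a * s)) (a *: x').
Proof.
move=> H i k; rewrite mxE mulrC.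
apply: (@is_derive1_comp _ (fun s => x s i k) (fun s : R => a * s) t _ _ (H i k)).
by rewrite -{2}[a]mulr1; apply: is_derive_cmul; exact: is_derive_id.
Qed.

(** The value a = 0 is allowed and yields the constant geodesic. *)
Lemma geodesic_scale c (a : R) : geodesic c -> geodesic (fun s => c (a * s)) /\
  forall i t, dom i (c (a * t)) ->
    derive1 (coord i \o (fun s => c (a * s))) t = a *: derive1 (coord i \o c) (a * t).
Proof.
move=> gc; have cc := geodesic_continuous gc.
have ac : continuous (fun s : R => a * s) by move=> s; exact: mulrl_continuous.
have cac : continuous (fun s => c (a * s)).
  by move=> s; apply: continuous_comp; [exact: ac|exact: cc].
have der i t : dom i (c (a * t)) -> mderiv t 1 (coord i \o (fun s => c (a * s))) (a *: derive1 (coord i \o c) (a * t)).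
  by move=> it; have [m1 _] := geodesic_mderiv gc it; exact: mderiv_comp_scale m1.
have derE i t : dom i (c (a * t)) -> derive1 (coord i \o (fun s => c (a * s))) t = a *: derive1 (coord i \o c) (a * t).
  by move=> it; rewrite derive1E; have /mderivP[] := der i t it.
have near_derE i t : dom i (c (a * t)) -> {near t,
    (fun s => a *: derive1 (coord i \o c) (a * s)) =1 derive1 (coord i \o (fun s => c (a * s)))}.
  move=> it; have := @near_dom _ (fun s => c (a * s)) t i (cac t) it.
  by apply: filterS => s /derE ->.
have der2 i t : dom i (c (a * t)) -> mderiv t 1 (derive1 (coord i \o (fun s => c (a * s))))
    (a *: (a *: (- Gam (metric i) (coord i (c (a * t))) (derive1 (coord i \o c) (a * t)) (derive1 (coord i \o c) (a * t))))).
  move=> it; apply: (mderiv_near (near_derE i t it)).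
  have [_ m2] := geodesic_mderiv gc it.
  have := mderivZ (is_derive_cst a t 1) (mderiv_comp_scale m2).
  by rewrite scale0r add0r.
split=> //; split; first split=> // i t it; [split|].
- by have /mderivP[] := der i t it.
- by have /mderivP/is_derive_continuous := der2 i t it.
move=> i t it /=; have /mderivP[d dE] := der2 i t it; split=> // k.
have tk := @trik _ _ (fun k p q => christoffel (metric i) k p q (coord i (c (a * t)))).
rewrite derive1E dE derE// -tk triZl triZr /Gam !scalerN.
by move: (tri _ _ _) => X; rewrite !mxE addNr.
Qed.

End charts.

(** * The exponential map *)

Lemma row_differentiable (R : realType) n m (f : 'rV[R]_n -> 'rV[R]_m) p :
  (forall k, differentiable (fun q => f q 0 k) p) -> differentiable f p.
Proof.
move=> H; rewrite (_ : f = \sum_k (fun q => f q 0 k *: basis_vec k)); last first.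
  by apply/funext => q; rewrite fct_sumE -row_sum_basis.
by apply: differentiable_sum => k; exact: differentiableZl (H k).
Qed.

Lemma row_continuous (R : realType) (T : topologicalType) m (f : T -> 'rV[R]_m) (p : T) :
  (forall k, {for p, continuous (fun q => f q 0 k)}) -> {for p, continuous f}.
Proof.
move=> H; apply/cvgrPdist_le => e e0.
near=> q; apply: row_norm_le => [|k]; rewrite ?(ltW e0)// !mxE; move: k; near: q.
by apply: filter_forall => k; have /cvgrPdist_le/(_ e e0) := H k.
Unshelve. all: by end_near.
Qed.

Lemma derive_coord (R : realType) (V : normedModType R) m (f : V -> 'rV[R]_m) (p v : V) k :
  derivable f p v -> 'D_v (fun q => f q 0 k) p = ('D_v f p) 0 k.
Proof. by move=> /derivableP/mderivP/(_ 0 k)[]. Qed.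

Section transition.
Context {R : realType} {n : nat}.
Variable M : riemannianManifold R n.
Implicit Types (i j : chart M) (p : 'rV[R]_n).

Lemma overlap_open i j : open (coord i @` (dom i `&` dom j)).
Proof.
rewrite openE => _ [x [ix jx] <-].
have cv : {for coord i x, continuous (coordV i)} by apply: coordV_continuous; exact: cod_dom.
have ip : cod i (coord i x) := cod_dom ix.
have := @near_dom _ _ M _ (coordV i) _ j cv; rewrite coordK// => /(_ jx).
have := near_open (@cod_open _ _ M i) ip; apply: filterS2 => q [z iz <-].
by rewrite coordK// => jz; exists z.
Qed.

(** The chain rule for the transition map and the tensor rule [metric_change] cancel, so the
    pullback does not depend on the chart. *)
Lemma metric_change_pull (phi psi : 'rV[R]_n -> 'rV[R]_n) U i j y : open U -> smooth_map_on U phi -> U y ->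
  (coord i @` (dom i `&` dom j)) (phi y) -> {near y, (coord j \o coordV i) \o phi =1 psi} ->
  pullback (metric j) psi y = pullback (metric i) phi y.
Proof.
move=> oU phism Uy ij psiE; set tau := coord j \o coordV i.
have dtau k : differentiable (fun q => tau q 0 k) (phi y).
  have ts := @transition_smooth _ _ M i j k.
  exact: (smooth_differentiable (@overlap_open i j) ts ij).
have dt : differentiable tau (phi y) by exact: row_differentiable.
have JE : jac psi y = jac phi y *m 'J tau (phi y).
  apply/row_matrixP => a; rewrite row_mul; apply/rowP => k.
  have me : mderiv y (basis_vec a) phi (row a (jac phi y)).
    move=> z l; rewrite ord1 !mxE; apply: derivableP; apply: diff_derivable.
    exact: smooth_differentiable oU (phism l) Uy.
  have H := chain_line (dtau k) me.
  rewrite !mxE /partial.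
  have -> : 'D_(basis_vec a) (fun q => psi q 0 k) y = 'D_(row a (jac phi y)) (fun q => tau q 0 k) (phi y).
    have nr : {near y, (fun q => tau (phi q) 0 k) =1 (fun q => psi q 0 k)}.
      by apply: filterS psiE => q <-.
    by rewrite -(near_eq_derive _ nr); case: H.
  rewrite derive_coord; last exact: diff_derivable.
  by rewrite deriveEjacobian// mxE.
rewrite /pullback JE trmx_mul (metric_change ij) -/tau.
have -> : psi y = tau (phi y) by have := nbhs_singleton psiE.
by rewrite !mulmxA.
Qed.

End transition.

Section exponential.
Context {R : realType} {n : nat}.
Variable M : riemannianManifold R n.
Variables (o : M) (E : 'rV[R]_n -> M) (F : M -> 'rV[R]_n).
Hypothesis Eexp : is_exponential_map o E.
Hypothesis EK : cancel E F.
Hypothesis FK : cancel F E.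
Hypothesis Ec : continuous E.
Hypothesis Esm : forall i, smooth_map_on (E @^-1` dom i) (coord i \o E).
Hypothesis Fsm : forall i, smooth_map_on (cod i) (F \o coordV i).
Implicit Types (i j : chart M) (y z v w : 'rV[R]_n).

Lemma exp_dom_open i : open (E @^-1` dom i).
Proof. by apply: open_comp; [move=> y _; exact: Ec|exact: dom_open]. Qed.

(** The definition of the exponential map speaks of time 1 only. The geodesic of velocity t v is
    that of velocity v run at speed t, by uniqueness. *)
Lemma exp_ray v : exists2 c : R -> M, geodesic c & forall t, 0 <= t -> E (t *: v) = c t.
Proof.
have [c [gc c0 cv c1]] := Eexp v; exists c => // t t0.
have [b [gb b0 bv b1]] := Eexp (t *: v).
have [gct der] := geodesic_scale t gc.
have o_dom := chart_atP o.
have h : dom (chart_at o) (c (t * 0)) by rewrite mulr0 c0.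
rewrite -b1 -[t in c t]mulr1; apply: (geodesic_unique gb gct (i := chart_at o)) => //.
- by rewrite b0.
- by rewrite b0 mulr0 c0.
- by rewrite bv der// mulr0 cv.
Qed.

(** A geodesic with initial velocity 0 agrees with its rescaling by the factor 0, which is
    constant. *)
Lemma exp0 : E 0 = o.
Proof.
have [c [gc c0 cv c1]] := Eexp 0.
have [c' gc' c'E] := exp_ray 0.
have := c'E 0 (lexx 0); have := c'E 1 ler01; rewrite !scaler0 => h1 h2.
have [b [gb b0 bv b1]] := Eexp 0.
have [gct der] := geodesic_scale 0 gb.
have o_dom := chart_atP o.
have h : dom (chart_at o) (b (0 * 0)) by rewrite mulr0 b0.
rewrite -b1 -[RHS]b0 -[in RHS](mul0r (1 : R)); apply: (geodesic_unique gb gct (i := chart_at o)) => //.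
- by rewrite b0.
- by rewrite mulr0.
- by rewrite bv der// mul0r scale0r.
Qed.

(** The ray through z is a geodesic; its equation is read at time 1 in the chart i, around which the
    times are positive as [exp_ray] requires. *)
Lemma exp_geodesic_pde i z : dom i (E z) ->
  d2 (coord i \o E) z z z + Gam (metric i) ((coord i \o E) z) (d1 (coord i \o E) z z) (d1 (coord i \o E) z z) = 0.
Proof.
move=> iz; have [c gc cE] := exp_ray z; set phi := coord i \o E.
have oU := @exp_dom_open i.
have U1 : (E @^-1` dom i) (1 *: z) by rewrite scale1r.
have c1 : dom i (c 1) by rewrite -cE// scale1r.
have near_c : {near (1 : R), (fun s => phi (s *: z)) =1 coord i \o c}.
  near=> s; rewrite /phi /= cE// ltW//; near: s; exact: lt_nbhsr.
have near_d : {near (1 : R), (fun s => d1 phi z (s *: z)) =1 derive1 (coord i \o c)}.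
  have nc := near_join near_c; have nU := near_ray oU U1; near=> s.
  have Us : (E @^-1` dom i) (s *: z) by near: s.
  have ds := mderiv_ray0 oU (Esm i) Us.
  rewrite derive1E; have ns : {near s, (fun s => phi (s *: z)) =1 coord i \o c} by near: s.
  by have /mderivP[_ ->] := mderiv_near ns ds.
have [_ m2] := geodesic_mderiv gc c1.
have e1 := mderiv_uniq (mderiv_near near_d (mderiv_ray1 oU (Esm i) z U1)) m2.
have dE := nbhs_singleton near_d; have pE := nbhs_singleton near_c.
move: e1 dE pE; rewrite /= !scale1r => e1 dE pE.
by rewrite e1 -dE -[coord i (c 1)]pE addNr.
Unshelve. all: by end_near. Qed.

Lemma F_near i (x : M) : dom i x -> \forall x' \near x, F x' = (F \o coordV i) (coord i x').
Proof.
by move=> ix; apply: filterS (@near_dom _ _ M _ id x i _ ix) => [x' ix'|]; [rewrite /= coordK|exact: cvg_id].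
Qed.

Lemma F_continuous : continuous F.
Proof.
move=> x; have ix := chart_atP x; set i := chart_at x in ix.
have near_F := F_near ix; have Fx := nbhs_singleton near_F.
have cx : {for x, continuous ((F \o coordV i) \o coord i)}.
  apply: continuous_comp; first exact: coord_continuous.
  apply: row_continuous => k; exact: (smooth_continuous (Fsm i k) (cod_dom ix)).
rewrite /continuous_at Fx; apply: cvg_trans cx; apply: near_eq_cvg.
by apply: filterS near_F => q ->.
Qed.

Lemma exp_chart_inv i z : dom i (E z) ->
  jac (coord i \o E) z *m jac (F \o coordV i) (coord i (E z)) = 1%:M.
Proof.
move=> iz; apply/row_matrixP => a; apply/rowP => k.
have oU := @exp_dom_open i.
have op : open (@cod _ _ M i) by exact: cod_open.
have me : mderiv z (basis_vec a) (coord i \o E) (row a (jac (coord i \o E) z)).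
  move=> r l; rewrite ord1 !mxE; apply: derivableP; apply: diff_derivable.
  exact: smooth_differentiable oU (Esm i l) iz.
have dh := smooth_differentiable op (Fsm i k) (cod_dom iz).
have := chain_line dh me; rewrite (smooth_deriveE _ op (Fsm i k) (cod_dom iz)) => -[_ H].
rewrite row_mul [LHS]mxE; transitivity (\sum_(l < n) row a (jac (coord i \o E) z) 0 l * partial l (fun p => (F \o coordV i) p 0 k) (coord i (E z))).
  by apply: eq_bigr => l _; rewrite [in X in _ * X]mxE.
rewrite -H -/(partial a _ z).
have nz : {near z, (fun q => (F \o coordV i) ((coord i \o E) q) 0 k) =1 (fun q : 'rV[R]_n => q 0 k)}.
  by apply: filterS (near_open oU iz) => q iq; rewrite /= coordK// EK.
rewrite /partial (near_eq_derive _ nz).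
have := @is_derive_id _ _ z (basis_vec a) => /mderivP/(_ 0 k)[_ ->].
by rewrite !mxE eqxx eq_sym.
Qed.

Lemma exp_jac_unit i z : dom i (E z) -> jac (coord i \o E) z \in unitmx.
Proof. by move=> /exp_chart_inv/mulmx1_unit[]. Qed.

(** The chosen chart may jump with y. Since any chart around E(y) gives the same matrix
    ([pull_metricE]), the result is nevertheless continuous. *)
Definition pull_metric y : 'M[R]_n := pullback (metric (chart_at (E y))) (coord (chart_at (E y)) \o E) y.

Lemma pull_metricE i y : dom i (E y) -> pull_metric y = pullback (metric i) (coord i \o E) y.
Proof.
move=> iy; have jy := chart_atP (E y); rewrite /pull_metric; set j := chart_at (E y) in jy *.
apply: (metric_change_pull (@exp_dom_open i) (Esm i)) => //.
  by exists (E y).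
by apply: filterS (near_open (@exp_dom_open i) iy) => q iq; rewrite /= coordK.
Qed.

Lemma pull_metric_continuous y a b : {for y, continuous (fun y => pull_metric y a b)}.
Proof.
have iy := chart_atP (E y); set i := chart_at (E y) in iy.
have oU := @exp_dom_open i.
apply: (@near_eq_continuous _ _ (fun y => pullback (metric i) (coord i \o E) y a b)).
  by apply: filterS (near_open oU iy) => q iq; rewrite -pull_metricE.
have Jc k l : {for y, continuous (fun y => jac (coord i \o E) y k l)}.
  rewrite (_ : (fun y => _) = partial k (fun q => (coord i \o E) q 0 l)); last by apply/funext => q; rewrite mxE.
  exact: smooth_continuous (smooth_partial k (Esm i l)) iy.
have gc k l : {for y, continuous (fun y => metric i (coord i (E y)) k l)}.
  have phc : {for y, continuous (coord i \o E)}.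
    by apply: continuous_comp; [exact: Ec|exact: coord_continuous].
  exact: (continuous_comp phc (smooth_continuous (@metric_smooth _ _ M i k l) (cod_dom iy))).
rewrite (_ : (fun y => _) = (fun y => \sum_k (\sum_l jac (coord i \o E) y a l * metric i (coord i (E y)) l k) * jac (coord i \o E) y b k)); last first.
  by apply/funext => q; rewrite /pullback mxE; apply: eq_bigr => k _; rewrite !mxE.
apply: continuous_bigsum => k; apply: continuousM => //.
by apply: continuous_bigsum => l; apply: continuousM.
Qed.

Lemma exp_normal_chart c : (forall (x : M) (s : 'M[R]_(2, n)), row_free s -> - c <= sectional_curvature x s <= 0) ->
  forall y, normal_chart c pull_metric y.
Proof.
(* [sectional_curvature] at E(y) is computed in [chart_at (E y)], hence this choice of chart. *)
move=> curv y; have iy := chart_atP (E y); set i := chart_at (E y) in iy.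
exists (metric i), (cod i), (coord i \o E), (E @^-1` dom i); split.
- by split; [exact: cod_open|exact: metric_smooth|exact: metric_posdef].
- by split=> //; [exact: exp_dom_open|move=> z; exact: cod_dom].
- by move=> z; exact: exp_geodesic_pde.
- by move=> z iz; split; [exact: pull_metricE|exact: exp_jac_unit].
- exact: (curv (E y)).
Qed.

End exponential.

(** * Distance *)

Lemma row_entry_continuous (R : realType) (T : topologicalType) n (u : T -> 'rV[R]_n) (p : T) k :
  {for p, continuous u} -> {for p, continuous (fun t => u t 0 k)}.
Proof.
move=> cu; apply/cvgrPdist_le => e e0; have /cvgrPdist_le/(_ e e0) := cu.
by apply: filterS => q; apply: le_trans; have := coord_le_norm (u p - u q) k; rewrite !mxE.
Qed.

Lemma bform_continuous (R : realType) (T : topologicalType) n (G : T -> 'M[R]_n) (u v : T -> 'rV[R]_n) (p : T) :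
  (forall a b, {for p, continuous (fun t => G t a b)}) -> {for p, continuous u} -> {for p, continuous v} ->
  {for p, continuous (fun t => bform (G t) (u t) (v t))}.
Proof.
move=> cG cu cv.
rewrite (_ : (fun t => bform (G t) (u t) (v t)) = fun t => \sum_i \sum_j u t 0 i * G t i j * v t 0 j); last first.
  by apply/funext => t; rewrite bformE.
apply: continuous_bigsum => i; apply: continuous_bigsum => j.
apply: continuousM; last exact: row_entry_continuous.
by apply: continuousM => //; exact: row_entry_continuous.
Qed.

Lemma row_mk_continuous (R : realType) (T : topologicalType) n (f : 'I_n -> T -> R) (p : T) :
  (forall a, {for p, continuous (f a)}) -> {for p, continuous (fun t => \row_a f a t)}.
Proof.
move=> H; apply: row_continuous => a.
by rewrite (_ : (fun t => _) = f a)//; apply/funext => t; rewrite mxE.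
Qed.

Lemma continuous_Rintegrable (R : realType) (s : R -> R) (a b : R) : continuous s ->
  (@lebesgue_measure R).-integrable `[a, b] (EFin \o s).
Proof.
move=> cs; apply: continuous_compact_integrable; first exact: segment_compact.
exact: continuous_subspaceT.
Qed.

Lemma increment_le_Rintegral (R : realType) (L L' s : R -> R) : continuous s -> continuous L' ->
  (forall t : R, is_derive t 1 L (L' t)) -> (forall t, L' t <= s t) ->
  L 1 - L 0 <= Rintegral (@lebesgue_measure R) `[0, 1] s.
Proof.
move=> cs cL' dL le; apply: (@le_trans _ _ (Rintegral (@lebesgue_measure R) `[0, 1] L')).
  have cL : continuous L by move=> t; exact: is_derive_continuous (dL t).
  rewrite /Rintegral (@continuous_FTC2 _ _ L)//.
  - exact: continuous_subspaceT.
  - split; [by move=> t _; case: (dL t)| |].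
    + exact: cvg_at_right_filter (cL 0).
    + exact: cvg_at_left_filter (cL 1).
  - by move=> t _; rewrite derive1E; case: (dL t).
apply: le_Rintegral => //; exact: continuous_Rintegrable.
Qed.

Section distance.
Context {R : realType} {n : nat}.
Variable M : riemannianManifold R n.
Variables (o : M) (E : 'rV[R]_n -> M) (F : M -> 'rV[R]_n).
Hypothesis Eexp : is_exponential_map o E.
Hypothesis EK : cancel E F.
Hypothesis FK : cancel F E.
Hypothesis Ec : continuous E.
Hypothesis Esm : forall i, smooth_map_on (E @^-1` dom i) (coord i \o E).
Hypothesis Fsm : forall i, smooth_map_on (cod i) (F \o coordV i).
Variable c : R.
Hypothesis c0 : 0 < c.
Hypothesis curv : forall (x : M) (s : 'M[R]_(2, n)), row_free s -> - c <= sectional_curvature x s <= 0.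
Implicit Types (i j : chart M) (y z v w : 'rV[R]_n).

Local Notation G := (pull_metric E).

Let NC y : normal_chart c G y.
Proof. exact: (exp_normal_chart Eexp EK Ec Esm Fsm curv). Qed.

Let Gc a b : {for 0, continuous (fun y => G y a b)}.
Proof. by apply: pull_metric_continuous. Qed.

(** The chart used in [speed] changes with t, whereas F o k is one curve in R^n; continuity of the
    speed and length estimates are read from the latter. *)
Lemma curve_pull (k : R -> M) (t : R) : C1_curve k ->
  [/\ derivable (F \o k) t 1, {for t, continuous (derive1 (F \o k))} &
      speed k t = Num.sqrt (bform (G (F (k t))) (derive1 (F \o k) t) (derive1 (F \o k) t))].
Proof.
move=> [kc k1]; have it := chart_atP (k t); set i := chart_at (k t) in it.
have op : open (@cod _ _ M i) by exact: cod_open.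
have oU := @exp_dom_open _ _ _ E Ec i.
pose x := coord i \o k.
have near_i : \forall s \near t, dom i (k s) := near_dom (kc t) it.
have hd a s : dom i (k s) -> is_derive s 1 (fun r => (F \o coordV i) (x r) 0 a)
    (\sum_l derive1 x s 0 l * partial l (fun p => (F \o coordV i) p 0 a) (x s)).
  move=> is_; have [dx _] := k1 i s is_.
  have := chain_line (smooth_differentiable op (Fsm i a) (cod_dom is_)) (derivable_mderiv dx).
  by rewrite (smooth_deriveE _ op (Fsm i a) (cod_dom is_)).
have md s : dom i (k s) -> mderiv s 1 (F \o k)
   (\row_a \sum_l derive1 x s 0 l * partial l (fun p => (F \o coordV i) p 0 a) (x s)).
  move=> is_; have nf : {near s, (fun r => (F \o coordV i) (x r)) =1 F \o k}.
    by apply: filterS (near_dom (kc s) is_) => r ir; rewrite /x /= coordK.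
  apply: (mderiv_near nf) => r a; rewrite ord1 mxE; exact: hd.
have dE s : dom i (k s) -> derive1 (F \o k) s = \row_a \sum_l derive1 x s 0 l * partial l (fun p => (F \o coordV i) p 0 a) (x s).
  by move=> /md/mderivP[_ h]; rewrite derive1E; exact: h.
have [dx cx'] := k1 i t it.
have cx : {for t, continuous x} by apply: continuous_comp; [exact: kc|exact: coord_continuous].
split.
- by have /mderivP[] := md t it.
- have nd : {near t, (fun s => \row_a \sum_l derive1 x s 0 l * partial l (fun p => (F \o coordV i) p 0 a) (x s)) =1 derive1 (F \o k)}.
    by apply: filterS near_i => s /dE ->.
  apply: (near_eq_continuous nd).
  apply: row_mk_continuous => a.
  apply: continuous_bigsum => l; apply: continuousM.
    exact: row_entry_continuous.
  exact: (continuous_comp cx (smooth_continuous (smooth_partial l (Fsm i a)) (cod_dom it))).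
- have itE : dom i (E (F (k t))) by rewrite FK.
  rewrite (pull_metricE Ec Esm itE) (pullbackE (metric i) oU (Esm i) _ _ itE).
  rewrite /speed -/i; congr Num.sqrt.
  have -> : (coord i \o E) (F (k t)) = x t by rewrite /x /= FK.
  suff -> : d1 (coord i \o E) (derive1 (F \o k) t) (F (k t)) = derive1 x t by [].
  apply/rowP => a; rewrite d1k.
  have dz : mderiv t 1 (F \o k) (derive1 (F \o k) t).
    by apply: derivable_mderiv; have /mderivP[] := md t it.
  have dphi : differentiable (fun q => (coord i \o E) q 0 a) ((F \o k) t).
    exact: (smooth_differentiable oU (Esm i a) itE).
  have [_ <-] := chain_line dphi dz.
  have := derivable_mderiv dx 0 a => -[_ <-].
  apply: near_eq_derive; near=> s; by rewrite /x /= FK.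
Unshelve. all: by end_near. Qed.

Lemma speed_continuous (k : R -> M) : C1_curve k -> continuous (speed k).
Proof.
move=> Ck t.
rewrite (_ : speed k = fun t => Num.sqrt (bform (G (F (k t))) (derive1 (F \o k) t) (derive1 (F \o k) t))); last first.
  by apply/funext => s; have [_ _ ->] := curve_pull s Ck.
have [_ c' _] := curve_pull t Ck.
apply: continuous_comp; last exact: sqrt_continuous.
have Fk : {for t, continuous (F \o k)}.
  by apply: continuous_comp; [exact: Ck.1|exact: (F_continuous Fsm)].
apply: (bform_continuous _ c' c') => a b.
exact: (@continuous_comp _ _ _ (F \o k) (fun y => G y a b) t Fk (@pull_metric_continuous _ _ _ _ Ec Esm _ _ _)).
Qed.

Let G0pd : posdef (G 0) := G_posdef NC 0.

(** The linear functional <., w> at the pole is followed along the curve: its derivative is at most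
    |w| times the norm of the velocity at the pole, hence at most |w| times the speed. Linearity
    makes the estimate additive over chains of arcs. *)
Lemma arc_length_ge (k : R -> M) w : C1_curve k ->
  bform (G 0) (F (k 1) - F (k 0)) w <= Num.sqrt (bform (G 0) w w) * arc_length k.
Proof.
move=> Ck; have cs := speed_continuous Ck.
rewrite /arc_length -RintegralZl//; last exact: continuous_Rintegrable.
rewrite bformBl; apply: (@increment_le_Rintegral _ (fun t => bform (G 0) (F (k t)) w) (fun t => bform (G 0) (derive1 (F \o k) t) w) (fun t => Num.sqrt (bform (G 0) w w) * speed k t)).
- by move=> t; exact: (continuousM (cvg_cst _) (cs t)).
- move=> t; have [_ c' _] := curve_pull t Ck.
  exact: (@bform_continuous _ _ _ (fun=> G 0) _ (fun=> w) t (fun a b => cvg_cst _) c' (cvg_cst _)).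
- move=> t; have [d _ _] := curve_pull t Ck.
  have md := derivable_mderiv d.
  have := mderivM (mderivM md (mderiv_cst t 1 (G 0))) (mderiv_cst t 1 w^T) => /(_ 0 0).
  by rewrite mulmx0 addr0 mulmx0 addr0.
- move=> t; have [_ _ ->] := curve_pull t Ck; rewrite -sqrtrM ?posdef_ge0//.
  apply: (le_trans (ler_norm _)); rewrite -sqrtr_sqr ler_wsqrtr// mulrC.
  apply: le_trans (posdef_CS _ _ G0pd) _; rewrite ler_wpM2r ?posdef_ge0//.
  exact: (metric_expands c0 NC Gc).
Qed.

Lemma path_length_ge (s : seq (R -> M)) (x y : M) w : piecewise_C1_path x s y ->
  bform (G 0) (F y - F x) w <= Num.sqrt (bform (G 0) w w) * \sum_(k <- s) arc_length k.
Proof.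
elim: s x => [|k s IH] x /=; first by move=> ->; rewrite subrr bform0l big_nil mulr0.
move=> [Ck <- p]; rewrite big_cons mulrDr.
rewrite (_ : F y - F (k 0) = (F (k 1) - F (k 0)) + (F y - F (k 1))); last by rewrite [RHS]addrC addrA subrK.
by rewrite bformDl lerD// ?arc_length_ge// IH.
Qed.

(** Provides a path between any two points, so that the infimum defining [dist] is not taken over
    the empty set. *)
Lemma segment_C1 (x y : M) : C1_curve (fun t : R => E (F x + t *: (F y - F x))).
Proof.
set u := F y - F x.
have lc : continuous (fun t : R => F x + t *: u).
  by move=> t; apply: (@cvgD _ 'rV[R]_n); [exact: cvg_cst|exact: scalel_continuous].
split; first by move=> t; apply: continuous_comp; [exact: lc|exact: Ec].
move=> i t it; have oU := @exp_dom_open _ _ _ E Ec i.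
have md s : dom i (E (F x + s *: u)) -> mderiv s 1 (fun s : R => (coord i \o E) (F x + s *: u)) (d1 (coord i \o E) u (F x + s *: u)).
  move=> is_ r k; rewrite ord1 d1k.
  have D := derivableP (@diff_derivable _ _ _ _ _ u (smooth_differentiable oU (Esm i k) is_)).
  exact: (iffLR (is_derive_lineP _ _ _ _ _) D).
split; first by have /mderivP[] := md t it.
have nd : {near t, (fun s : R => d1 (coord i \o E) u (F x + s *: u)) =1 derive1 (coord i \o (fun t : R => E (F x + t *: u)))}.
  have /= := @near_dom _ _ M _ (fun t : R => E (F x + t *: u)) t i _ it.
  move=> /(_ _)/filterS; apply.
    by move=> s is_; rewrite derive1E; have /mderivP[_ /esym] := md s is_.
  by apply: continuous_comp; [exact: lc|exact: Ec].
apply: (near_eq_continuous nd).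
apply: row_continuous => k.
have -> : (fun s : R => d1 (coord i \o E) u (F x + s *: u) 0 k) = ('D_u (fun q => (coord i \o E) q 0 k)) \o (fun s : R => F x + s *: u).
  by apply/funext => s; rewrite d1k.
exact: (continuous_comp (lc t) (smooth_continuous (smooth_derive u oU (Esm i k)) it)).
Qed.

Lemma dist_ge (x y : M) : Num.sqrt (bform (G 0) (F y - F x) (F y - F x)) <= dist x y.
Proof.
apply: lb_le_inf.
  exists (\sum_(k <- [:: fun t : R => E (F x + t *: (F y - F x))]) arc_length k).
  exists [:: fun t : R => E (F x + t *: (F y - F x))] => //=; split; first exact: segment_C1.
  - by rewrite scale0r addr0 FK.
  - by rewrite scale1r addrC subrK FK.
(* Testing against w = F y - F x itself gives |w|^2 <= |w| times the length, and |w| is divided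
   out. *)
move=> _ [s p ->]; have := path_length_ge (F y - F x) p; set w := F y - F x.
have [->|w0] := eqVneq w 0.
  move=> _; rewrite bform0l sqrtr0 sumr_ge0// => k _; apply: Rintegral_ge0 => t _; exact: sqrtr_ge0.
have ww : 0 < bform (G 0) w w by exact: G0pd.2.
by rewrite -{1}[bform _ _ _](sqr_sqrtr (ltW ww)) expr2 ler_pM2l// sqrtr_gt0.
Qed.

Lemma dist_diag (x : M) : dist x x = 0.
Proof.
apply/eqP; rewrite eq_le; apply/andP; split.
  apply: ge_inf; last by exists [::] => //; rewrite big_nil.
  by exists 0 => _ [s _ ->]; rewrite sumr_ge0// => k _; apply: Rintegral_ge0 => t _; exact: sqrtr_ge0.
by have := dist_ge x x; rewrite subrr bform0l sqrtr0.
Qed.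

End distance.

Lemma mulmxr_norm_le (R : realType) n m (v : 'rV[R]_n) (B : 'M[R]_(n, m)) :
  `|v *m B| <= (\sum_i \sum_j `|B i j|) * `|v|.
Proof.
have B0 i : 0 <= \sum_j `|B i j| by apply: sumr_ge0.
apply: row_norm_le => [|k]; first by rewrite mulr_ge0// sumr_ge0.
rewrite mxE mulr_suml; apply: le_trans (ler_norm_sum _ _ _) _; apply: ler_sum => i _.
rewrite normrM mulrC; apply: ler_pM => //; last exact: coord_le_norm.
by rewrite (bigD1 k)//= lerDl sumr_ge0.
Qed.

Lemma mulmxr_continuous (R : realType) n m (B : 'M[R]_(n, m)) : continuous (fun v : 'rV[R]_n => v *m B).
Proof.
move=> v; apply: row_continuous => k.
rewrite (_ : (fun v : 'rV[R]_n => _) = fun v : 'rV[R]_n => \sum_i v 0 i * B i k); last first.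
  by apply/funext => w; rewrite mxE.
apply: continuous_bigsum => i.
have vi : {for v, continuous (fun w : 'rV[R]_n => w 0 i)} by exact: (@row_entry_continuous _ _ _ id v i).
exact: (continuousM vi (@cst_continuous _ _ (B i k) v)).
Qed.

Lemma differentiable_estimate (R : realType) (V W : normedModType R) (f : V -> W) (x : V) (e : R) :
  differentiable f x -> 0 < e -> \forall z \near x, `|f z - f x - 'd f x (z - x)| <= e * `|z - x|.
Proof.
move=> /diff_locally/eqaddoP H e0; have := H e e0 => h; apply/nbhs0P; apply: filterS h => h /=.
have -> : x + h - x = h by rewrite addrAC subrr add0r.
by rewrite -addrA -opprD [x + h]addrC.
Qed.

(* The linear change of variables C turns the metric at the pole into the Euclidean one, so that
   Phi expands no distance and the density of Phi^-1 is bounded by that of the model space. *)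
Lemma polar_coordinates (R : realType) (n : nat) (M : riemannianManifold R n) (o : M) (c : R) :
  pole o -> 0 < c ->
  (forall (x : M) (s : 'M[R]_(2, n)), row_free s -> - c <= sectional_curvature x s <= 0) ->
  exists (Phi : M -> 'rV[R]_n) (Psi : 'rV[R]_n -> M),
  [/\ [/\ cancel Phi Psi, cancel Psi Phi, continuous Phi & continuous Psi],
      forall x y : M, l2norm (Phi y - Phi x) <= dist x y,
      forall x : M, dist x x = 0,
      Phi o = 0 &
      forall y, exists (i : chart M) (A : 'M[R]_n),
      [/\ dom i (Psi y), A \in unitmx,
          forall e : R, 0 < e -> \forall z \near y,
            `|coord i (Psi z) - coord i (Psi y) - (z - y) *m A| <= e * `|z - y| &
          Num.sqrt (\det (metric i (coord i (Psi y)))) * `|\det A| <=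
          if y == 0 then 1 else
            (sinh (Num.sqrt c * l2norm y) / (Num.sqrt c * l2norm y)) ^+ n.-1]].
Proof.
move=> [E Eexp [F [EK FK Ec Esm Fsm]]] c0 curv.
have NC := exp_normal_chart Eexp EK Ec Esm Fsm curv.
set G := pull_metric E in NC.
have Gc a b : {for 0, continuous (fun y => G y a b)} by apply: pull_metric_continuous.
have G0pd : posdef (G 0) := G_posdef NC 0.
have [C Cu GC] := posdef_chol G0pd.
have l2C v : l2norm (v *m C) = Num.sqrt (bform (G 0) v v).
  rewrite GC /bform /l2norm; congr Num.sqrt.
  rewrite mulmxA -mulmxA -trmx_mul mxE; apply: eq_bigr => k _.
  by rewrite [in X in _ = _ * X]mxE expr2.
have lC (m : nat) (B : 'M[R]_(n, m)) : continuous (fun v : 'rV[R]_n => v *m B).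
  exact: mulmxr_continuous.
exists (fun x => F x *m C), (fun y => E (y *m invmx C)); split.
- split.
  + by move=> x; rewrite mulmxK// FK.
  + by move=> y; rewrite EK mulmxKV.
  + by move=> x; exact: (continuous_comp (F_continuous Fsm (x := x)) (lC _ C (F x))).
  + by move=> y; exact: (continuous_comp (lC _ (invmx C) y) (Ec (y *m invmx C))).
- move=> x y; rewrite -mulmxBl l2C; exact: (dist_ge Eexp EK FK Ec Esm Fsm c0 curv).
- exact: (dist_diag Eexp EK FK Ec Esm Fsm c0 curv).
- have F0 : F o = 0 by rewrite -(exp0 Eexp) EK.
  by rewrite F0 mul0mx.
move=> y; set z := y *m invmx C.
have iz := chart_atP (E z); set i := chart_at (E z) in iz.
have oU := @exp_dom_open _ _ _ E Ec i.
have Ju := exp_jac_unit EK Ec Esm Fsm iz.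
(* A is the jacobian at y of the chart composed with Psi, where Psi(y) = E(y C^-1). *)
exists i, (invmx C *m jac (coord i \o E) z); split=> //.
- by rewrite unitmx_mul unitmx_inv Cu.
- move=> e e0; set phi := coord i \o E; set K := \sum_i \sum_j `|invmx C i j|.
  have K0 : 0 <= K by do 2!(apply: sumr_ge0 => ? _).
  have K1 : 0 < K + 1 by rewrite ltr_wpDl.
  have dphi : differentiable phi z.
    by apply: row_differentiable => k; exact: (smooth_differentiable oU (Esm i k) iz).
  have dE h : 'd phi z h = h *m jac phi z.
    rewrite -deriveE//; apply/rowP => k.
    rewrite -(d1E oU (Esm i) h iz) d1k derive_coord//; exact: diff_derivable.
  have est := differentiable_estimate dphi (divr_gt0 e0 K1).
  have cC : {for y, continuous (fun w : 'rV[R]_n => w *m invmx C)} := @mulmxr_continuous _ _ _ (invmx C) y.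
  have est' : \forall w \near y, `|phi (w *m invmx C) - phi z - 'd phi z (w *m invmx C - z)| <=
      e / (K + 1) * `|w *m invmx C - z| := cC _ est.
  apply: filterS est' => w; rewrite dE -/z => h.
  have -> : (w - y) *m (invmx C *m jac phi z) = (w *m invmx C - z) *m jac phi z.
    by rewrite mulmxA mulmxBl.
  apply: le_trans h _; rewrite -mulrA ler_wpM2l ?(ltW e0)//.
  rewrite ler_pdivrMl// -mulmxBl; apply: le_trans (mulmxr_norm_le _ _) _.
  by rewrite ler_wpM2r// lerDl.
have GE := pull_metricE Ec Esm iz.
(* As |det C| = sqrt(det G(0)), the density of the volume in the new coordinates is the ratio
   sqrt(det G(z)) / sqrt(det G(0)) bounded by [det_comparison]. *)
have detE : Num.sqrt (\det (metric i (coord i (E z)))) * `|\det (invmx C *m jac (coord i \o E) z)| =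
    Num.sqrt (\det (G z)) / `|\det C|.
  rewrite det_mulmx normrM mulrC -mulrA mulrC det_inv normfV; congr (_ * _).
  rewrite /G GE /pullback !det_mulmx det_tr mulrAC -expr2 sqrtrM ?sqr_ge0// sqrtr_sqr mulrC.
  by [].
rewrite detE.
have detC : `|\det C| = Num.sqrt (\det (G 0)) by rewrite GC det_mulmx det_tr -expr2 sqrtr_sqr.
have C0 : 0 < `|\det C| by rewrite normr_gt0 -unitfE -unitmxE.
rewrite ler_pdivrMr//.
case: ifP => [/eqP y0|/negbT y0].
  by rewrite /z y0 mul0mx mul1r detC.
have z0 : z != 0 by apply: contraNneq y0 => z0; rewrite -[y](mulmxKV Cu) -/z z0 mul0mx.
have -> : l2norm y = Num.sqrt (bform (G 0) z z) by rewrite -l2C /z mulmxKV.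
by rewrite mulrC detC; exact: (det_comparison c0 NC Gc z0).
Qed.

(** * Integration *)

Section integral_without_measurability.
Context d (T : measurableType d) (R : realType) (mu : {measure set T -> \bar R}).
Local Open Scope ereal_scope.
Implicit Types (D : set T) (f g : T -> \bar R).

Lemma le_ge0_integral D f g : (forall x, D x -> 0 <= f x) -> (forall x, D x -> f x <= g x) ->
  \int[mu]_(x in D) f x <= \int[mu]_(x in D) g x.
Proof.
move=> f0 fg; have g0 x : D x -> 0 <= g x by move=> Dx; apply: le_trans (fg x Dx); exact: f0.
rewrite !ge0_integralE//; apply: ereal_sup_le => _ [h hf <-].
exists h => // x; apply: le_trans (hf x) _.
by rewrite /patch; case: ifP => // /[!in_setE]; exact: fg.
Qed.

(* Needed without measurability because dist is not known to be measurable; it holds because the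
   integral of a nonnegative function is a supremum over simple functions below it. *)
Lemma le_integralT f g : (forall x, f x <= g x) -> \int[mu]_x f x <= \int[mu]_x g x.
Proof.
move=> fg; rewrite [leLHS]integralE [leRHS]integralE; apply: leeB.
  by apply: le_ge0_integral => // x _; apply: (@funepos_le _ _ setT); rewrite ?in_setE// => y _; exact: fg.
by apply: le_ge0_integral => // x _; apply: (@funeneg_le _ _ setT); rewrite ?in_setE// => y _; exact: fg.
Qed.

End integral_without_measurability.

Section image_weighted.
Context d d' (X : measurableType d) (Y : measurableType d') (R : realType).
Variables (m : {measure set X -> \bar R}) (phi : X -> Y) (w : X -> R).
Hypothesis mphi : measurable_fun setT phi.
Hypothesis mw : measurable_fun setT w.
Hypothesis w0 : forall x, 0 <= w x.
Local Open Scope ereal_scope.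

Let mpre (B : set Y) : measurable B -> measurable (phi @^-1` B).
Proof. by move=> mB; rewrite -[X in measurable X]setTI; exact: mphi. Qed.

(** The image by phi of the measure of density w. With w = 1 it is an image measure, with phi the
    identity a measure given by a density. *)
Lemma exists_image_weighted : exists P : {measure set Y -> \bar R},
  forall B, P B = \int[m]_(x in phi @^-1` B) (w x)%:E.
Proof.
pose P (B : set Y) := \int[m]_(x in phi @^-1` B) (w x)%:E.
have P0 : P set0 = 0 by rewrite /P preimage_set0 integral_set0.
have Pge0 B : 0 <= P B by apply: integral_ge0 => x _; rewrite lee_fin.
have Padd : semi_sigma_additive P.
  move=> F mF tF mUF; rewrite /P preimage_bigcup.
  apply: (@semi_sigma_additive_nng_induced _ _ _ m (EFin \o w)); [exact/measurable_EFinP|by move=> x; rewrite lee_fin|by move=> k; exact: mpre| |]; last first.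
    by rewrite -preimage_bigcup; exact: mpre.
  apply/trivIsetP => /= i j _ _ ij; rewrite -preimage_setI.
  by move/trivIsetP : tF => /(_ _ _ _ _ ij) ->//; rewrite preimage_set0.
pose mix := isMeasure.Build _ _ _ P P0 Pge0 Padd.
pose Q : {measure set Y -> \bar R} := HB.pack P mix.
by exists Q.
Qed.

Import HBNNSimple.

Lemma integral_nnsfun_weighted (h : {nnsfun Y >-> R}) :
  \int[m]_x ((h (phi x))%:E * (w x)%:E) =
  \sum_(r \in range h) (r%:E * \int[m]_(x in phi @^-1` (h @^-1` [set r])) (w x)%:E).
Proof.
have r0 r : range h r -> (0 <= r)%R by move=> [y _ <-].
have mh r : measurable (h @^-1` [set r]) by [].
have mi r : measurable_fun setT (fun x => (\1_(h @^-1` [set r]) (phi x))%:E : \bar R).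
  apply/measurable_EFinP; apply: (measurableT_comp _ mphi).
  exact: measurable_indic.
transitivity (\int[m]_x \sum_(r \in range h) (r%:E * ((\1_(h @^-1` [set r]) (phi x))%:E * (w x)%:E))).
  apply: eq_integral => x _; rewrite fimfunE -fsumEFin//.
  rewrite ge0_mule_fsuml => [|r]; last by rewrite lee_fin; exact: nnfun_muleindic_ge0.
  by apply: eq_fsbigr => r _; rewrite EFinM muleA.
have mfw r : measurable_fun setT (fun x => (\1_(h @^-1` [set r]) (phi x))%:E * (w x)%:E).
  by apply: emeasurable_funM => //; exact/measurable_EFinP.
have fw0 r x : 0 <= (\1_(h @^-1` [set r]) (phi x))%:E * (w x)%:E by rewrite mule_ge0// lee_fin// w0.
rewrite ge0_integral_fsum//; last 2 first.
- by move=> r; apply: emeasurable_funM => //; exact: measurable_cst.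
- move=> r x _.
  have [hr|hr] := pselect (range h r); first by rewrite mule_ge0// lee_fin r0.
  rewrite preimage10 ?indic0 ?mul0e ?mule0//.
apply: eq_fsbigr => r /[!in_setE] hr.
rewrite ge0_integralZl//; last by rewrite lee_fin r0.
congr (_ * _); rewrite [RHS]integral_mkcond; apply: eq_integral => x _.
rewrite /patch /= indicE; have -> : (x \in phi @^-1` (h @^-1` [set r])) = (phi x \in h @^-1` [set r]) by [].
by case: ifP => _; rewrite ?mul1e ?mul0e.
Qed.

Lemma approx_weighted f (mf : measurable_fun setT f) : (forall y, 0 <= f y) ->
  (\int[m]_x (((nnsfun_approx measurableT mf n) (phi x))%:E * (w x)%:E) @[n --> \oo]) -->
  \int[m]_x (f (phi x) * (w x)%:E).
Proof.
move=> f0; pose h := nnsfun_approx measurableT mf.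
have fE x : f (phi x) * (w x)%:E = lim (((h n (phi x))%:E * (w x)%:E) @[n --> \oo]).
  have hc : (h n (phi x))%:E @[n --> \oo] --> f (phi x) by exact: cvg_nnsfun_approx.
  by apply/esym/cvg_lim => //; apply: cvgeZr hc.
have -> : \int[m]_x (f (phi x) * (w x)%:E) = \int[m]_x lim (((h n (phi x))%:E * (w x)%:E) @[n --> \oo]).
  by apply: eq_integral => x _.
apply: cvg_monotone_convergence => //.
- move=> n; apply: emeasurable_funM => //; apply/measurable_EFinP => //.
  by apply: (measurableT_comp _ mphi).
- by move=> n x _; rewrite mule_ge0 ?lee_fin.
- move=> x _ a b ab; apply: lee_wpmul2r; rewrite lee_fin//.
  exact/lefP/nd_nnsfun_approx.
Qed.

(** An inequality between measures passes to simple functions, then to nonnegative functions by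
    monotone convergence. *)
Lemma integral_image_weighted_le (P : {measure set Y -> \bar R}) f :
  (forall B, measurable B -> P B <= \int[m]_(x in phi @^-1` B) (w x)%:E) ->
  measurable_fun setT f -> (forall y, 0 <= f y) ->
  \int[P]_y f y <= \int[m]_x (f (phi x) * (w x)%:E).
Proof.
move=> HP mf f0; pose h := nnsfun_approx measurableT mf.
have c1 := approx_weighted mf f0.
have c2 : (\int[P]_y (h n y)%:E @[n --> \oo]) --> \int[P]_y f y.
  have -> : \int[P]_y f y = \int[P]_y lim ((h n y)%:E @[n --> \oo]).
    by apply: eq_integral => y _; apply/esym/cvg_lim => //; exact: cvg_nnsfun_approx.
  apply: cvg_monotone_convergence => //.
  - by move=> n; exact/measurable_EFinP.
  - by move=> n y _; rewrite lee_fin.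
  - by move=> y _ a b ab; rewrite lee_fin; exact/lefP/nd_nnsfun_approx.
apply: (lee_cvg_to c2 c1); near=> n.
 rewrite integral_nnsfun// patch_setT sintegralE integral_nnsfun_weighted.
apply: lee_fsum => // r [y _ <-]; apply: lee_wpmul2l; first by rewrite lee_fin.
exact: HP.
Unshelve. all: by end_near. Qed.

Lemma integral_image_weighted (P : {measure set Y -> \bar R}) f :
  (forall B, measurable B -> P B = \int[m]_(x in phi @^-1` B) (w x)%:E) ->
  measurable_fun setT f -> (forall y, 0 <= f y) ->
  \int[P]_y f y = \int[m]_x (f (phi x) * (w x)%:E).
Proof.
move=> HP mf f0; pose h := nnsfun_approx measurableT mf.
apply: (cvg_unique _ _ (approx_weighted mf f0)) => //.
have c2 : (\int[P]_y (h n y)%:E @[n --> \oo]) --> \int[P]_y f y.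
  have -> : \int[P]_y f y = \int[P]_y lim ((h n y)%:E @[n --> \oo]).
    by apply: eq_integral => y _; apply/esym/cvg_lim => //; exact: cvg_nnsfun_approx.
  apply: cvg_monotone_convergence => //.
  - by move=> n; exact/measurable_EFinP.
  - by move=> n y _; rewrite lee_fin.
  - by move=> y _ a b ab; rewrite lee_fin; exact/lefP/nd_nnsfun_approx.
rewrite (_ : (fun n => _) = (fun n => \int[P]_y (h n y)%:E))//; apply/funext => n.
rewrite integral_nnsfun// patch_setT sintegralE integral_nnsfun_weighted.
by apply: eq_fsbigr => r _; rewrite HP.
Qed.

(** No integrability is involved: as w >= 0, multiplication by w commutes with positive and negative
    parts. *)
Lemma integral_image_weightedT (P : {measure set Y -> \bar R}) f :
  (forall B, measurable B -> P B = \int[m]_(x in phi @^-1` B) (w x)%:E) ->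
  measurable_fun setT f ->
  \int[P]_y f y = \int[m]_x (f (phi x) * (w x)%:E).
Proof.
move=> HP mf; rewrite [LHS]integralE [RHS]integralE.
rewrite !(integral_image_weighted HP)//; [|exact: measurable_funeneg|exact: measurable_funepos].
congr (_ - _); apply: eq_integral => x _.
  by rewrite !funeposE muleC [f _ * _]muleC maxe_pMr ?mule0 ?lee_fin.
by rewrite !funenegE muleC [f _ * _]muleC -muleN maxe_pMr ?mule0 ?lee_fin.
Qed.

End image_weighted.

Section integral_dual_add.
Context d (T : measurableType d) (R : realType) (mu : {measure set T -> \bar R}).
Local Open Scope ereal_scope.

(** The identity (a + b)^+ + a^- = (a + b)^- + a^+ + b has nonnegative terms and can be integrated
    without integrability. Together with a^+ <= (a + b)^+ and a^- <= (a + b)^- + b it settles all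
    cases, +oo prevailing on the right. *)
Lemma integral_add_le_dual (a b : T -> R) : measurable_fun setT a -> measurable_fun setT b ->
  (forall x, 0 <= b x)%R ->
  \int[mu]_x (a x + b x)%:E <= (\int[mu]_x (a x)%:E + \int[mu]_x (b x)%:E)%dE.
Proof.
move=> ma mb b0.
have mea : measurable_fun setT (EFin \o a) by exact/measurable_EFinP.
have meb : measurable_fun setT (EFin \o b) by exact/measurable_EFinP.
have ms : measurable_fun setT (fun x => (a x + b x)%:E).
  by apply/measurable_EFinP; exact: measurable_funD.
have eq : \int[mu]_x ((fun x => (a x + b x)%:E)^\+ x) + \int[mu]_x ((EFin \o a)^\- x) =
    \int[mu]_x ((fun x => (a x + b x)%:E)^\- x) + (\int[mu]_x ((EFin \o a)^\+ x) + \int[mu]_x (b x)%:E).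
  rewrite -!ge0_integralD//; try by [exact: measurable_funepos|exact: measurable_funeneg|move=> x _; rewrite lee_fin].
  - apply: eq_integral => x _; rewrite !funeposE !funenegE /= -!EFin_max -!EFinD -?EFinN -?EFin_max -?EFinD; congr EFin.
    by rewrite /Num.max; do 4!case: ifPn => //; lra.
  - by move=> x _; rewrite adde_ge0// lee_fin.
  - by apply: emeasurable_funD => //; exact: measurable_funepos.
have le1 : \int[mu]_x ((EFin \o a)^\+ x) <= \int[mu]_x ((fun x => (a x + b x)%:E)^\+ x).
  apply: le_ge0_integral => // x _; rewrite !funeposE /= -!EFin_max lee_fin.
  by have := b0 x; rewrite /Num.max; do 2!case: ifPn => //; lra.
have le2 : \int[mu]_x ((EFin \o a)^\- x) <= \int[mu]_x ((fun x => (a x + b x)%:E)^\- x) + \int[mu]_x (b x)%:E.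
  rewrite -ge0_integralD//; [|exact: measurable_funeneg|by move=> x _; rewrite lee_fin].
  apply: le_ge0_integral => // x _; rewrite !funenegE /= -!EFin_max -EFinD lee_fin.
  by have := b0 x; rewrite /Num.max; do 2!case: ifPn => //; lra.
rewrite [leLHS]integralE [X in (X + _)%dE]integralE.
have I1 : 0 <= \int[mu]_x ((fun x => (a x + b x)%:E)^\+ x) by apply: integral_ge0.
have I2 : 0 <= \int[mu]_x ((fun x => (a x + b x)%:E)^\- x) by apply: integral_ge0.
have A1 : 0 <= \int[mu]_x ((EFin \o a)^\+ x) by apply: integral_ge0.
have A2 : 0 <= \int[mu]_x ((EFin \o a)^\- x) by apply: integral_ge0.
have B0 : 0 <= \int[mu]_x (b x)%:E by apply: integral_ge0 => x _; rewrite lee_fin.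
move: (\int[mu]_x ((fun x => (a x + b x)%:E)^\+ x)) (\int[mu]_x ((fun x => (a x + b x)%:E)^\- x))
  (\int[mu]_x ((EFin \o a)^\+ x)) (\int[mu]_x ((EFin \o a)^\- x)) (\int[mu]_x (b x)%:E) I1 I2 A1 A2 B0 eq le1 le2.
move=> [p||] [q||] [r||] [s||] [t||] //= _ _ _ _ _.
- rewrite -!EFinD => -[e] _ _.
  by change ((p - q)%:E <= (r - s + t)%:E); rewrite lee_fin; lra.
- by move=> _ _ _; exact: leey.
- by move=> _ _ _; exact: leNye.
Qed.

End integral_dual_add.

(** * Measures on R^n *)

Lemma open_borel (T : ptopologicalType) (U : set T) : open U -> measurable (U : set (borel T)).
Proof. by move=> oU; exact: sub_sigma_algebra. Qed.

Lemma continuous_borel (T W : ptopologicalType) (f : T -> W) : continuous f ->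
  measurable_fun setT (f : borel T -> borel W).
Proof.
move=> fc; apply: (@measurability _ _ (borel T) (borel W) setT f (@open W)) => //.
move=> _ [U oU <-]; rewrite setTI; apply: open_borel.
by apply: open_comp => // x _; exact: fc.
Qed.

Lemma lower_semicontinuous_borel (T : ptopologicalType) (R : realType) (f : T -> R) :
  (forall x (e : R), 0 < e -> \forall y \near x, f x - e < f y) ->
  measurable_fun setT (f : borel T -> R).
Proof.
move=> fc; apply: (@measurability _ _ (borel T) _ setT f (@RGenOInfty.G R)); first exact: RGenOInfty.measurableE.
move=> _ [_ [a ->] <-]; rewrite setTI; apply: open_borel.
rewrite openE => x /=; rewrite in_itv/= andbT => ax.
have := fc x (f x - a); rewrite subr_gt0 => /(_ ax); apply: filterS => y.
by rewrite opprB addrC subrK /= in_itv/= andbT.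
Qed.

Lemma continuous_borel_real (T : ptopologicalType) (R : realType) (f : T -> R) : continuous f ->
  measurable_fun setT (f : borel T -> R).
Proof.
move=> fc; apply: lower_semicontinuous_borel => x e e0.
have /cvgrPdist_lt/(_ e e0) := fc x; apply: filterS => y.
by rewrite ltr_norml => /andP[_]; lra.
Qed.

(** * Outer regularity of finite Borel measures *)

Section regularity.
Context {R : realType} {n : nat}.
Local Notation V := 'rV[R]_n.
Variable kappa : {measure set (borel V) -> \bar R}.
Hypothesis kfin : (kappa setT < +oo)%E.

Let kle (A : set (borel V)) : measurable A -> (kappa A < +oo)%E.
Proof. by move=> mA; apply: le_lt_trans kfin; apply: le_measure; rewrite ?in_setE. Qed.

(* Two-sided, so as to be stable under complement. *)
Definition inner_outer (B : set V) := forall e : R, 0 < e -> exists U W : set V,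
  [/\ open U, open W, B `<=` U, ~` B `<=` W & (kappa (U `&` W) <= e%:E)%E].

Lemma decreasing_small (F : nat -> set (borel V)) (e : R) : 0 < e ->
  (forall k, measurable (F k)) -> nonincreasing_seq F ->
  (kappa (\bigcap_k F k) < e%:E)%E -> exists k, (kappa (F k) <= e%:E)%E.
Proof.
move=> e0 mF niF H.
have mI : measurable (\bigcap_k F k) by apply: bigcapT_measurable.
have := nonincreasing_cvg_mu (kle (mF 0)) mF mI niF.
move=> /cvg_lim L; apply: contrapT => /forallNP N.
suff : (e%:E <= kappa (\bigcap_k F k))%E by rewrite leNgt H.
rewrite -L//; apply: lime_ge.
  apply: ereal_nonincreasing_is_cvgn => a b ab.
  by apply: le_measure; rewrite ?in_setE//; exact/subsetPset/niF.
by near=> k; rewrite leNgt; apply/negP => /ltW; exact: N.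
Unshelve. all: by end_near. Qed.

(** The complement is covered by its neighbourhoods of radius 1 / (k + 1). Their traces on the open
    set B decrease to the empty set, so one of them has small measure. *)
Lemma inner_outer_open (B : set V) : open B -> inner_outer B.
Proof.
move=> oB e e0; pose W (k : nat) : set V := \bigcup_(y in ~` B) ball y (k.+1%:R^-1 : R).
have oW k : open (W k) by apply: bigcup_open => y _; apply: ball_open.
have [k Hk] : exists k, (kappa (B `&` W k) <= e%:E)%E.
  apply: (@decreasing_small (fun k => B `&` W k)) => //.
  - by move=> k; apply: measurableI; exact: open_borel.
  - move=> a b ab; apply/subsetPset; apply: setIS => x [y By xy]; exists y => //.
    by apply: le_ball xy; rewrite lef_pV2 ?posrE// ler_nat.
  - rewrite (_ : \bigcap_k _ = set0) ?measure0 ?lte_fin//.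
    apply/seteqP; split => // x H; have [Bx _] := H 0%N I.
    have /nbhs_ballP[d /= d0 Hd] : nbhs x B by exact: near_open.
    have [k /= kd] : exists k : nat, k.+1%:R^-1 < d.
      exists (Num.truncn d^-1); rewrite -[ltRHS]invrK ltf_pV2 ?posrE ?invr_gt0//.
      exact: truncnS_gt.
    have [_ [y By xy]] := H k I; apply: By; apply: Hd.
    by apply: ball_sym; apply: le_ball xy; exact: ltW.
exists B, (W k); split=> //.
by move=> x Bx; exists x => //; apply: ballxx; rewrite invr_gt0.
Qed.

Lemma inner_outerC B : inner_outer B -> inner_outer (~` B).
Proof.
move=> H e e0; have [U [W [oU oW BU BW k]]] := H e e0; exists W, U; split=> //.
  by rewrite setCK.
by rewrite setIC.
Qed.

(** The complement of the union lies in the intersection of all the W's, which need not be open;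
    finitely many of them suffice by continuity from above. *)
Lemma inner_outer_bigcup (B : nat -> set V) : (forall k, inner_outer (B k)) ->
  inner_outer (\bigcup_k B k).
Proof.
move=> H e e0; have e20 : 0 < e / 2 / 2 by lra.
have /choice[UW HUW] : forall k, exists UW : set V * set V,
    [/\ open UW.1, open UW.2, B k `<=` UW.1, ~` B k `<=` UW.2 &
      (kappa (UW.1 `&` UW.2) <= (e / 2 / 2 / (2 ^ k.+1)%:R)%:E)%E].
  move=> k; have [|U [W ?]] := H k (e / 2 / 2 / (2 ^ k.+1)%:R).
    by rewrite divr_gt0// ltr0n expn_gt0.
  by exists (U, W).
pose U := \bigcup_k (UW k).1; pose W (k : nat) := \bigcap_(i in `I_k) (UW i).2.
have oU : open U by apply: bigcup_open => k _; have [] := HUW k.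
have oW k : open (W k).
  rewrite /W bigcap_mkord; elim/big_ind: _ => [|A A'|i _]; [exact: openT|exact: openI|].
  by have [] := HUW i.
have [k Hk] : exists k, (kappa (U `&` W k) <= e%:E)%E.
  apply: (@decreasing_small (fun k => U `&` W k)) => //.
  - by move=> k; apply: measurableI; exact: open_borel.
  - move=> a b ab; apply/subsetPset; apply: setIS => x Wx i /= ia; apply: Wx => /=.
    exact: leq_trans ab.
  - apply: (@le_lt_trans _ _ (\sum_(k <oo) kappa ((UW k).1 `&` (UW k).2))%E).
      apply: measure_sigma_subadditive => [k||x Hx].
      + by have [] := HUW k => *; apply: measurableI; exact: open_borel.
      + by apply: bigcapT_measurable => k; apply: measurableI; exact: open_borel.
      + have [[i _ Ux] _] := Hx 0%N I; exists i => //; split=> //.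
        by have [_] := Hx i.+1 I; apply => /=.
    apply: (@le_lt_trans _ _ (e / 2 / 2)%:E); last by rewrite lte_fin; lra.
    apply: le_trans (epsilon_trick0 xpredT (ltW e20)).
    by apply: lee_nneseries => // k _; have [] := HUW k.
exists U, (W k); split=> //.
  by move=> x [i _ Bx]; exists i => //; have [_ _ + _ _] := HUW i; exact.
move=> x Bx i _; have [_ _ _ h _] := HUW i; apply: h => Bi; apply: Bx; by exists i.
Qed.

(** The sets approximated from both sides form a sigma-algebra containing the open sets, hence all
    Borel sets. *)
Lemma outer_regular (B : set (borel V)) (e : R) : measurable B -> 0 < e ->
  exists U : set V, [/\ open U, B `<=` U & (kappa U <= kappa B + e%:E)%E].
Proof.
move=> mB e0.
have : inner_outer B.
  apply: (smallest_sub (C := sigma_algebra setT) _ _ mB); last by move=> U; exact: inner_outer_open.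
  split.
  - by apply: inner_outer_open; exact: open0.
  - by move=> A /inner_outerC; rewrite setTD.
  - exact: inner_outer_bigcup.
move=> /(_ e e0)[U [W [oU oW BU BW k]]]; exists U; split=> //.
have mU := open_borel oU; have mW := open_borel oW.
apply: (@le_trans _ _ (kappa (B `|` (U `&` W)))).
  apply: le_measure; rewrite ?in_setE//; first by apply: measurableU => //; exact: measurableI.
  move=> x Ux; have [Bx|Bx] := pselect (B x); [by left|right; split=> //; exact: BW].
apply: le_trans (measureU2 _ _ _) _ => //; first exact: measurableI.
by rewrite leeD2l.
Qed.

End regularity.

(** * Comparison of measures through dyadic cubes *)

Section cubes.
Context {R : realType} {n : nat}.
Local Notation V := 'rV[R]_n.
Implicit Types (a x z : V) (r : R).

Lemma row_norm_lt x r : 0 < r -> (forall i, `|x 0 i| < r) -> `|x| < r.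
Proof.
move=> r0 H; apply: (@le_lt_trans _ _ (\big[Num.max/0]_i `|x 0 i|)).
  by apply: row_norm_le => [|i]; [exact: bigmax_ge_id|exact: le_bigmax].
by apply/bigmax_lt.
Qed.

(** Half-open on the left, so that the children of a cube tile it without overlap. *)
Definition cube a r : set V := [set x | forall i, a 0 i < x 0 i <= a 0 i + r].

Definition cube_child a r (e : {ffun 'I_n -> bool}) : V := \row_i (a 0 i + (r / 2) *+ e i).

Lemma coord_borel i : measurable_fun setT (fun x : borel V => x 0 i).
Proof.
apply: (@continuous_borel_real V _ (fun x : V => x 0 i)) => x.
exact: (@row_entry_continuous _ _ _ id x i).
Qed.

Lemma cube_measurable a r : measurable (cube a r : set (borel V)).
Proof.
rewrite (_ : cube a r = \bigcap_(i in [set: 'I_n]) ((fun x : V => x 0 i) @^-1` `]a 0 i, a 0 i + r])).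
  apply: fin_bigcap_measurable => // i _; rewrite -[X in measurable X]setTI.
  exact: coord_borel.
by apply/seteqP; split=> x H i; [move=> _ /=; rewrite in_itv/=|have := H i I; rewrite /= in_itv]; exact.
Qed.

Lemma cube_childP a r x : 0 < r -> cube a r x ->
  cube (cube_child a r [ffun i => a 0 i + r / 2 < x 0 i]) (r / 2) x.
Proof.
move=> r0 H i; have := H i; rewrite !mxE ffunE; case: (ltP (a 0 i + r / 2)) => h /andP[h1 h2].
  by rewrite mulr1n; apply/andP; split; lra.
by rewrite mulr0n; apply/andP; split; lra.
Qed.

Lemma cube_child_sub a r e : 0 < r -> cube (cube_child a r e) (r / 2) `<=` cube a r.
Proof.
move=> r0 x H i; have := H i; rewrite !mxE; case: (e i); rewrite ?mulr1n ?mulr0n => /andP[h1 h2];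
 apply/andP; split; lra.
Qed.

Lemma cube_split a r : 0 < r ->
  cube a r = \bigcup_(e in [set: {ffun 'I_n -> bool}]) cube (cube_child a r e) (r / 2).
Proof.
move=> r0; apply/seteqP; split=> [x Hx|x [e _]]; last exact: cube_child_sub.
by exists [ffun i => a 0 i + r / 2 < x 0 i] => //; exact: cube_childP.
Qed.

Lemma cube_children_disjoint a r (F : {ffun 'I_n -> bool} -> set V) :
  (forall e, F e `<=` cube (cube_child a r e) (r / 2)) -> trivIset setT F.
Proof.
move=> FS; apply/trivIsetP => e e' _ _ ee'; apply/seteqP; split=> // x [/FS He /FS He'].
case/eqP: ee'; apply/ffunP => i; have := He i; have := He' i; rewrite !mxE.
by case: (e i); case: (e' i); rewrite ?mulr1n ?mulr0n//; lra.
Qed.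

Lemma measure_cube_split (mu : {measure set (borel V) -> \bar R}) a r : 0 < r ->
  mu (cube a r) = (\sum_(e \in [set: {ffun 'I_n -> bool}]) mu (cube (cube_child a r e) (r / 2)))%E.
Proof.
move=> r0; rewrite {1}cube_split// measure_fin_bigcup//.
- exact: finite_finset.
- by apply: (@cube_children_disjoint a r) => e x.
- by move=> e _; exact: cube_measurable.
Qed.

(** The union of the dyadic subcubes of depth at most k contained in U; it exhausts the part of an
    open U inside the cube as k grows. *)
Fixpoint inner_cubes (U : set V) (k : nat) a r : set V :=
  if `[< cube a r `<=` U >] then cube a r else
  match k with
  | 0 => set0
  | k'.+1 => \bigcup_(e in [set: {ffun 'I_n -> bool}]) inner_cubes U k' (cube_child a r e) (r / 2)
  end.

Lemma inner_cubes_sub U k a r : 0 < r -> inner_cubes U k a r `<=` U `&` cube a r.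
Proof.
elim: k a r => [|k IH] a r r0 /=; case: asboolP => // aU x; do ?by move=> Hx; split => //; exact: aU.
have r20 : 0 < r / 2 by lra.
by move=> [e _ /(IH _ _ r20)[Ux /(cube_child_sub r0)]].
Qed.

Lemma inner_cubes_measurable U k a r : measurable (inner_cubes U k a r : set (borel V)).
Proof.
elim: k a r => [|k IH] a r /=; case: asboolP => _; try exact: cube_measurable.
  exact: measurable0.
by apply: fin_bigcup_measurable => // e _; exact: IH.
Qed.

Lemma inner_cubes_nd U k a r : 0 < r -> inner_cubes U k a r `<=` inner_cubes U k.+1 a r.
Proof.
elim: k a r => [|k IH] a r r0 x; rewrite /= ; case: asboolP => // aU.
move=> [e _ Hx]; exists e => //; have := IH _ _ _ x Hx; rewrite /=; apply; lra.
Qed.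

Lemma inner_cubes_le (mu kappa : {measure set (borel V) -> \bar R}) U k a r : 0 < r ->
  (forall b s, 0 < s -> (mu (cube b s) <= kappa (cube b s))%E) ->
  (mu (inner_cubes U k a r) <= kappa (inner_cubes U k a r))%E.
Proof.
move=> + H; elim: k a r => [|k IH] a r r0 /=; case: asboolP => aU; try exact: H.
  by rewrite !measure0.
have r20 : 0 < r / 2 by lra.
have sub e : inner_cubes U k (cube_child a r e) (r / 2) `<=` cube (cube_child a r e) (r / 2).
  by move=> x /(inner_cubes_sub r20)[].
rewrite !measure_fin_bigcup//; try exact: finite_finset; try exact: (cube_children_disjoint sub);
  try by move=> e _; exact: inner_cubes_measurable.
by apply: lee_fsum => [|e _]; [exact: finite_finset|exact: IH].
Qed.

Lemma cube_dist a r x z : 0 < r -> cube a r x -> cube a r z -> `|z - x| < r.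
Proof.
move=> r0 ax az; apply: row_norm_lt => // i.
by have := ax i; have := az i; rewrite !mxE ltr_norml => /andP[? ?] /andP[? ?]; apply/andP; split; lra.
Qed.

Lemma inner_cubesP U k a r x : 0 < r -> cube a r x ->
  (forall z, `|z - x| < r / 2 ^+ k -> U z) -> inner_cubes U k a r x.
Proof.
elim: k a r => [|k IH] a r r0 ax H /=; case: asboolP => // aU.
  by case: aU => z az; apply: H; rewrite expr0 divr1; exact: cube_dist az.
exists [ffun i => a 0 i + r / 2 < x 0 i] => //; apply: IH; [lra|exact: cube_childP|].
by move=> z; rewrite -mulrA -invfM -exprS; exact: H.
Qed.

Lemma measure_open_cube_le (mu kappa : {measure set (borel V) -> \bar R}) U a r : open U -> 0 < r ->
  (forall b s, 0 < s -> (mu (cube b s) <= kappa (cube b s))%E) ->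
  (mu (U `&` cube a r) <= kappa (U `&` cube a r))%E.
Proof.
move=> oU r0 H.
have UE : U `&` cube a r = \bigcup_k inner_cubes U k a r.
  apply/seteqP; split=> [x [Ux ax]|x [k _ /(inner_cubes_sub r0)]//].
  have /nbhs_normP[d /= d0 Hd] : nbhs x U by exact: near_open.
  have [k kd] : exists k : nat, r / 2 ^+ k < d.
    exists (Num.truncn (r / d)).+1; rewrite ltr_pdivrMr ?exprn_gt0// mulrC -ltr_pdivrMr//.
    apply: lt_trans (truncnS_gt _) _; rewrite -natrX ltr_nat; exact: ltn_expl.
  exists k => //; apply: inner_cubesP => // z zx; apply: Hd; rewrite /= distrC.
  exact: lt_trans kd.
have mI k := inner_cubes_measurable U k a r.
have nd : nondecreasing_seq (fun k => inner_cubes U k a r).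
  by apply/nondecreasing_seqP => k; apply/subsetPset; exact: inner_cubes_nd.
have mU : measurable (\bigcup_k inner_cubes U k a r : set (borel V)) by exact: bigcupT_measurable.
rewrite UE; apply: (lee_cvg_to (nondecreasing_cvg_mu mI mU nd) (nondecreasing_cvg_mu mI mU nd)).
by near=> k; exact: inner_cubes_le.
Unshelve. all: by end_near. Qed.

(** From cubes the inequality passes to open sets by dyadic exhaustion, to Borel subsets of a cube
    by outer regularity of the finite restriction of kappa, and to all Borel sets by increasing
    cubes. *)
Lemma cube_comparison (mu kappa : {measure set (borel V) -> \bar R}) :
  (forall a r, 0 < r -> (kappa (cube a r) < +oo)%E) ->
  (forall a r, 0 < r -> (mu (cube a r) <= kappa (cube a r))%E) ->
  forall B, measurable B -> (mu B <= kappa B)%E.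
Proof.
move=> kfin H B mB.
have step a r : 0 < r -> (mu (B `&` cube a r) <= kappa B)%E.
  move=> r0; have mQ := cube_measurable a r.
  apply: (@le_trans _ _ (kappa (B `&` cube a r))); last first.
    by apply: le_measure; rewrite ?in_setE//; exact: measurableI.
  apply/lee_addgt0Pr => e e0.
  have kf : (mrestr kappa mQ setT < +oo)%E by rewrite /mrestr setTI; exact: kfin.
  have [U [oU BU kU]] := outer_regular kf mB e0.
  have mU := open_borel oU.
  apply: le_trans kU; apply: (@le_trans _ _ (mu (U `&` cube a r))).
    by apply: le_measure; rewrite ?in_setE; [exact: measurableI|exact: measurableI|exact: setSI].
  exact: measure_open_cube_le.
pose Q (k : nat) := cube (const_mx (- k.+1%:R)) (2 * k.+1%:R).
have mBQ k : measurable (B `&` Q k : set (borel V)) by apply: measurableI => //; exact: cube_measurable.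
have BE : B = \bigcup_k (B `&` Q k).
  apply/seteqP; split=> [x Bx|x [k _ []]//].
  exists (Num.truncn `|x|) => //; split=> // i; rewrite !mxE.
  have := coord_le_norm x i; have := truncnS_gt `|x|; rewrite ler_norml => h /andP[h1 h2].
  by apply/andP; split; lra.
have nd : nondecreasing_seq (fun k => B `&` Q k).
  apply/nondecreasing_seqP => k; apply/subsetPset; apply: setIS => x Qx i; have := Qx i; rewrite !mxE.
  by rewrite -[k.+2]addn1 natrD => /andP[h1 h2]; apply/andP; split; lra.
rewrite {1}BE; apply: (cvge_le _ (nondecreasing_cvg_mu mBQ _ nd)).
  by near=> k; apply: step; rewrite mulr_gt0.
by apply: bigcupT_measurable.
Unshelve. all: by end_near. Qed.

End cubes.

(** * Lebesgue measure of linear images *)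

Section linear_image.
Context {R : realType} {n : nat}.
Local Notation V := 'rV[R]_n.
Variable lambda : {measure set (borel V) -> \bar R}.
Hypothesis lambdaE : is_lebesgue lambda.
Implicit Types (a x y : V) (r K : R) (A : 'M[R]_n) (B : set (borel V)).

Definition box (l u : V) : set V := [set x | forall i, l 0 i < x 0 i <= u 0 i].

Lemma box_measurable l u : measurable (box l u : set (borel V)).
Proof.
rewrite (_ : box l u = \bigcap_(i in [set: 'I_n]) ((fun x : V => x 0 i) @^-1` `]l 0 i, u 0 i])).
  apply: fin_bigcap_measurable => // i _; rewrite -[X in measurable X]setTI.
  exact: coord_borel.
by apply/seteqP; split=> x H i; [move=> _ /=; rewrite in_itv/=|have := H i I; rewrite /= in_itv]; exact.
Qed.

Lemma lebesgue_cube a r : 0 < r -> lambda (cube a r) = (r ^+ n)%:E.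
Proof.
move=> r0; have -> : cube a r = box a (a + const_mx r).
  by apply/seteqP; split=> x H i; have := H i; rewrite !mxE.
rewrite lambdaE => [|i]; last by rewrite !mxE lerDl ltW.
congr EFin; rewrite -[in RHS](card_ord n) -prodr_const; apply: eq_bigr => i _.
by rewrite !mxE addrAC subrr add0r.
Qed.

(** For invertible A this is the image of B by x |-> x A, written as a preimage so that
    measurability is immediate. *)
Definition lin_image A B : set (borel V) := [set x | B (x *m invmx A)].

Lemma lin_image_measurable A B : measurable B -> measurable (lin_image A B).
Proof.
move=> mB; rewrite -[X in measurable X]setTI.
by apply: (continuous_borel (@mulmxr_continuous _ _ _ (invmx A))).
Qed.

Lemma lin_imageM A A' B : A \in unitmx -> A' \in unitmx ->
  lin_image (A *m A') B = lin_image A' (lin_image A B).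
Proof. by move=> uA uA'; apply/seteqP; split=> x; rewrite /lin_image /= invmxM// mulmxA. Qed.

(** Only an upper bound on the dilation, which is enough for comparing volumes and multiplies along
    factorizations of A. *)
Definition dilates A K := forall B, measurable B -> (lambda (lin_image A B) <= K%:E * lambda B)%E.

Lemma dilatesM A A' K K' : A \in unitmx -> A' \in unitmx -> 0 <= K' ->
  dilates A K -> dilates A' K' -> dilates (A *m A') (K * K').
Proof.
move=> uA uA' K'0 H H' B mB; rewrite lin_imageM//.
apply: le_trans (H' _ (lin_image_measurable A mB)) _.
rewrite [(K * K')%R]mulrC EFinM -muleA lee_wpmul2l ?lee_fin//; exact: H.
Qed.

(** By [cube_comparison], it is enough to enclose the image of each cube in a box of volume at most
    K r^n. *)
Lemma dilates_boxes A K : 0 <= K ->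
  (forall a r, 0 < r -> exists l u : V, [/\ forall i, l 0 i <= u 0 i,
     lin_image A (cube a r) `<=` box l u & \prod_i (u 0 i - l 0 i) <= K * r ^+ n]) ->
  dilates A K.
Proof.
move=> K0 H B mB.
have mcA : measurable_fun setT ((fun x : V => x *m invmx A) : borel V -> borel V).
  exact: (continuous_borel (@mulmxr_continuous _ _ _ (invmx A))).
have mc (c : R) : measurable_fun setT (fun _ : borel V => c) by exact: measurable_cst.
have [mu muE] := exists_image_weighted lambda mcA (mc 1) (fun=> ler01).
have [ka kaE] := exists_image_weighted lambda (@measurable_id _ _ _) (mc K) (fun=> K0).
have mu' C : measurable C -> mu C = lambda (lin_image A C).
  move=> mC; rewrite muE integral_cst ?mul1e//; exact: lin_image_measurable.
have ka' C : measurable C -> ka C = (K%:E * lambda C)%E.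
  by move=> mC; rewrite kaE integral_cst.
rewrite -mu'// -ka'//; apply: (cube_comparison _ _ mB) => a r r0; have mQ := cube_measurable a r.
  by rewrite ka'// lebesgue_cube// -EFinM ltry.
rewrite mu'// ka'// lebesgue_cube// -EFinM.
have [l [u [lu sub P]]] := H a r r0.
apply: (@le_trans _ _ (lambda (box l u))).
  have mI := lin_image_measurable A mQ; have mb := box_measurable l u.
  exact: (le_measure lambda (mem_set mI) (mem_set mb) sub).
by rewrite lambdaE// lee_fin.
Qed.

Lemma dilates_lim A K : 0 <= K -> (forall e, 0 < e -> dilates A ((1 + e) ^+ n * K)) -> dilates A K.
Proof.
move=> K0 H B mB; have L0 : (0 <= lambda B)%E by [].
case: (lambda B) L0 (fun e e0 => H e e0 B mB) => [b b0 {}H|_ {}H|//]; last first.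
  move: K0; rewrite le_eqVlt => /orP[/eqP K0|K0]; last by rewrite mulry gtr0_sg// mul1e leey.
  by have := H 1 ltr01; rewrite -K0 mulr0.
rewrite -EFinM; have := H 1 ltr01; rewrite -EFinM.
have : (0 <= lambda (lin_image A B))%E by [].
case: (lambda (lin_image A B)) H => [c H _ _|H _|//]; last first.
  by have := H 1 ltr01; rewrite -EFinM.
 rewrite lee_fin leNgt; apply/negP => Kbc.
have cont : {for (0 : R), continuous (fun e : R => (1 + e) ^+ n * (K * b))}.
  apply: continuousM; last exact: cst_continuous.
  apply: (@continuous_comp _ _ _ (fun e : R => 1 + e) (fun x : R => x ^+ n)); last exact: exprn_continuous.
  by apply: continuousD; [exact: cst_continuous|exact: cvg_id].
have : \forall e \near (0 : R), (1 + e) ^+ n * (K * b) < c.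
  by apply: (cvgr_lt _ cont); rewrite addr0 expr1n mul1r.
move=> /nbhs_normP[d /= d0 Hd].
have d20 : 0 < d / 2 by rewrite divr_gt0.
have := H _ d20; rewrite -EFinM -mulrA lee_fin leNgt Hd//= sub0r normrN gtr0_norm//.
by lra.
Qed.

Lemma dilates_perm (s : 'S_n) : dilates (perm_mx s) 1.
Proof.
apply: dilates_boxes => // a r r0; exists (a *m perm_mx s), (a *m perm_mx s + const_mx r).
have E x j : (x *m perm_mx s) 0 j = x 0 ((s^-1)%g j).
  by rewrite -{1}[s]invgK -col_permE mxE.
have vD (u v : V) i : (u + v) 0 i = u 0 i + v 0 i by rewrite mxE.
split.
- by move=> i; rewrite !mxE lerDl ltW.
- move=> x Hx i; have -> : x = (x *m invmx (perm_mx s)) *m perm_mx s by rewrite mulmxKV// unitmx_perm.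
  by move: Hx; rewrite /lin_image /=; move: (x *m _) => y Hy; have := Hy ((s^-1)%g i); rewrite vD !E [const_mx _ _ _]mxE.
- rewrite mul1r -[X in _ <= _ ^+ X](card_ord n) -prodr_const; apply: ler_prod => i _.
  by rewrite !mxE addrAC subrr add0r ltW /=.
Qed.

Lemma dilates_diag (d : V) : (forall i, d 0 i != 0) -> dilates (diag_mx d) (\prod_i `|d 0 i|).
Proof.
move=> d0; have P0 : 0 <= \prod_i `|d 0 i| by apply: prodr_ge0.
have du : diag_mx d \in unitmx by rewrite unitmxE det_diag unitfE; apply/prodf_neq0.
apply: dilates_lim => // e e0; apply: dilates_boxes.
  by rewrite mulr_ge0// exprn_ge0// addr_ge0// ltW.
move=> a r r0.
(* A negative entry exchanges the open and the closed end of the interval; extending it downwards by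
   e r |d_i| restores the inclusion in a half-open box, and e tends to 0 afterwards. *)
pose l := \row_i (if 0 < d 0 i then a 0 i * d 0 i else (a 0 i + r) * d 0 i - e * (r * `|d 0 i|)).
exists l, (l + \row_i ((1 + e) * (r * `|d 0 i|))).
have rd i : 0 < r * `|d 0 i| by rewrite mulr_gt0// normr_gt0.
split.
- by move=> i; rewrite !mxE lerDl mulr_ge0 ?ltW// addr_gt0.
- move=> x Hx i; have -> : x = (x *m invmx (diag_mx d)) *m diag_mx d by rewrite mulmxKV.
  move: Hx; rewrite /lin_image /=; move: (x *m _) => y Hy; have := Hy i; have := rd i; have := d0 i.
  rewrite mul_mx_diag !mxE; move: (a 0 i) (y 0 i) (d 0 i) => ai yi di di0 h /andP[h1 h2].
  case: ifPn => [dp|]; first by rewrite gtr0_norm// in h *; apply/andP; split; nra.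
  rewrite -leNgt => dn; have {}dn : di < 0 by rewrite lt_neqAle di0.
  by rewrite ltr0_norm// in h *; apply/andP; split; nra.
- rewrite mulrAC -exprMn -[X in _ ^+ X * _](card_ord n) -prodr_const -big_split /=.
  apply: ler_prod => i _; rewrite [X in X - _]mxE [X in _ + X - _]mxE addrAC subrr add0r mulrA lexx andbT.
  by rewrite -mulrA mulr_ge0 ?ltW// addr_gt0.
Qed.

(** For x in the cube, x A - a A differs from x - a by at most e r in each coordinate, so the image
    fits in a cube enlarged by e r on both sides. *)
Lemma dilates_near1 A (e : R) : A \in unitmx -> 0 <= e ->
  \sum_i \sum_j `|(A - 1%:M) i j| <= e -> dilates A ((1 + (e + e)) ^+ n).
Proof.
move=> uA e0 Ne; apply: dilates_boxes; first by rewrite exprn_ge0// !addr_ge0.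
move=> a r r0; have er : 0 <= e * r by rewrite mulr_ge0// ltW.
have vD (u v : V) i : (u + v) 0 i = u 0 i + v 0 i by rewrite mxE.
have vN (u : V) i : (- u) 0 i = - u 0 i by rewrite mxE.
have vc (k : R) i : (const_mx k : V) 0 i = k by rewrite mxE.
exists (a *m A - const_mx (e * r)), (a *m A + const_mx (r + e * r)); split.
- by move=> i; rewrite !(vD, vN, vc); lra.
- move=> x Hx i; have -> : x = (x *m invmx A) *m A by rewrite mulmxKV.
  move: Hx; rewrite /lin_image /=; move: (x *m _) => y Hy.
  have dN : `|(y - a) *m (A - 1%:M)| <= e * r.
    apply: le_trans (mulmxr_norm_le _ _) _; apply: ler_pM => //; first by do 2!(apply: sumr_ge0 => ? _).
    apply: row_norm_le => [|k]; first exact: ltW.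
    by have := Hy k; rewrite !mxE => /andP[h1 h2]; rewrite ler_norml; apply/andP; split; lra.
  have := coord_le_norm ((y - a) *m (A - 1%:M)) i => /le_trans/(_ dN).
  rewrite mulmxBr mulmx1 mulmxBl; have := Hy i.
  rewrite !(vD, vN, vc).
  move: ((y *m A) 0 i) ((a *m A) 0 i) => p q /andP[h1 h2]; rewrite ler_norml => /andP[h3 h4].
  by apply/andP; split; lra.
- rewrite -exprMn -[X in _ <= _ ^+ X](card_ord n) -prodr_const; apply: ler_prod => i _.
  rewrite !(vD, vN, vc).
  by apply/andP; split; lra.
Qed.

(* Conjugating by diag(t^(sg i)) with t -> 0 makes a triangular unipotent matrix close to 1. *)
Lemma dilates_unipotent A (sg : 'I_n -> nat) : A \in unitmx -> (forall i, A i i = 1) ->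
  (forall i j, i != j -> A i j != 0 -> (sg j < sg i)%N) -> dilates A 1.
Proof.
move=> uA A1 Asg; apply: dilates_lim => // e e0; rewrite mulr1.
set N := \sum_i \sum_j `|(A - 1%:M) i j|.
have N0 : 0 <= N by do 2!(apply: sumr_ge0 => ? _).
pose t := Num.min 1 (e / 2 / (N + 1)).
have t0 : 0 < t by rewrite lt_min ltr01 !divr_gt0// ltr_wpDl.
have t1 : t <= 1 by rewrite ge_min lexx.
have tN : t * N <= e / 2.
  apply: (@le_trans _ _ (e / 2 / (N + 1) * N)); first by rewrite ler_wpM2r// ge_min lexx orbT.
  by rewrite -mulrA ger_pMr ?divr_gt0// mulrC ler_pdivrMr ?ltr_wpDl// mul1r lerDl.
pose D : 'M[R]_n := diag_mx (\row_i t ^+ sg i); pose D' : 'M[R]_n := diag_mx (\row_i (t ^+ sg i)^-1).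
have tp i : t ^+ sg i != 0 by rewrite expf_neq0// gt_eqF.
have DD' : D *m D' = 1%:M.
  rewrite mulmx_diag; apply/matrixP => i j; rewrite !mxE; case: eqP => [->|//]; rewrite ?mulr1n ?mulr0n// divff//.
have [uD uD'] := mulmx1_unit DD'.
have D'D : D' *m D = 1%:M by apply: mulmx1C.
pose M := D *m A *m D'.
have AE : A = D' *m M *m D by rewrite /M !mulmxA D'D mul1mx -mulmxA D'D mulmx1.
have uM : M \in unitmx by rewrite !unitmx_mul uD uA.
(* Conjugation multiplies the entry (i, j) by t^(sg i - sg j), which is at most t on nonzero
   off-diagonal entries since sg j < sg i. *)
have Me i j : (M - 1%:M) i j = t ^+ sg i * (A - 1%:M) i j * (t ^+ sg j)^-1.
  rewrite (_ : M - 1%:M = D *m (A - 1%:M) *m D'); last by rewrite mulmxBr mulmx1 mulmxBl DD'.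
  by rewrite mul_mx_diag mxE mul_diag_mx !mxE.
have MN : \sum_i \sum_j `|(M - 1%:M) i j| <= e / 2.
  apply: le_trans tN; rewrite mulr_sumr; apply: ler_sum => i _; rewrite mulr_sumr; apply: ler_sum => j _.
  rewrite Me; have [->|ij] := eqVneq i j; first by rewrite !mxE A1 eqxx subrr mulr0 mul0r normr0 mulr0.
  have -> : (A - 1%:M) i j = A i j by rewrite !mxE (negbTE ij) subr0.
  have [->|Aij] := eqVneq (A i j) 0; first by rewrite mulr0 mul0r normr0 mulr0.
  have sij := Asg i j ij Aij.
  rewrite !normrM normfV !(ger0_norm (exprn_ge0 _ (ltW t0))) mulrAC ler_wpM2r//.
  rewrite ler_pdivrMr ?exprn_gt0// -exprS.
  by apply: ler_wiXn2l => //; exact: ltW.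
have e20 : 0 <= e / 2 by lra.
have dM := dilates_near1 uM e20 MN.
have p1 : dilates D' (\prod_i `|(\row_i (t ^+ sg i)^-1 : V) 0 i|).
  by apply: dilates_diag => i; rewrite mxE invr_neq0.
have p2 : dilates D (\prod_i `|(\row_i t ^+ sg i : V) 0 i|).
  by apply: dilates_diag => i; rewrite mxE.
have e2 : e / 2 + e / 2 = e by lra.
have f1 : 0 <= (1 + (e / 2 + e / 2)) ^+ n by rewrite e2 exprn_ge0// addr_ge0// ltW.
have := dilatesM _ _ _ (dilatesM uD' uM f1 p1 dM) p2; rewrite -AE e2.
have -> : \prod_i `|(\row_i (t ^+ sg i)^-1 : V) 0 i| * (1 + e) ^+ n * \prod_i `|(\row_i t ^+ sg i : V) 0 i| = (1 + e) ^+ n.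
  rewrite mulrAC -big_split /= big1 ?mul1r// => i _.
  by rewrite !mxE -normrM mulVf// normr1.
apply=> //; first by rewrite unitmx_mul uD'.
by apply: prodr_ge0.
Qed.

End linear_image.

(** From the LUP decomposition P A = L U, with U = D U' and D the diagonal of U. The permutation and
    the unipotent factors L and U' have factor 1, and D contributes |det U| = |det A|. *)
Lemma dilates_det {R : realType} {n : nat} (lambda : {measure set (borel 'rV[R]_n.+1) -> \bar R}) (A : 'M[R]_n.+1) :
  is_lebesgue lambda -> A \in unitmx -> dilates lambda A `|\det A|.
Proof.
move=> lam uA.
have := cormen_lup_correct A; have := cormen_lup_perm A; have := cormen_lup_detL A.
have := @cormen_lup_lower _ _ A; have := @cormen_lup_upper _ _ A.
case: (cormen_lup A) => [[P L] U] /= UU LL detL /is_perm_mxP[s Ps] PA.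
have uP : P \in unitmx by rewrite Ps unitmx_perm.
have uL : L \in unitmx by rewrite unitmxE detL unitr1.
have PALU : P *m A = L *m U by [].
have uU : U \in unitmx.
  have : L *m U \in unitmx by rewrite -PALU unitmx_mul uP.
  by rewrite unitmx_mul => /andP[].
have detU : \det U = \prod_i U i i.
  rewrite -det_tr det_trig; first by apply: eq_bigr => i _; rewrite mxE.
  by apply/is_trig_mxP => i j ij; rewrite mxE UU.
have Ui i : U i i != 0.
  move: uU; rewrite unitmxE unitfE detU => /prodf_neq0; exact.
pose D : 'M[R]_n.+1 := diag_mx (\row_i U i i).
pose U' : 'M[R]_n.+1 := \matrix_(i, j) ((U i i)^-1 * U i j).
have UE : U = D *m U'.
  by apply/matrixP => i j; rewrite mul_diag_mx !mxE mulVKf.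
have [uD uU'] : D \in unitmx /\ U' \in unitmx by apply/andP; rewrite -unitmx_mul -UE.
have dL : dilates lambda L 1.
  apply: (dilates_unipotent lam (sg := fun i => nat_of_ord i) uL) => [i|i j ij].
    by rewrite LL// eqxx.
  by apply: contraR; rewrite -leqNgt => ji; rewrite LL// (negbTE ij).
have dU' : dilates lambda U' 1.
  apply: (dilates_unipotent lam (sg := fun i => (n - i)%N) uU') => [i|i j ij].
    by rewrite mxE mulVf.
  rewrite mxE mulf_eq0 invr_eq0 (negbTE (Ui i)) /=; apply: contraR; rewrite -leqNgt => ji.
  apply/eqP/UU; rewrite ltn_neqAle eq_sym ij /=.
  by move: ji; rewrite leq_sub2lE// -ltnS.
have dD : dilates lambda D (\prod_i `|(\row_i U i i : 'rV[R]_n.+1) 0 i|).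
  by apply: dilates_diag => // i; rewrite mxE.
have AE : A = perm_mx (s^-1)%g *m L *m (D *m U').
  by rewrite -mulmxA -UE -PALU Ps mulmxA -perm_mxM mulVg perm_mx1 mul1mx.
have uP' : (perm_mx (s^-1)%g : 'M[R]_n.+1) \in unitmx by rewrite unitmx_perm.
have p0 : 0 <= \prod_i `|(\row_i U i i : 'rV[R]_n.+1) 0 i| by apply: prodr_ge0.
have uPL : perm_mx (s^-1)%g *m L \in unitmx by rewrite unitmx_mul uP'.
have uDU : D *m U' \in unitmx by rewrite unitmx_mul uD.
have := dilatesM uPL uDU _ (dilatesM uP' uL ler01 (dilates_perm lam (s^-1)%g) dL) (dilatesM uD uU' ler01 dD dU').
rewrite -AE !mul1r mulr1 => /(_ p0).
suff -> : `|\det A| = \prod_i `|(\row_i U i i : 'rV[R]_n.+1) 0 i| by [].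
have dP : `|\det P| = 1 by rewrite Ps det_perm normrX normrN1 expr1n.
have -> : `|\det A| = `|\det P| * `|\det A| by rewrite dP mul1r.
rewrite -normrM -det_mulmx PALU det_mulmx detL mul1r detU normr_prod.
by apply: eq_bigr => i _; rewrite mxE.
Qed.

(** * Volume comparison *)

Lemma le_integral_in d (T : measurableType d) (R : realType) (mu : {measure set T -> \bar R})
    (D : set T) (f g : T -> \bar R) : (forall x, D x -> (f x <= g x)%E) ->
  (\int[mu]_(x in D) f x <= \int[mu]_(x in D) g x)%E.
Proof.
move=> fg; rewrite [leLHS]integral_mkcond [leRHS]integral_mkcond.
by apply: le_integralT => x; rewrite /patch; case: ifP => // /[!in_setE]; exact: fg.
Qed.

Lemma exists_image_measure d d' (X : measurableType d) (Y : measurableType d') (R : realType)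
    (m : {measure set X -> \bar R}) (phi : X -> Y) : measurable_fun setT phi ->
  exists P : {measure set Y -> \bar R}, forall B, measurable B -> P B = m (phi @^-1` B).
Proof.
move=> mphi; have m1 : measurable_fun setT (fun _ : X => (1 : R)) by exact: measurable_cst.
have [P PE] := exists_image_weighted m mphi m1 (fun=> ler01); exists P => B mB.
have mB' : measurable (phi @^-1` B) by rewrite -[X in measurable X]setTI; exact: mphi.
by rewrite PE integral_cst ?mul1e.
Qed.

Section volume_comparison.
Context {R : realType} {n : nat}.
Local Notation V := 'rV[R]_n.+1.
Variable lambda : {measure set (borel V) -> \bar R}.
Hypothesis lambdaE : is_lebesgue lambda.
Variable M : riemannianManifold R n.+1.
Variable vol : {measure set (borel M) -> \bar R}.
Hypothesis volE : is_riemannian_volume lambda vol.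
Variables (Phi : M -> V) (Psi : V -> M).
Hypothesis PhiK : cancel Phi Psi.
Hypothesis PsiK : cancel Psi Phi.
Hypothesis Phic : continuous Phi.
Hypothesis Psic : continuous Psi.
Variable J : V -> R.
Hypothesis J0 : forall y, 0 <= J y.
Hypothesis Jlsc : forall y (e : R), 0 < e -> \forall z \near y, J y - e < J z.
Hypothesis Jbnd : forall a r, exists C, forall z, cube a r z -> J z <= C.
Hypothesis loc : forall y, exists (i : chart M) (A : 'M[R]_n.+1),
  [/\ dom i (Psi y), A \in unitmx,
      forall e : R, 0 < e -> \forall z \near y,
        `|coord i (Psi z) - coord i (Psi y) - (z - y) *m A| <= e * `|z - y| &
      Num.sqrt (\det (metric i (coord i (Psi y)))) * `|\det A| <= J y].

Lemma metric_density_continuous i p : cod i p ->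
  {for p, continuous (fun p => Num.sqrt (\det (@metric _ _ M i p)))}.
Proof.
move=> ip; apply: continuous_comp; last exact: sqrt_continuous.
have c k l : {for p, continuous (fun p => @metric _ _ M i p k l)}.
  exact: smooth_continuous (metric_smooth _ _ _) ip.
apply: continuous_bigsum => s; apply: continuousM; first exact: cst_continuous.
exact: continuous_bigprod.
Qed.

(** The left-hand side gathers the errors of the local volume estimate, oscillation of the density
    and enlargement of the cube; it tends to f d < e as eta tends to 0. *)
Lemma choose_eps (f d K e : R) : 0 <= d -> f * d < e ->
  exists2 eta : R, 0 < eta & (f + eta) * d * (1 + 2 * (K * eta)) ^+ n.+1 <= e.
Proof.
move=> d0 fde.
have cont : {for (0 : R), continuous (fun eta : R => (f + eta) * d * (1 + 2 * (K * eta)) ^+ n.+1)}.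
  apply: continuousM.
    apply: continuousM; last exact: cst_continuous.
    by apply: continuousD; [exact: cst_continuous|exact: cvg_id].
  apply: (@continuous_comp _ _ _ (fun eta : R => 1 + 2 * (K * eta)) (fun x : R => x ^+ n.+1)); last exact: exprn_continuous.
  apply: continuousD; first exact: cst_continuous.
  by do 2!(apply: continuousM; first exact: cst_continuous); exact: cvg_id.
have : \forall eta \near (0 : R), (f + eta) * d * (1 + 2 * (K * eta)) ^+ n.+1 < e.
  by apply: (cvgr_lt _ cont); rewrite !mulr0 !addr0 expr1n mulr1.
move=> /nbhs_normP[t /= t0 Ht]; exists (t / 2); first by rewrite divr_gt0.
apply/ltW/Ht; rewrite /= sub0r normrN gtr0_norm ?divr_gt0//; lra.
Qed.

(** Near y, the chart image of a small cube lies in the image by A of a slightly larger cube, on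
    which the Riemannian density is almost its value at y; the volume is then at most density times
    |det A| times r^n, up to e. The point y need not belong to the cube, only be within r of its
    points. *)
Lemma volume_local y (e : R) : 0 < e -> exists2 d : R, 0 < d & forall a r, 0 < r -> r < d ->
  (forall z, cube a r z -> `|z - y| <= r) ->
  (vol (Phi @^-1` cube a r) <= ((J y + e) * r ^+ n.+1)%:E)%E.
Proof.
move=> e0; have [i [A [iy uA est JA]]] := loc y.
set q := coord i (Psi y) in est JA; pose psi z := coord i (Psi z).
pose f p := Num.sqrt (\det (@metric _ _ M i p)).
pose K : R := \sum_k \sum_l `|invmx A k l|.
have K0 : 0 <= K by do 2!(apply: sumr_ge0 => ? _).
have [|eta eta0 Heta] := @choose_eps (f q) `|\det A| K (J y + e) (normr_ge0 _).
  by apply: le_lt_trans JA _; rewrite ltrDl.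
have psic : {for y, continuous psi}.
  by apply: continuous_comp; [exact: Psic|exact: coord_continuous].
have near_f : \forall z \near y, f (psi z) <= f q + eta.
  have fc : {for q, continuous f} by apply: metric_density_continuous; exact: cod_dom.
  have : {for y, continuous (f \o psi)} by apply: continuous_comp.
  move=> /cvgrPdist_le/(_ eta eta0); apply: filterS => z /=.
  by rewrite ler_distlC => /andP[_].
have near_i : \forall z \near y, dom i (Psi z) by apply: near_dom => //; exact: Psic.
have : \forall z \near y, `|coord i (Psi z) - q - (z - y) *m A| <= eta * `|z - y| /\
    (f (psi z) <= f q + eta /\ dom i (Psi z)).
  by apply: filterI; [exact: est|exact: filterI].
move=> /nbhs_normP[d /= d0 Hd]; exists d => // a r r0 rd ay.
have Hz z : cube a r z -> [/\ `|psi z - q - (z - y) *m A| <= eta * r, f (psi z) <= f q + eta & dom i (Psi z)].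
  move=> az; have zy := ay z az.
  have [|h1 [h2 h3]] := Hd z; first by rewrite /= distrC (le_lt_trans zy).
  by split=> //; apply: le_trans h1 _; rewrite ler_wpM2l// ltW.
have mQ := cube_measurable a r.
have mP : measurable (Phi @^-1` cube a r : set (borel M)).
  by rewrite -[X in measurable X]setTI; apply: (continuous_borel Phic).
rewrite (@volE i _ mP); last by move=> x /= ax; have [_ _] := Hz _ ax; rewrite PhiK.
pose s := r * (1 + 2 * (K * eta)).
have Ke : 0 <= K * eta by rewrite mulr_ge0// ltW.
have s0 : 0 < s by rewrite mulr_gt0// ltr_wpDr// mulr_ge0.
(* Solving the expansion for z - y gives p A^-1 = w A^-1 + (z - y) + q A^-1 with an error w A^-1 of
   size K eta r. So b is the translated corner of the cube, moved back by that error. *)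
pose b : V := a - const_mx (K * eta * r) - y + q *m invmx A.
have sub p : (coord i @` (Phi @^-1` cube a r)) p -> lin_image A (cube b s) p /\ f p <= f q + eta.
  move=> [x ax <-]; have [h1 h2 h3] := Hz _ ax; move: h1 h2 h3; rewrite /psi PhiK => h1 h2 _; split=> //.
  move: ax h1; rewrite /=; set z := Phi x; set p' := coord i x => az h1 k.
  set w := p' - q - (z - y) *m A in h1.
  have -> : p' *m invmx A = w *m invmx A + (z - y) + q *m invmx A.
    by rewrite -[X in _ + X + _](mulmxK uA) -!mulmxDl /w !subrK.
  have hw : `|(w *m invmx A) 0 k| <= K * eta * r.
    apply: le_trans (coord_le_norm _ _) _; apply: le_trans (mulmxr_norm_le _ _) _.
    by rewrite -mulrA ler_wpM2l.
  have := az k; move: hw; rewrite /b /s !mxE; set u := (\sum_j _); set v := (\sum_j _).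
  rewrite ler_norml => /andP[h3 h4] /andP[h5 h6].
  by apply/andP; split; nra.
apply: (@le_trans _ _ (\int[lambda]_(p in lin_image A (cube b s)) (f q + eta)%:E)%E).
  rewrite [leLHS]integral_mkcond [leRHS]integral_mkcond; apply: le_integralT => p.
  rewrite /patch; case: ifPn => [|_].
    by rewrite in_setE => /sub[h1 h2]; rewrite mem_set// lee_fin.
  by case: ifPn => // _; rewrite lee_fin addr_ge0// ?sqrtr_ge0// ltW.
rewrite integral_cst; last by apply: lin_image_measurable; exact: cube_measurable.
have fe0 : 0 <= f q + eta by rewrite addr_ge0 ?sqrtr_ge0// ltW.
apply: (@le_trans _ _ ((f q + eta)%:E * (`|\det A|%:E * lambda (cube b s)))%E).
  by apply: lee_wpmul2l; [rewrite lee_fin|apply: dilates_det => //; exact: cube_measurable].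
rewrite lebesgue_cube// -!EFinM lee_fin /s exprMn.
have -> : (f q + eta) * (`|\det A| * (r ^+ n.+1 * (1 + 2 * (K * eta)) ^+ n.+1)) =
    (f q + eta) * `|\det A| * (1 + 2 * (K * eta)) ^+ n.+1 * r ^+ n.+1.
  by move: (r ^+ n.+1) ((1 + 2 * (K * eta)) ^+ n.+1) => P1 P2; ring.
by rewrite ler_wpM2r// exprn_ge0// ltW.
Qed.

Let mJ : measurable_fun setT (J : borel V -> R).
Proof. exact: lower_semicontinuous_borel. Qed.

(* A cube violating the bound has a violating child; the nested cubes shrink to a point, where
   volume_local is contradicted. *)
Lemma volume_cube a r (e : R) : 0 < r -> 0 < e ->
  (vol (Phi @^-1` cube a r) <= \int[lambda]_(y in cube a r) (J y)%:E + (e * r ^+ n.+1)%:E)%E.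
Proof.
move=> r0 e0; rewrite leNgt; apply/negP => bad0.
have mPhi : measurable_fun setT (Phi : borel M -> borel V) by exact: continuous_borel.
have [nu nuE] := exists_image_measure vol mPhi.
have [ka kaE] := exists_image_weighted lambda (@measurable_id _ _ _) mJ J0.
have nu' b s : nu (cube b s) = vol (Phi @^-1` cube b s).
  by rewrite nuE//; exact: cube_measurable.
pose Bad b s := (ka (cube b s) + (e * s ^+ n.+1)%:E < nu (cube b s))%E.
have child b s : 0 < s -> Bad b s -> exists e', Bad (cube_child b s e') (s / 2).
  move=> s0; rewrite /Bad ltNge => /negP H; apply: contrapT => /forallNP N; apply: H.
  have le e' : (nu (cube (cube_child b s e') (s / 2)) <= ka (cube (cube_child b s e') (s / 2)) + (e * (s / 2) ^+ n.+1)%:E)%E.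
    by rewrite leNgt; apply/negP; exact: N.
  have s20 : 0 < s / 2 by rewrite divr_gt0.
  have -> : (e * s ^+ n.+1)%:E = (e%:E * lambda (cube b s))%E by rewrite lebesgue_cube.
  rewrite !(@measure_cube_split _ _ _ b s)// ge0_mule_fsumr// -fsbig_split//=.
  apply: lee_fsum => [|e' _]; first exact: finite_finset.
  by have := le e'; rewrite EFinM (lebesgue_cube lambdaE _ s20).
have /choice[F HF] : forall bs : V * R, exists b, 0 < bs.2 -> Bad bs.1 bs.2 ->
    (exists e', b = cube_child bs.1 bs.2 e') /\ Bad b (bs.2 / 2).
  move=> [b s] /=; have [[s0 B]|N] := pselect (0 < s /\ Bad b s); last by exists b => s0 B; case: N.
  by have [e' He'] := child b s s0 B; exists (cube_child b s e') => _ _; split=> //; exists e'.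
pose st := fix st (k : nat) : V * R := if k is k'.+1 then (F (st k'), (st k').2 / 2) else (a, r).
have stP k : 0 < (st k).2 /\ Bad (st k).1 (st k).2.
  elim: k => [|k [s0 B]] /=; first by split=> //; rewrite /Bad nu' kaE.
  by split; [rewrite divr_gt0|have [] := HF (st k) s0 B].
have st_child k i : (st k).1 0 i <= (st k.+1).1 0 i /\
    (st k.+1).1 0 i + (st k.+1).2 <= (st k).1 0 i + (st k).2.
  have [s0 B] := stP k; have [[e' He'] _] := HF (st k) s0 B; rewrite /= He' !mxE.
  by case: (e' i); rewrite ?mulr1n ?mulr0n; split; lra.
have st_nd k l i : (k <= l)%N -> (st k).1 0 i <= (st l).1 0 i /\
    (st l).1 0 i + (st l).2 <= (st k).1 0 i + (st k).2.
  move=> /subnKC <-; elim: (l - k)%N => [|m [h1 h2]]; first by rewrite addn0.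
  by rewrite addnS; have [h3 h4] := st_child (k + m)%N i; split; [exact: le_trans h3|exact: le_trans h2].
have st_le k l i : (st k).1 0 i <= (st l).1 0 i + (st l).2.
  have [kl|lk] := leqP k l.
    by apply: le_trans (st_nd _ _ i kl).1 _; rewrite lerDl ltW//; exact: (stP l).1.
  by apply: le_trans (st_nd _ _ i (ltnW lk)).2; rewrite lerDl ltW//; exact: (stP k).1.
(* The common limit of the corners. It lies in the closures of the nested half-open cubes, possibly
   outside the cubes themselves. *)
pose y : V := \row_i sup (range (fun k => (st k).1 0 i)).
have y_st k i : (st k).1 0 i <= y 0 i <= (st k).1 0 i + (st k).2.
  rewrite mxE; apply/andP; split.
    apply: ub_le_sup; last by exists k.
    by exists ((st 0).1 0 i + (st 0).2) => _ [l _ <-]; exact: st_le.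
  by apply: ge_sup; [exists ((st 0).1 0 i); exists 0%N|move=> _ [l _ <-]; exact: st_le].
(* The local volume bound J(y) + e / 4 and the lower semicontinuity bound J >= J(y) - e / 4 differ
   by e / 2, less than the allowed e. *)
have e40 : 0 < e / 4 by rewrite divr_gt0.
have [d d0 Hd] := volume_local y e40.
have /nbhs_normP[d' /= d'0 Hd'] := Jlsc y e40.
have st2 k : (st k).2 = r / 2 ^+ k.
  by elim: k => [|k IH] /=; [rewrite expr0 divr1|rewrite IH exprS invfM mulrA mulrAC].
have [k kd] : exists k : nat, r / 2 ^+ k < Num.min d d'.
  have m0 : 0 < Num.min d d' by rewrite lt_min d0.
  exists (Num.truncn (r / Num.min d d')).+1; rewrite ltr_pdivrMr ?exprn_gt0// mulrC -ltr_pdivrMr//.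
  apply: lt_trans (truncnS_gt _) _; rewrite -natrX ltr_nat; exact: ltn_expl.
move: kd; rewrite -st2 lt_min => /andP[kd kd'].
have [s0 B] := stP k; move: B; rewrite /Bad.
set b := (st k).1; set s := (st k).2 in kd kd' s0 *; move=> B.
have zy z : cube b s z -> `|z - y| <= s.
  move=> bz; apply: row_norm_le => [|i]; first exact: ltW.
  have := bz i; have := y_st k i; rewrite !mxE -/b -/s ler_norml => /andP[h1 h2] /andP[h3 h4].
  by apply/andP; split; lra.
move: B; apply/negP; rewrite -leNgt nu'; apply: le_trans (Hd b s s0 kd zy) _.
apply: (@le_trans _ _ (((J y - e / 4) * s ^+ n.+1)%:E + (e * s ^+ n.+1)%:E)%E).
  rewrite -EFinD lee_fin -mulrDl ler_wpM2r ?exprn_ge0 ?(ltW s0)//; lra.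
rewrite leeD2r// kaE; apply: (@le_trans _ _ (\int[lambda]_(z in cube b s) (J y - e / 4)%:E)%E).
  by rewrite integral_cst ?lebesgue_cube -?EFinM//; exact: cube_measurable.
apply: le_integral_in => z bz; rewrite lee_fin; apply/ltW/Hd' => /=.
by rewrite distrC; apply: le_lt_trans kd'; exact: zy.
Qed.

Lemma volume_comparison (B : set (borel V)) : measurable B ->
  (vol (Phi @^-1` B) <= \int[lambda]_(y in B) (J y)%:E)%E.
Proof.
move=> mB; have mPhi : measurable_fun setT (Phi : borel M -> borel V) by exact: continuous_borel.
have [nu nuE] := exists_image_measure vol mPhi.
have [ka kaE] := exists_image_weighted lambda (@measurable_id _ _ _) mJ J0.
rewrite -nuE// -[leRHS]kaE; apply: cube_comparison mB => a r r0; have mQ := cube_measurable a r.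
  have [C HC] := Jbnd a r; rewrite kaE.
  apply: (@le_lt_trans _ _ (\int[lambda]_(z in cube a r) C%:E)%E).
    by apply: le_integral_in => z az; rewrite lee_fin; exact: HC.
  by rewrite integral_cst// lebesgue_cube// -EFinM ltry.
apply/lee_addgt0Pr => e e0; rewrite nuE// kaE.
have := @volume_cube a r (e / r ^+ n.+1) r0; rewrite divfK ?gt_eqF ?exprn_gt0//; apply.
by rewrite divr_gt0// exprn_gt0.
Qed.

End volume_comparison.

(** * Transport of the inequality *)

Lemma measurable_integral_snd d1 d2 (T1 : measurableType d1) (T2 : measurableType d2)
    (R : realType) (m2 : {sigma_finite_measure set T2 -> \bar R}) (f : T1 * T2 -> \bar R) :
  measurable_fun setT f -> measurable_fun setT (fun x => \int[m2]_y f (x, y))%E.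
Proof.
move=> mf; rewrite (_ : (fun x => _) = (fun x => \int[m2]_y f^\+ (x, y) - \int[m2]_y f^\- (x, y))%E).
  apply: emeasurable_funB.
    by apply: (measurable_fun_fubini_tonelli_F (m2 := m2) f^\+%E) => //; exact: measurable_funepos.
  by apply: (measurable_fun_fubini_tonelli_F (m2 := m2) f^\-%E) => //; exact: measurable_funeneg.
by apply/funext => x; rewrite [LHS]integralE; congr (_ - _)%E; apply: eq_integral => y _; rewrite ?funeposE ?funenegE.
Qed.

(** Integrability is not assumed: a factor c > 0 scales both parts of the integral, and infinite
    values are treated separately. *)
Lemma integralZl_nneg d (T : measurableType d) (R : realType) (mu : {measure set T -> \bar R})
    (c : R) (f : T -> \bar R) : measurable_fun setT f -> 0 <= c ->
  (\int[mu]_x (c%:E * f x) = c%:E * \int[mu]_x f x)%E.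
Proof.
rewrite le_eqVlt => mf /predU1P[<-|c0].
  by rewrite mul0e; under eq_integral do rewrite mul0e; rewrite integral0.
have cE (g : T -> \bar R) : measurable_fun setT g -> (forall x, 0 <= g x)%E ->
    (\int[mu]_x (c%:E * g x) = c%:E * \int[mu]_x g x)%E.
  by move=> mg g0; rewrite ge0_integralZl_EFin// ltW.
rewrite [LHS]integralE [X in (_ * X)%E]integralE.
have -> : (fun x => c%:E * f x)^\+%E = (fun x => c%:E * f^\+ x)%E.
  by apply/funext => x; rewrite !funeposE maxe_pMr ?mule0// lee_fin ltW.
have -> : (fun x => c%:E * f x)^\-%E = (fun x => c%:E * f^\- x)%E.
  by apply/funext => x; rewrite !funenegE -muleN maxe_pMr ?mule0// lee_fin ltW.
rewrite !cE//; [|exact: measurable_funeneg|exact: measurable_funepos].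
have : (0 <= \int[mu]_x f^\+ x)%E by exact: integral_ge0.
have : (0 <= \int[mu]_x f^\- x)%E by exact: integral_ge0.
have cy : (c%:E * +oo = +oo)%E by rewrite gt0_muley ?lte_fin.
have cNy : (c%:E * -oo = -oo)%E by rewrite gt0_muleNy ?lte_fin.
move: (\int[mu]_x f^\- x)%E (\int[mu]_x f^\+ x)%E => [u| |] [v| |] //= _ _.
- by rewrite -!EFinM -!EFinB mulrBr.
- by rewrite cy.
- by rewrite cy ?cNy.
- by rewrite cy ?cNy.
Qed.

(* An alias of mu to which the structure deduced from the proof can be attached. *)
Definition sigma_finite_copy d (T : measurableType d) (R : realType)
  (mu : {measure set T -> \bar R}) (_ : sigma_finite setT mu) : set T -> \bar R := mu.

HB.instance Definition _ d (T : measurableType d) (R : realType)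
    (mu : {measure set T -> \bar R}) (H : sigma_finite setT mu) :=
  Measure.copy (sigma_finite_copy H) (Measure.sort mu).

HB.instance Definition _ d (T : measurableType d) (R : realType)
    (mu : {measure set T -> \bar R}) (H : sigma_finite setT mu) :=
  Measure_isSigmaFinite.Build _ _ _ (sigma_finite_copy H) H.

Definition probability_copy d (T : measurableType d) (R : realType)
  (mu : {measure set T -> \bar R}) (_ : mu setT = 1%E) : set T -> \bar R := mu.

HB.instance Definition _ d (T : measurableType d) (R : realType)
    (mu : {measure set T -> \bar R}) (H : mu setT = 1%E) :=
  Measure.copy (probability_copy H) (Measure.sort mu).

HB.instance Definition _ d (T : measurableType d) (R : realType)
    (mu : {measure set T -> \bar R}) (H : mu setT = 1%E) :=
  Measure_isProbability.Build _ _ _ (probability_copy H) H.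

Lemma measurable_l2norm_sub (R : realType) (n : nat) :
  measurable_fun setT (fun xz : borel 'rV[R]_n * borel 'rV[R]_n => l2norm (xz.1 - xz.2 : 'rV[R]_n)).
Proof.
rewrite /l2norm; apply: measurableT_comp.
  by apply: continuous_measurable_fun; exact: sqrt_continuous.
apply: measurable_sum => i; rewrite (_ : (fun xz => _) =
  (fun xz : borel 'rV[R]_n * borel 'rV[R]_n => ((xz.1 : 'rV_n) 0 i - (xz.2 : 'rV_n) 0 i) ^+ 2)); last first.
  by apply/funext => xz; rewrite !mxE.
by apply/measurable_funX/measurable_funB; apply: measurableT_comp (coord_borel i) _.
Qed.

Section density_transport.
Context {R : realType} {n : nat}.
Local Notation V := 'rV[R]_n.+1.
Variable lambda : {measure set (borel V) -> \bar R}.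
Hypothesis lambdaE : is_lebesgue lambda.
Context d (X : measurableType d).
Variable vol : {measure set X -> \bar R}.
Variables (Phi : X -> borel V) (Psi : borel V -> X).
Hypothesis mPhi : measurable_fun setT Phi.
Hypothesis mPsi : measurable_fun setT Psi.
Hypothesis PhiK : cancel Phi Psi.
Variable J : V -> R.
Hypothesis mJ : measurable_fun setT (J : borel V -> R).
Hypothesis J0 : forall y, 0 <= J y.
Hypothesis vol_le : forall B : set (borel V), measurable B ->
  (vol (Phi @^-1` B) <= \int[lambda]_(y in B) (J y)%:E)%E.
Variable rho : X -> R.
Hypothesis rhoP : prob_density vol rho.

Lemma lebesgue_sigma_finite : sigma_finite setT lambda.
Proof.
exists (fun k => cube (const_mx (- k.+1%:R)) (2 * k.+1%:R : R)).
  apply/seteqP; split=> // x _; exists (Num.truncn `|x|) => // i.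
  have xi : `|x 0 i| < (Num.truncn `|x|).+1%:R.
    by apply: le_lt_trans (coord_le_norm x i) _; exact: truncnS_gt.
  by move: xi; rewrite mxE ltr_norml => /andP[h1 h2]; apply/andP; split; lra.
move=> k; split; first exact: cube_measurable.
by rewrite lebesgue_cube ?ltry// mulr_gt0.
Qed.

(* The Radon-Nikodym density satisfies the bound almost everywhere; its minimum with the bound is
   still a density and satisfies it everywhere. *)
Lemma exists_transported_density : exists (P : probability (borel V) R) (p : V -> R),
  [/\ forall B, measurable B -> P B = (\int[vol]_(x in Phi @^-1` B) (rho x)%:E)%E,
      forall B, measurable B -> P B = (\int[lambda]_(x in B) (p x)%:E)%E,
      prob_density lambda p &
      forall y, p y <= rho (Psi y) * J y].
Proof.
have [mrho rho0 rho1] := rhoP.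
have [P PE] := exists_image_weighted vol mPhi mrho rho0.
have P1 : P setT = 1%E by rewrite PE preimage_setT.
have [nu nuE] := exists_image_measure vol mPhi.
pose f (y : borel V) := rho (Psi y).
have mf : measurable_fun setT f by exact: measurableT_comp.
have f0 y : 0 <= f y by exact: rho0.
have mfJ : measurable_fun setT (fun y : borel V => f y * J y) by exact: measurable_funM.
have Ple B : measurable B -> (P B <= \int[lambda]_(y in B) (f y * J y)%:E)%E.
  move=> mB; rewrite PE// integral_mkcond [leRHS]integral_mkcond.
  have mfB : measurable_fun setT ((fun y => (f y)%:E) \_ B : borel V -> \bar R).
    have mEf : measurable_fun setT (EFin \o f) by exact/measurable_EFinP.
    exact: (measurable_restrictT (EFin \o f) mB).1 (measurable_funTS mEf).
  have fB0 y : (0 <= ((fun y => (f y)%:E) \_ B) y)%E.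
    by rewrite /patch; case: ifP => _; rewrite ?lee_fin.
  have m1 : measurable_fun setT (fun _ : X => (1 : R)) by exact: measurable_cst.
  have := @integral_image_weighted _ _ _ _ _ vol Phi (fun=> 1) mPhi m1 (fun=> ler01) nu _ _ mfB fB0.
  have := @integral_image_weighted_le _ _ _ _ _ lambda (@id (borel V)) J (@measurable_id _ _ _) mJ J0 nu _ _ mfB fB0.
  move=> H1 H2.
  apply: (@le_trans _ _ (\int[nu]_y ((fun y => (f y)%:E) \_ B) y)%E).
    rewrite H2 => [|B' mB']; last first.
      by rewrite nuE// integral_cst ?mul1e// -[X in measurable X]setTI; exact: mPhi.
    apply: le_integralT => x; rewrite mule1 /patch; case: ifPn => //.
      by rewrite in_setE => BPhi; rewrite mem_set// /f PhiK.
    by rewrite notin_setE => BPhi; rewrite memNset.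
  apply: (le_trans (H1 _)) => [B' mB'|].
    by rewrite nuE//; exact: vol_le.
  by apply: le_integralT => y; rewrite /patch; case: ifP => _; rewrite ?mul0e.
pose lam : {sigma_finite_measure set (borel V) -> \bar R} := sigma_finite_copy lebesgue_sigma_finite.
pose PP : probability (borel V) R := probability_copy P1.
have dom : PP `<< lam.
  apply/null_content_dominatesP => B mB lB0.
  apply/eqP; rewrite eq_le measure_ge0 andbT; apply: le_trans (Ple _ mB) _.
  by rewrite null_set_integral//; exact/measurable_EFinP/measurable_funTS.
have [q0 [q00 q0f q0i q0E]] := radon_nikodym_sigma_finite dom.
pose q (y : borel V) := fine (q0 y).
have qE y : (q y)%:E = q0 y by rewrite fineK.
have mq : measurable_fun setT q.
  by apply/measurable_EFinP; rewrite (_ : _ \o _ = q0); [exact: measurable_int q0i|exact/funext].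
have q_ge0 y : 0 <= q y by rewrite fine_ge0.
pose p (y : borel V) := Num.min (q y) (f y * J y).
have mp : measurable_fun setT p by exact: measurable_minr.
have p0 y : 0 <= p y by rewrite le_min q_ge0 mulr_ge0.
have PpE B : measurable B -> P B = (\int[lambda]_(x in B) (p x)%:E)%E.
  move=> mB; apply/eqP; rewrite eq_le; apply/andP; split; last first.
    have -> : P B = (\int[lambda]_(x in B) (q x)%:E)%E.
      by rewrite [LHS](q0E B mB); apply: eq_integral => y _; rewrite qE.
    by apply: le_integral_in => y _; rewrite lee_fin ge_min lexx.
  (* Outside N the minimum is q, and the Radon-Nikodym formula applies; on N it is the bound itself,
     whose integral dominates P by [Ple]. *)
  pose N := [set y : borel V | f y * J y < q y].
  have mN : measurable N.
    have m1 : measurable_fun setT (fun y : borel V => (f y * J y)%:E) by exact/measurable_EFinP.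
    have m2 : measurable_fun setT (fun y : borel V => (q y)%:E) by exact/measurable_EFinP.
    by have := measurable_lte measurableT m1 m2; rewrite setTI.
  have mBN : measurable (B `&` N) by exact: measurableI.
  have mBN' : measurable (B `\` N) by exact: measurableD.
  have BE : B = (B `\` N) `|` (B `&` N) by rewrite setUC setUIDK.
  have dBN : [disjoint B `\` N & B `&` N].
    by apply/disj_setPS => y [[_ Ny] [_]].
  rewrite [in leRHS]BE ge0_integral_setU//; last 2 first.
  - by apply/measurable_EFinP/measurable_funTS.
  - by move=> y _; rewrite lee_fin.
  rewrite [in leLHS]BE measureU//; last by apply/eqP; rewrite -disj_set2E//; exact/disj_set2P.
  apply: leeD.
    rewrite [leLHS](q0E _ mBN'); apply: le_integral_in => y [_ /negP].
    by rewrite -leNgt => h; rewrite -qE lee_fin /p le_min lexx.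
  apply: le_trans (Ple _ mBN) _; apply: le_integral_in => y [_ h].
  by rewrite lee_fin /p le_min lexx ltW.
exists PP, p; split; [by move=> B _; exact: PE|exact: PpE| |]; last by move=> y; rewrite ge_min lexx orbT.
by split=> //; rewrite -PpE// P1.
Qed.



End density_transport.

Lemma muleDl_dual (R : realType) (c : R) (a b : \bar R) : 0 < c ->
  (c%:E * (a + b)%dE = (c%:E * a + c%:E * b)%dE)%E.
Proof.
move=> c0; have cy : (c%:E * +oo = +oo)%E by rewrite gt0_muley ?lte_fin.
have cNy : (c%:E * -oo = -oo)%E by rewrite gt0_muleNy ?lte_fin.
by case: a b => [a| |] [b| |] /=; rewrite ?cy ?cNy //; congr EFin; exact: mulrDr.
Qed.

Lemma addeE_dual (R : realType) (a : \bar R) (c : R) : (a + c%:E = (a + c%:E)%dE)%E.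
Proof. by case: a => [a| |]. Qed.

Section log_HLS_transport.
Context {R : realType} {n : nat}.
Local Notation V := 'rV[R]_n.+1.
Variable lambda : {measure set (borel V) -> \bar R}.
Hypothesis lambdaE : is_lebesgue lambda.
Context d (X : measurableType d).
Variable vol : {measure set X -> \bar R}.
Variables (Phi : X -> borel V) (Psi : borel V -> X).
Hypothesis mPhi : measurable_fun setT Phi.
Hypothesis mPsi : measurable_fun setT Psi.
Hypothesis PhiK : cancel Phi Psi.
Variable L : V -> R.
Hypothesis mL : measurable_fun setT (L : borel V -> R).
Hypothesis L0 : forall y, 0 <= L y.
Hypothesis vol_le : forall B : set (borel V), measurable B ->
  (vol (Phi @^-1` B) <= \int[lambda]_(y in B) (expR (L y))%:E)%E.
Variable rho : X -> R.
Hypothesis rhoP : prob_density vol rho.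

(** Everything is stated through Phi, with L the logarithm of the density bound, so no geometry
    remains. The Euclidean inequality is applied to the transported density p, and each integral is
    carried back through the image measure P. *)
Lemma log_HLS_transport (C0 : R) : log_HLS_constant lambda C0 ->
  (\int[vol]_x (ln (1 + l2norm (Phi x : V) ^+ 2) * rho x)%:E < +oo)%E ->
  (- (\int[vol]_x \int[vol]_y (ln (l2norm (Phi x - Phi y : V)) * rho x * rho y)%:E) <=
   ((n.+1%:R^-1)%:E * (\int[vol]_x (rho x * ln (rho x))%:E)%E
    + (n.+1%:R^-1)%:E * (\int[vol]_x (L (Phi x) * rho x)%:E)%E + C0%:E)%dE)%E.
Proof.
move=> HLS logm; have [mrho rho0 rho1] := rhoP.
have mJ : measurable_fun setT (fun y : borel V => expR (L y)) by exact: measurableT_comp.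
have [P [p [PE PpE [mp p0 p1] ple]]] := exists_transported_density lambdaE mPhi mPsi PhiK mJ
  (fun y => expR_ge0 _) vol_le rhoP.
have trP f : measurable_fun setT f ->
    (\int[P]_y f y = \int[vol]_x (f (Phi x) * (rho x)%:E))%E.
  by move=> mf; rewrite (integral_image_weightedT mPhi mrho rho0 PE mf).
have tr f : measurable_fun setT f ->
    (\int[lambda]_y (f y * (p y)%:E) = \int[P]_y f y)%E.
  by move=> mf; rewrite (integral_image_weightedT (@measurable_id _ _ _) mp p0 PpE mf).
have ml2 : measurable_fun setT (fun x : borel V => l2norm (x : V)).
  rewrite (_ : (fun x => _) = (fun xz : borel V * borel V => l2norm (xz.1 - xz.2 : V)) \o (fun x => (x, 0))).
    apply: (measurableT_comp (@measurable_l2norm_sub R n.+1)).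
    by apply: measurable_fun_pair => //; exact: measurable_cst.
  by apply/funext => x /=; rewrite subr0.
have mlog2 : measurable_fun setT (fun xz : borel V * borel V => (ln (l2norm (xz.1 - xz.2 : V)))%:E : \bar R).
  by apply/measurable_EFinP; apply: measurableT_comp (@measurable_l2norm_sub R n.+1); exact: measurable_ln.
have mlog1 x : measurable_fun setT (fun z : borel V => (ln (l2norm (x - z : V)))%:E : \bar R).
  have mx : measurable_fun setT (fun z : borel V => ((x : borel V), z)).
    by apply: measurable_fun_pair => //; exact: measurable_cst.
  exact: (measurableT_comp mlog2 mx).
pose k (x : borel V) := (\int[P]_z (ln (l2norm (x - z : V)))%:E)%E.
have mk : measurable_fun setT k by exact: (@measurable_integral_snd _ _ _ _ _ P _ mlog2).
(* Both double integrals equal the double integral of the kernel ln |x - z| against P in each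
   variable. *)
have -> : (\int[vol]_x \int[vol]_y (ln (l2norm (Phi x - Phi y : V)) * rho x * rho y)%:E =
    \int[lambda]_x \int[lambda]_y (ln (l2norm (x - y)) * p x * p y)%:E)%E.
  transitivity (\int[P]_x k x)%E.
    rewrite trP//; apply: eq_integral => x _; rewrite muleC /k trP// -integralZl_nneg//.
      by apply: eq_integral => y _; rewrite -!EFinM; congr EFin; ring.
    apply: emeasurable_funM; first exact: (measurableT_comp (mlog1 (Phi x)) mPhi).
    exact/measurable_EFinP.
  rewrite -tr//; apply: eq_integral => x _; rewrite muleC /k -tr// -integralZl_nneg//.
    by apply: eq_integral => y _; rewrite -!EFinM; congr EFin; ring.
  by apply: emeasurable_funM => //; exact/measurable_EFinP.
have mln2 : measurable_fun setT (fun x : borel V => (ln (1 + l2norm (x : V) ^+ 2))%:E : \bar R).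
  apply/measurable_EFinP; apply: measurableT_comp; first exact: measurable_ln.
  by apply: measurable_funD; [exact: measurable_cst|exact: measurable_funX].
have mom : (\int[lambda]_x (ln (1 + l2norm x ^+ 2) * p x)%:E < +oo)%E.
  by have := logm; rewrite -(trP _ mln2) -tr.
apply: le_trans (HLS p _ mom) _; first by split.
(* C0 is finite, so the usual and the dual addition agree for this term. *)
rewrite addeE_dual; apply: DualAddTheoryRealDomain.lee_dD => //; rewrite -muleDl_dual ?invr_gt0//.
apply: lee_wpmul2l; first by rewrite lee_fin invr_ge0.
pose g (y : borel V) := ln (rho (Psi y) * expR (L y)).
have mg : measurable_fun setT g.
  apply: measurableT_comp; first exact: measurable_ln.
  by apply: measurable_funM => //; exact: measurableT_comp.
apply: (@le_trans _ _ (\int[lambda]_y ((g y)%:E * (p y)%:E))%E).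
  apply: le_integralT => y; rewrite -EFinM lee_fin mulrC.
  have := p0 y; rewrite le_eqVlt => /predU1P[<-|py]; first by rewrite !mulr0.
  by rewrite ler_pM2r// ler_ln ?posrE//; exact: lt_le_trans (ple y).
rewrite tr ?trP; [|exact/measurable_EFinP..].
rewrite (_ : (\int[vol]_x _)%E = (\int[vol]_x (rho x * ln (rho x) + L (Phi x) * rho x)%:E)%E); last first.
  apply: eq_integral => x _; rewrite -EFinM /g PhiK; congr EFin.
  (* Where rho vanishes the logarithm of the product does not split, but the factor rho makes every
     term 0. *)
  have := rho0 x; rewrite le_eqVlt => /predU1P[<-|rx]; first by rewrite !(mulr0, mul0r, addr0).
  by rewrite lnM ?posrE// ?expR_gt0// expRK; ring.
apply: integral_add_le_dual.
- by apply: measurable_funM => //; apply: measurableT_comp => //; exact: measurable_ln.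
- by apply: measurable_funM => //; exact: (measurableT_comp mL mPhi).
- by move=> x; rewrite mulr_ge0.
Qed.

End log_HLS_transport.

(** * The model density *)

Section sinhc.
Context {R : realType}.
Implicit Types r s t : R.

Definition sinhc r : R := if r == 0 then 1 else sinh r / r.

(** At r = 0 the quotient is 0 / 0 = 0 and ln 0 = 0 = ln 1, so the expression in the theorem has the
    right value at the pole as well. *)
Lemma ln_sinhc r : ln (sinhc r) = ln (sinh r / r).
Proof. by rewrite /sinhc; case: eqP => [->|//]; rewrite invr0 mulr0 ln1 ln0. Qed.

Lemma sinhN t : sinh (- t) = - sinh t.
Proof. by rewrite /sinh opprK -opprB mulNr. Qed.

Lemma sinhc_ge1 r : 0 <= r -> 1 <= sinhc r.
Proof.
rewrite le_eqVlt => /predU1P[<-|r0]; first by rewrite /sinhc eqxx.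
by rewrite /sinhc gt_eqF// ler_pdivlMr// mul1r sinh_ge// ltW.
Qed.

Lemma sinh_le_mul_cosh t : 0 <= t -> sinh t <= t * cosh t.
Proof.
move=> t0; have d (u : R) : -1 < u ->
    is_derive u 1 (fun s : R => s * cosh (1 * s) - sinh (1 * s)) (u * sinh u).
  move=> _; have ds := is_derive_sinh 1 u; have dc := is_derive_cosh 1 u.
  apply: is_derive_eq; rewrite /GRing.scale /= !mul1r; ring.
have u0 (u : R) : -1 < u -> 0 <= u * sinh u.
  move=> _; have [u0|u0] := leP 0 u; first by rewrite mulr_ge0// (le_trans u0)// sinh_ge.
  by rewrite -mulrNN mulr_ge0 -?sinhN ?oppr_ge0 ?(ltW u0)// (le_trans _ (sinh_ge _))// oppr_ge0 ltW.
have := ge0_deriv_ndecr d u0 (ltrN10 R) t0.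
by rewrite !mulr0 !mul1r mul0r /sinh oppr0 subrr mul0r subrr -/(sinh t) subr_ge0.
Qed.

Lemma sinhc_le r s : 0 <= r -> r <= s -> sinhc r <= sinhc s.
Proof.
rewrite le_eqVlt => /predU1P[<-|r0] rs; first by rewrite {1}/sinhc eqxx sinhc_ge1.
rewrite /sinhc !gt_eqF ?(lt_le_trans r0)//.
pose f (s : R) := sinh s / s; pose f' t := (t * cosh t - sinh t) / t ^+ 2.
have df t : 0 < t -> is_derive t 1 f (f' t).
  move=> t0; have ds := is_derive_sinh 1 t.
  have {}ds : is_derive t 1 (fun s : R => sinh s) (cosh t).
    by move: ds; rewrite !mul1r; under eq_fun do rewrite mul1r.
  have t0' : t != 0 by rewrite gt_eqF.
  have di : is_derive t 1 (fun s : R => s^-1) (- t ^- 2 *: 1) by exact: is_deriveV t0' (is_derive_id t (1 : R)).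
  by apply: is_derive_eq; rewrite /GRing.scale /= /f'; field.
apply: (ge0_deriv_ndecr df) rs => // t t0.
by rewrite divr_ge0 ?sqr_ge0// subr_ge0 sinh_le_mul_cosh// ltW.
Qed.

Lemma sinhc_continuous r : r != 0 -> {for r, continuous sinhc}.
Proof.
move=> r0; have E : \forall s \near r, sinh s / s = sinhc s.
  have : \forall s \near r, s != 0 by exact: (@cvgr_neq0 R R^o _ (nbhs r) _ id r cvg_id r0).
  by apply: filterS => s s0; rewrite /sinhc (negbTE s0).
apply: (near_eq_continuous E).
have c : {for r, continuous (fun s : R => sinh s)}.
  have /is_derive_continuous := is_derive_sinh 1 r.
  by under [X in {for r, continuous X}]eq_fun do rewrite mul1r.
by apply: continuousM => //; apply: continuousV => //; exact: cvg_id.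
Qed.

End sinhc.

Section l2norm.
Context {R : realType} {n : nat}.
Implicit Types x y : 'rV[R]_n.

Lemma l2norm_ge0 x : 0 <= l2norm x.
Proof. exact: sqrtr_ge0. Qed.

Lemma l2norm0 : l2norm (0 : 'rV[R]_n) = 0.
Proof. by rewrite /l2norm big1 ?sqrtr0// => i _; rewrite mxE expr0n. Qed.

Lemma l2norm_eq0 x : (l2norm x == 0) = (x == 0).
Proof.
apply/idP/eqP => [|->]; last by rewrite l2norm0.
rewrite sqrtr_eq0 => H; apply/rowP => i; rewrite mxE; apply/eqP.
rewrite -sqrf_eq0 eq_le sqr_ge0 andbT; apply: le_trans H.
by rewrite (bigD1 i)//= lerDl sumr_ge0// => k _; exact: sqr_ge0.
Qed.

Lemma l2normB x y : l2norm (x - y) = l2norm (y - x).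
Proof. by rewrite /l2norm; congr Num.sqrt; apply: eq_bigr => i _; rewrite !mxE -sqrrN opprB. Qed.

Lemma l2norm_continuous : continuous (l2norm : 'rV[R]_n -> R).
Proof.
move=> x; apply: continuous_comp; last exact: sqrt_continuous.
apply: continuous_bigsum => i; apply: (@continuous_comp _ _ _ (fun x : 'rV[R]_n => x 0 i) (fun u : R => u ^+ 2)).
  exact: (@row_entry_continuous _ _ _ id x i).
exact: exprn_continuous.
Qed.

Lemma l2norm_cube_bounded (a : 'rV[R]_n) (r : R) : exists C, forall z, cube a r z -> l2norm z <= C.
Proof.
exists (Num.sqrt (\sum_i (`|a 0 i| + `|r|) ^+ 2)) => z Hz; apply: ler_wsqrtr.
apply: ler_sum => i _; have /andP[h1 h2] := Hz i.
rewrite -[z 0 i ^+ 2]real_normK ?num_real// ler_sqr ?nnegrE ?addr_ge0//.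
have := ler_norm (a 0 i); have := ler_norm (- a 0 i); have := ler_norm r; have := normr_ge0 r.
by rewrite normrN ler_norml => *; apply/andP; split; lra.
Qed.

End l2norm.

Section model_density.
Context {R : realType} {n : nat} (m : nat).
Local Notation V := 'rV[R]_n.
Variable k : R.
Hypothesis k0 : 0 < k.

Definition model_density (y : V) : R := sinhc (k * l2norm y) ^+ m.

Lemma model_densityE (y : V) : model_density y =
  if y == 0 then 1 else (sinh (k * l2norm y) / (k * l2norm y)) ^+ m.
Proof.
rewrite /model_density /sinhc mulf_eq0 gt_eqF//= l2norm_eq0.
by case: ifP; rewrite ?expr1n.
Qed.

Lemma model_density_ge1 y : 1 <= model_density y.
Proof. by rewrite exprn_ege1// sinhc_ge1// mulr_ge0 ?l2norm_ge0// ltW. Qed.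

(** At y = 0 the value 1 is the minimum, so lower semicontinuity there needs no expansion of sinh;
    elsewhere the function is continuous. *)
Lemma model_density_lsc y (e : R) : 0 < e -> \forall z \near y, model_density y - e < model_density z.
Proof.
move=> e0; have [->|y0] := eqVneq y 0.
  near=> z; apply: lt_le_trans (model_density_ge1 z).
  by rewrite model_densityE eqxx ltrBlDr ltrDl.
have : {for y, continuous model_density}.
  apply: (@continuous_comp _ _ _ (fun z : V => sinhc (k * l2norm z)) (fun u : R => u ^+ m)); last exact: exprn_continuous.
  apply: (@continuous_comp _ _ _ (fun z : V => k * l2norm z) sinhc).
    by apply: continuousM; [exact: cst_continuous|exact: l2norm_continuous].
  by apply: sinhc_continuous; rewrite mulf_eq0 gt_eqF//= l2norm_eq0.
by move=> c; apply: (cvgr_gt _ c); rewrite ltrBlDr ltrDl.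
Unshelve. all: by end_near. Qed.

Lemma model_density_bounded (a : V) (r : R) : exists C, forall z, cube a r z -> model_density z <= C.
Proof.
have [C HC] := l2norm_cube_bounded a r; exists (sinhc (k * C) ^+ m) => z az.
have h : 0 <= k * l2norm z by rewrite mulr_ge0 ?l2norm_ge0// ltW.
apply: lerXn2r; rewrite ?nnegrE ?(le_trans ler01) ?sinhc_ge1//.
  by apply: (le_trans h); rewrite ler_pM2l// HC.
by apply: sinhc_le => //; rewrite ler_pM2l// HC.
Qed.

End model_density.

(* The right-hand side is summed with the dual addition, -oo + +oo = +oo: the
   negative part of rho log rho can only fail to be integrable when the second
   integral is +oo, and nothing is claimed in that indeterminate case. *)
Theorem theorem5p2 (R : realType) (n : nat) (n_gt0 : (0 < n)%N)
    (lambda : {measure set (borel 'rV[R]_n) -> \bar R})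
    (lambda_lebesgue : is_lebesgue lambda)
    (C0 : R) (C0_HLS : log_HLS_constant lambda C0)
    (M : riemannianManifold R n) (M_CH : cartan_hadamard M)
    (o : M) (o_pole : pole o)
    (vol : {measure set (borel M) -> \bar R})
    (vol_riemannian : is_riemannian_volume lambda vol)
    (cm : R) (cm_gt0 : 0 < cm)
    (curv : forall (x : M) (s : 'M[R]_(2, n)), row_free s ->
       - cm <= sectional_curvature x s <= 0)
    (rho : M -> R) (rho_density : prob_density vol rho)
    (rho_log : (\int[vol]_x (ln (1 + `|dist o x| ^+ 2) * rho x)%:E < +oo)%E) :
  (- (\int[vol]_x \int[vol]_y (ln (dist x y) * rho x * rho y)%:E) <=
   ((n%:R^-1)%:E * (\int[vol]_x (rho x * ln (rho x))%:E)%E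
    + ((n%:R - 1) / n%:R)%:E *
      (\int[vol]_x
        (ln (sinh (Num.sqrt cm * dist o x) / (Num.sqrt cm * dist o x))
         * rho x)%:E)%E
    + C0%:E)%dE)%E.
Proof.
(* With n = m + 1 the exponent n - 1 of the model density is m. *)
destruct n as [|m]; first by [].
have [Phi [Psi [[PhiK PsiK Phic Psic] Phi_le dist0 Phio loc]]] := polar_coordinates o_pole cm_gt0 curv.
set k := Num.sqrt cm in loc *; have k0 : 0 < k by rewrite sqrtr_gt0.
have J1 := @model_density_ge1 R m.+1 m k k0.
have J0 y : 0 <= @model_density R m.+1 m k y by apply: le_trans (J1 y).
have lsc e := @model_density_lsc R m.+1 e k k0.
(* Used with exponent m for the density and with exponent 1 for its base once the logarithm is
   taken. *)
have mJ e : measurable_fun setT (@model_density R m.+1 e k : borel _ -> R).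
  exact: lower_semicontinuous_borel (lsc e).
have lnJ y : expR (ln (@model_density R m.+1 m k y)) = @model_density R m.+1 m k y.
  by rewrite lnK// posrE (lt_le_trans ltr01).
have volJ (B : set (borel 'rV[R]_m.+1)) : measurable B ->
    (vol (Phi @^-1` B) <= \int[lambda]_(y in B) (expR (ln (@model_density R m.+1 m k y)))%:E)%E.
  move=> mB; under eq_integral do rewrite lnJ.
  apply: (@volume_comparison _ _ _ lambda_lebesgue _ _ vol_riemannian _ _ PhiK Phic Psic _ J0 (lsc m)) => //.
    exact: model_density_bounded.
  by move=> y; have [i [A [iy uA est dA]]] := loc y; exists i, A; split=> //; rewrite model_densityE.
have mL : measurable_fun setT (fun y : borel 'rV[R]_m.+1 => ln (@model_density R m.+1 m k y)).
  by apply: measurableT_comp (mJ m); exact: measurable_ln.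
have L0 y : 0 <= ln (@model_density R m.+1 m k y) by exact: ln_ge0.
have mPhi : measurable_fun setT (Phi : borel M -> borel 'rV[R]_m.+1) by exact: continuous_borel.
have mPsi : measurable_fun setT (Psi : borel 'rV[R]_m.+1 -> borel M) by exact: continuous_borel.
have [mrho rho0 _] := rho_density.
have Phi_dist x : l2norm (Phi x) <= dist o x by have := Phi_le o x; rewrite Phio subr0.
have mom : (\int[vol]_x (ln (1 + l2norm (Phi x) ^+ 2) * rho x)%:E < +oo)%E.
  apply: le_lt_trans rho_log; apply: le_integralT => x; rewrite lee_fin ler_wpM2r//.
  rewrite ler_ln ?posrE ?ltr_pwDl ?sqr_ge0// lerD2l ler_sqr ?nnegrE ?l2norm_ge0//.
  by rewrite (le_trans (Phi_dist x))// ler_norm.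
apply: le_trans (le_trans (log_HLS_transport lambda_lebesgue mPhi mPsi PhiK mL L0 volJ rho_density C0_HLS mom) _).
  rewrite leeN2; apply: le_integralT => x; apply: le_integralT => y.
  rewrite lee_fin -!mulrA ler_wpM2r ?mulr_ge0//.
  (* On the diagonal both distances are 0 and both sides contain ln 0, so no monotonicity of the
     logarithm is needed there. *)
  have [/(can_inj PhiK) <-|xy] := eqVneq (Phi x) (Phi y); first by rewrite subrr l2norm0 dist0.
  have l0 : 0 < l2norm (Phi x - Phi y) by rewrite lt_def l2norm_eq0 subr_eq0 xy l2norm_ge0.
  have le : l2norm (Phi x - Phi y) <= dist x y by rewrite l2normB.
  by rewrite ler_ln ?posrE// (lt_le_trans l0).
do 2!apply: DualAddTheoryRealDomain.lee_dD => //.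
have m1 : measurable_fun setT (fun x : borel M => (ln (sinhc (k * l2norm (Phi x))) * rho x)%:E : \bar R).
  apply/measurable_EFinP/measurable_funM => //; apply: measurableT_comp; first exact: measurable_ln.
  exact: (measurableT_comp (mJ 1%N) mPhi).
(* The logarithm of the m-th power brings out the factor m = n - 1 of the statement. *)
rewrite (eq_integral (fun x : borel M => m%:R%:E * (ln (sinhc (k * l2norm (Phi x))) * rho x)%:E)%E); last first.
  move=> x _; rewrite -EFinM mulrA /model_density lnXn ?mulr_natl//.
  by rewrite (lt_le_trans ltr01)// sinhc_ge1// mulr_ge0 ?l2norm_ge0// ltW.
rewrite integralZl_nneg// muleA -EFinM mulrC -[m.+1%:R]natr1 addrK.
apply: lee_wpmul2l; first by rewrite lee_fin mulr_ge0// invr_ge0 addr_ge0.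
apply: le_integralT => x; rewrite lee_fin -ln_sinhc ler_wpM2r//.
have l0 : 0 <= k * l2norm (Phi x) by rewrite mulr_ge0 ?l2norm_ge0// ltW.
have le : k * l2norm (Phi x) <= k * dist o x by rewrite ler_pM2l.
rewrite ler_ln ?posrE ?(lt_le_trans ltr01) ?sinhc_ge1// ?sinhc_le//; exact: le_trans le.
Qed.
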